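(* Let $\eta$ be a weight kernel on $\mathbb{R}^d$ satisfying (E1)–(E5) and $\theta$ an interpolation function satisfying (T1)–(T7) (see context), and let $\mathcal{W}_{\eta,\theta}$ be the nonlocal Wasserstein distance with Lebesgue reference measure. Let $\delta_0$ be the Dirac measure at the origin and let $\nu$ be any compactly supported probability measure on $\mathbb{R}^d$ singular to $\delta_0$. Then: (i) If $\theta(1,0)=0$ and $\int_{B(0,1)}\eta(|y|)\,dy<\infty$, then $\mathcal{W}_{\eta,\theta}(\delta_0,\nu)=\infty$. (ii) If $\theta(1,0)>0$ and $\int_{B(0,1)}\eta(|y|)\,dy<\infty$, then $\infty>\mathcal{W}_{\eta,\theta}(\delta_0,\nu)\ge 2\left(\int_{\mathbb{R}^d}\eta(|y|)\,dy\right)^{-1/2}$. (iii) If instead there exist $s>0$, $\delta>0$ and $c>0$ such that $\eta(|y|)\ge c|y|^{-d-s}$ whenever $0<|y|\le\delta$, then $$\mathcal{W}_{\eta,\theta}(\delta_0,\mathfrak{m}_{B(0,\delta)})\le C\,\delta^{s/2},$$ where $\mathfrak{m}_{B(0,\delta)}$ is the uniform probability measure on $B(0,\delta)$ and $C$ is a constant depending only on $d,s,c,\theta$. In particular, $\inf\{\mathcal{W}_{\eta,\theta}(\delta_0,\nu'):\nu'\in\mathcal{P}(\mathbb{R}^d),\ \nu'\perp\delta_0\}=0$.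
   Context: Weight kernel. $\eta:\{(x,y)\in\mathbb{R}^d\times\mathbb{R}^d: x\ne y\}\to[0,\infty)$ satisfies: (E1) $\eta$ is continuous on the set $\{\eta>0\}$; (E2) $\eta$ is isotropic: $\eta(x,y)$ depends only on $|x-y|$, and the radial profile $(0,\infty)\to[0,\infty)$ is again denoted $\eta$, so $\eta(x,y)=\eta(|x-y|)$; (E3) the radial profile is non-increasing; (E4) $\int_{\mathbb{R}^d}(1\wedge|y|^2)\,\eta(|y|)\,dy<\infty$; (E5) the support of the radial profile contains $(0,1]$. Interpolation. $\theta:[0,\infty)\times[0,\infty)\to[0,\infty)$ satisfies: (T1) $\theta$ is continuous, and $C^1$ on $(0,\infty)^2$; (T2) $\theta(s,t)=\theta(t,s)$; (T3) $\theta(s,t)>0$ for $s,t>0$ and $\theta(1,1)=1$; (T4) $\theta(r,t)\le\theta(s,t)$ for $0\le r\le s$, $t\ge0$; (T5) $\theta(\lambda s,\lambda t)=\lambda\theta(s,t)$ for $\lambda>0$, $s,t\ge0$; (T6) $\theta$ is concave; (T7) $\int_0^1\frac{dr}{\theta(1-r,1+r)}<\infty$. Let $G=\{(x,y):x\ne y,\ \eta(x,y)>0\}$, and let $\mathcal{M}_{loc}(G)$ be the space of locally finite signed Radon measures on $G$ (weak* topology in duality with $C_c(G)$). Action. For $\mu\in\mathcal{P}(\mathbb{R}^d)$, $\mathbf{j}\in\mathcal{M}_{loc}(G)$, $$\mathcal{A}(\mu,\mathbf{j})=\frac12\iint_G\frac{\left(\frac{d\mathbf{j}}{d\lambda}\right)^2}{\theta\left(\frac{d(\mu\otimes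 \mathrm{Leb})}{d\lambda},\frac{d(\mathrm{Leb}\otimes\mu)}{d\lambda}\right)}\eta\,d\lambda,$$ where $\lambda$ is any nonnegative locally finite measure on $G$ dominating $|\mathbf{j}|,\mu\otimes\mathrm{Leb},\mathrm{Leb}\otimes\mu$ (the value is independent of $\lambda$), with $\frac00=0$ and $\frac a0=+\infty$ for $a>0$. Nonlocal continuity equation. $(\mu_t,\mathbf{j}_t)_{t\in[0,1]}\in\mathcal{CE}(\nu,\sigma)$ means: $t\mapsto\mu_t\in\mathcal{P}(\mathbb{R}^d)$ is narrowly continuous, $t\mapsto\mathbf{j}_t\in\mathcal{M}_{loc}(G)$ is weak* Borel, $\mu_0=\nu$, $\mu_1=\sigma$, and for all $\varphi\in C_c^\infty((0,1)\times\mathbb{R}^d)$ (all integrals understood to converge absolutely) $$\int_0^1\!\int_{\mathbb{R}^d}\partial_t\varphi_t\,d\mu_t\,dt+\frac12\int_0^1\!\iint_G(\varphi_t(y)-\varphi_t(x))\,\eta(x,y)\,d\mathbf{j}_t(x,y)\,dt=0.$$ Distance. $\mathcal{W}_{\eta,\theta}^2(\nu,\sigma)=\inf\{\int_0^1\mathcal{A}(\mu_t,\mathbf{j}_t)\,dt:(\mu_t,\mathbf{j}_t)\in\mathcal{CE}(\nu,\sigma)\}\in[0,\infty]$. *)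

(* Defs.v *)
From HB Require Import structures.
From mathcomp Require Import all_boot all_order all_algebra.
From mathcomp Require Import all_classical all_reals all_analysis.
From mathcomp Require Import measurable_realfun.
From mathcomp Require Import lra.
Set Implicit Arguments.
Unset Strict Implicit.
Unset Printing Implicit Defensive.
Import Order.TTheory GRing.Theory Num.Theory.
Import numFieldNormedType.Exports.
Local Open Scope classical_set_scope.
Local Open Scope ring_scope.

(* R^d with its Borel sigma-algebra *)
Definition Rd (R : realType) (d : nat) : Type := 'rV[R]_d.

HB.instance Definition _ (R : realType) (d : nat) :=
  NormedModule.copy (Rd R d) 'rV[R]_d.
HB.instance Definition _ (R : realType) (d : nat) :=
  Measurable.copy (Rd R d) (g_sigma_algebraType (@open 'rV[R]_d)).

Section lebesgue_Rd.
Context {R : realType}.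

Lemma open_measurable_Rd d (U : set (Rd R d)) : open U -> measurable U.
Proof. by move=> oU; apply: sub_sigma_algebra. Qed.

Lemma measurable_coord d (i : 'I_d) :
  measurable_fun setT (fun x : Rd R d => x ord0 i).
Proof.
apply: (measurability _ (RGenOpens.measurableE R)) => _ [_ [a [b ->] <-]].
rewrite setTI; apply: open_measurable_Rd; apply: open_comp.
  by move=> x _; exact: coord_continuous.
exact: interval_open.
Qed.

Lemma measurable_fun_Rd d' (T : measurableType d') d (f : T -> Rd R d) :
  (forall i, measurable_fun setT (fun x => f x ord0 i)) -> measurable_fun setT f.
Proof.
move=> mf; apply: (@measurability _ _ _ _ setT f (@open 'rV[R]_d)) => //.
move=> _ [U oU <-]; rewrite setTI.
pose box (q : 'rV[rat]_d * nat) : set 'rV[R]_d :=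
  [set x | forall i, x ord0 i \in `](ratr (q.1 ord0 i) - q.2.+1%:R^-1 : R),
     (ratr (q.1 ord0 i) + q.2.+1%:R^-1)[].
have -> : U = \bigcup_(q in [set q | box q `<=` U]) box q.
  apply/seteqP; split => [x Ux|x [q qU qx]]; last exact: qU.
  have /nbhs_ballP[e /= e0 xeU] : nbhs x U by exact: open_nbhs_nbhs.
  have [k ke] : exists k, (k.+1%:R^-1 : R) < e / 2.
    have e2 : 0 < e / 2 by rewrite divr_gt0.
    near \oo => k; exists k; near: k.
    exact: (near_infty_natSinv_lt (PosNum e2)).
  have k0 : 0 < (k.+1%:R^-1 : R) by rewrite invr_gt0.
  have /choice[q qP] : forall i, exists r : rat,
      ratr r \in `](x ord0 i - k.+1%:R^-1), (x ord0 i + k.+1%:R^-1)[.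
    move=> i.
    have /rat_in_itvoo[r rP] : x ord0 i - k.+1%:R^-1 < x ord0 i + k.+1%:R^-1.
      by rewrite ltrBlDr -addrA ltrDl addr_gt0.
    by exists r.
  exists (\row_i q i, k); last first.
    move=> i /=; move: (qP i); rewrite mxE !in_itv/= => /andP[h1 h2].
    by rewrite ltrBlDr h2 /= -ltrBlDr h1.
  move=> y /= yq; apply: xeU; split => // a i; rewrite ord1.
  move: (qP i) (yq i); rewrite mxE/= !in_itv/= => /andP[h1 h2] /andP[h3 h4].
  rewrite /ball/= ltr_distlC.
  set k' : R := k.+1%:R^-1 in ke h1 h2 h3 h4 *; apply/andP; split; lra.
rewrite preimage_bigcup bigcup_mkcond.
apply: countable_bigcupT_measurable => [|q]; first exact: countableP.
case: ifP => // _.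
rewrite [X in measurable X](_ : _ = \bigcap_(i in [set: 'I_d])
   ((fun x => f x ord0 i) @^-1` [set` `](ratr (q.1 ord0 i) - q.2.+1%:R^-1 : R),
     (ratr (q.1 ord0 i) + q.2.+1%:R^-1)[])); last first.
  by apply/seteqP; split => [x xq i _|x xq i]; [exact: xq|exact: (xq i)].
apply: fin_bigcap_measurable => // i _.
by rewrite -[X in measurable X]setTI; exact: mf.
Unshelve. all: end_near.
Qed.

Definition cons_Rd d (p : measurableTypeR R * Rd R d) : Rd R d.+1 :=
  \row_i oapp (fun j => p.2 ord0 j) p.1 (unlift ord0 i).

Definition uncons_Rd d (x : Rd R d.+1) : measurableTypeR R * Rd R d :=
  (x ord0 ord0, \row_j x ord0 (lift ord0 j)).

Lemma cons_RdK d : cancel (@cons_Rd d) (@uncons_Rd d).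
Proof.
move=> [x v]; rewrite /uncons_Rd /cons_Rd mxE unlift_none/=; congr pair.
by apply/rowP => j; rewrite !mxE liftK.
Qed.

Lemma measurable_cons_Rd d : measurable_fun setT (@cons_Rd d).
Proof.
apply: measurable_fun_Rd => i; case: (unliftP ord0 i) => [j|] ->.
  rewrite (_ : (fun _ => _) = (fun x : Rd R d => x ord0 j) \o snd).
    by apply: measurableT_comp; [exact: measurable_coord|exact: measurable_snd].
  by apply/funext => x /=; rewrite mxE liftK.
rewrite (_ : (fun _ => _) = fst); first exact: measurable_fst.
by apply/funext => x /=; rewrite mxE unlift_none.
Qed.

Lemma measurable_uncons_Rd d : measurable_fun setT (@uncons_Rd d).
Proof.
apply/measurable_fun_pairP; split; first exact: measurable_coord.
apply: measurable_fun_Rd => j /=.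
rewrite (_ : (fun _ => _) = (fun x : Rd R d.+1 => x ord0 (lift ord0 j))).
  exact: measurable_coord.
by apply/funext => x; rewrite mxE.
Qed.

Section step.
Context d (m : {sigma_finite_measure set (Rd R d) -> \bar R}).
Local Open Scope ereal_scope.

Definition leb_step : set (Rd R d.+1) -> \bar R :=
  pushforward (@lebesgue_measure R \x m) (@cons_Rd d).

Let pre A : measurable A -> measurable (@cons_Rd d @^-1` A).
Proof.
by move=> mA; rewrite -[X in measurable X]setTI; exact: measurable_cons_Rd.
Qed.

Let leb_step0 : leb_step set0 = 0.
Proof. by rewrite /leb_step /pushforward preimage_set0 measure0. Qed.

Let leb_step_ge0 A : 0 <= leb_step A.
Proof. by rewrite /leb_step /pushforward measure_ge0. Qed.

Let leb_step_sigma_additive : semi_sigma_additive leb_step.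
Proof.
move=> F mF tF mUF; rewrite /leb_step /pushforward preimage_bigcup.
apply: measure_semi_sigma_additive.
- by move=> n; exact: pre.
- apply/trivIsetP => /= i j _ _ ij; rewrite -preimage_setI.
  by move/trivIsetP : tF => /(_ _ _ _ _ ij) ->//; rewrite preimage_set0.
- by rewrite -preimage_bigcup; exact: pre.
Qed.

HB.instance Definition _ := isMeasure.Build _ _ _ leb_step
  leb_step0 leb_step_ge0 leb_step_sigma_additive.

Let leb_step_sigma_finite : sigma_finite setT leb_step.
Proof.
have /sigma_finiteP[F [TF ndF Foo]] := sigma_finiteT (@lebesgue_measure R).
have /sigma_finiteP[G [TG ndG Goo]] := sigma_finiteT m.
exists (fun n => @uncons_Rd d @^-1` (F n `*` G n)).
  rewrite -preimage_bigcup; apply/esym/seteqP; split => // x _.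
  have [n _ Fn] : (\bigcup_n F n) (uncons_Rd x).1 by rewrite -TF.
  have [k _ Gk] : (\bigcup_n G n) (uncons_Rd x).2 by rewrite -TG.
  exists (maxn n k) => //; split => /=.
    by move: Fn; exact/subsetPset/ndF/leq_maxl.
  by move: Gk; exact/subsetPset/ndG/leq_maxr.
move=> n; have [mF Fn] := Foo n; have [mG Gn] := Goo n; split.
  rewrite -[X in measurable X]setTI; apply: measurable_uncons_Rd => //.
  exact: measurableX.
rewrite /leb_step /pushforward -comp_preimage.
rewrite (_ : _ \o _ = id); last by apply/funext => x /=; rewrite cons_RdK.
by rewrite preimage_id product_measure1E// lte_mul_pinfty// ge0_fin_numE.
Qed.

HB.instance Definition _ := Measure_isSigmaFinite.Build _ _ _ leb_step
  leb_step_sigma_finite.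

End step.

Fixpoint leb d : {sigma_finite_measure set (Rd R d) -> \bar R} :=
  if d is d'.+1 then leb_step (leb d') else \d_(0 : Rd R 0).

Lemma leb_box d (a b : Rd R d) : (forall i, a ord0 i <= b ord0 i) ->
  leb d [set x | forall i, x ord0 i \in `[a ord0 i, b ord0 i]] =
  (\prod_i (b ord0 i - a ord0 i))%:E.
Proof.
elim: d a b => [|d ih] a b ab /=.
  by rewrite big_ord0 diracE mem_set// => -[].
rewrite /leb_step /pushforward.
pose a' : Rd R d := (uncons_Rd a).2; pose b' : Rd R d := (uncons_Rd b).2.
rewrite (_ : _ @^-1` _ = `[a ord0 ord0, b ord0 ord0]%classic `*`
   [set x : Rd R d | forall i, x ord0 i \in `[a' ord0 i, b' ord0 i]]); last first.
  apply/seteqP; split => [[x v]/= h|[x v]/= [hx hv] i].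
    split; first by have := h ord0; rewrite mxE unlift_none.
    by move=> i; have := h (lift ord0 i); rewrite !mxE liftK.
  rewrite mxE; case: (unliftP ord0 i) => [j|] -> //=.
  by have := hv j; rewrite !mxE.
rewrite product_measure1E//.
  rewrite ih; last by move=> i; rewrite !mxE.
  rewrite big_ord_recl EFinM; congr (_ * _)%E; last first.
    by congr EFin; apply: eq_bigr => i _; rewrite !mxE.
  apply: (etrans (lebesgue_measure_itv _)) => /=; rewrite lte_fin.
  case: ltP => // ba; rewrite (_ : b _ _ = a ord0 ord0) ?subrr//.
  by apply/le_anti; rewrite ba ab.
rewrite (_ : mkset _ = \bigcap_(i in [set: 'I_d])
   ((fun x : Rd R d => x ord0 i) @^-1` `[a' ord0 i, b' ord0 i])); last first.
  by apply/seteqP; split => [x h i _|x h i]; [exact: h|exact: (h i)].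
apply: fin_bigcap_measurable => // i _.
by rewrite -[X in measurable X]setTI; exact: measurable_coord.
Qed.

End lebesgue_Rd.

Section euclidean.
Context {R : realType} {d : nat}.

(* The norm that 'rV[R]_d carries in the library is the sup norm (it induces
   the same topology), hence enorm for |y|. *)
Definition enorm (x : Rd R d) : R := Num.sqrt (\sum_i x ord0 i ^+ 2).

Definition eball (r : R) : set (Rd R d) := [set y | enorm y < r].

Lemma measurable_enorm : measurable_fun setT enorm.
Proof.
apply: (measurableT_comp (continuous_measurable_fun (@sqrt_continuous R))).
apply: measurable_sum => i.
exact: (measurableT_comp (exprn_measurable 2) (measurable_coord i)).
Qed.

Lemma measurable_eball r : measurable (eball r).
Proof.
rewrite (_ : eball r = enorm @^-1` `]-oo, r[).
  by rewrite -[X in measurable X]setTI; exact: measurable_enorm.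
by apply/seteqP; split => y; rewrite /eball/= in_itv.
Qed.

Definition unif_ball (r : R) : probability (Rd R d) R :=
  mnormalize (mrestr (leb d) (measurable_eball r)) (\d_(0 : Rd R d)).

End euclidean.

(* For U open. *)
Fixpoint Ck_on (R : realType) (V : normedModType R) (U : set V) (k : nat)
    (f : V -> R) : Prop :=
  {in U, continuous f} /\
  if k is k'.+1 then
    forall v, (forall x, U x -> derivable f x v) /\ Ck_on U k' ('D_v f)
  else True.

Definition mutually_singular (R : realType) disp (T : measurableType disp)
    (m1 m2 : set T -> \bar R) : Prop :=
  exists A, [/\ measurable A, m1 A = 0%E & m2 (~` A) = 0%E].

Definition compactly_supported (R : realType) d (nu : set (Rd R d) -> \bar R) :
    Prop :=
  exists2 K, compact K & nu (~` K) = 0%E.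

Section weight_kernel.
Context {R : realType} {d : nat}.

(* A kernel is given by its radial profile, of which only the values on
   (0, +oo) matter; isotropy is thus built in. *)
Definition kernel (eta : R -> R) (z : Rd R d * Rd R d) : R :=
  eta (enorm (z.1 - z.2)).

Definition Gset (eta : R -> R) : set (Rd R d * Rd R d) :=
  [set z | z.1 != z.2 /\ 0 < kernel eta z].

End weight_kernel.

Record weight_kernel (R : realType) (d : nat) (eta : R -> R) : Prop := {
  wk_ge0 : forall r, 0 < r -> 0 <= eta r ;
  wk_continuous : {within Gset eta, continuous (@kernel R d eta)} ;
  wk_nonincreasing : forall r s, 0 < r -> r <= s -> eta s <= eta r ;
  wk_moment : (\int[leb d]_y
    (Num.min 1 (enorm y ^+ 2) * eta (enorm y))%:E < +oo)%E ;
  wk_support : `]0, 1] `<=` closure [set r | 0 < r /\ 0 < eta r]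
}.

Record interpolation (R : realType) (theta : R -> R -> R) : Prop := {
  itp_ge0 : forall s t, 0 <= s -> 0 <= t -> 0 <= theta s t ;
  itp_continuous : {within [set p : R * R | 0 <= p.1 /\ 0 <= p.2],
    continuous (fun p : R * R => theta p.1 p.2)} ;
  itp_C1 : Ck_on [set p : R * R | 0 < p.1 /\ 0 < p.2] 1
    (fun p : R * R => theta p.1 p.2) ;
  itp_sym : forall s t, 0 <= s -> 0 <= t -> theta s t = theta t s ;
  itp_gt0 : forall s t, 0 < s -> 0 < t -> 0 < theta s t ;
  itp_11 : theta 1 1 = 1 ;
  itp_mono : forall r s t, 0 <= r -> r <= s -> 0 <= t ->
    theta r t <= theta s t ;
  itp_homogeneous : forall l s t, 0 < l -> 0 <= s -> 0 <= t ->
    theta (l * s) (l * t) = l * theta s t ;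
  itp_concave : forall a s t s' t', 0 <= a <= 1 ->
    0 <= s -> 0 <= t -> 0 <= s' -> 0 <= t' ->
    a * theta s t + (1 - a) * theta s' t' <=
    theta (a * s + (1 - a) * s') (a * t + (1 - a) * t') ;
  (* over [0, 1[, where the denominator is positive *)
  itp_integrable : (\int[lebesgue_measure]_(r in `[0%R, 1%R[)
    ((theta (1 - r) (1 + r))^-1)%:E < +oo)%E
}.

Section local_measures.
Context {R : realType} {d : nat}.
Local Notation RR := (Rd R d * Rd R d)%type.

Definition locally_finite_on (G : set RR) (m : set RR -> \bar R) : Prop :=
  m (~` G) = 0%E /\ forall K, compact K -> K `<=` G -> (m K < +oo)%E.

(* A locally finite signed measure on G is given by its Jordan decomposition
   (as a set function it may be undefined on non relatively compact sets);
   measures on G are extended by 0. *)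
Record Mloc (G : set RR) := {
  mpos : {measure set RR -> \bar R} ;
  mneg : {measure set RR -> \bar R} ;
  mpos_loc : locally_finite_on G mpos ;
  mneg_loc : locally_finite_on G mneg ;
  mpos_mneg_singular : mutually_singular mpos mneg
}.

(* C_c(G): values off G are irrelevant. *)
Definition Cc (G : set RR) : set (RR -> R) :=
  [set phi | {within G, continuous phi} /\
    exists K, [/\ compact K, K `<=` G & forall z, G z -> phi z != 0 -> K z]].

Definition pairing (G : set RR) (j : Mloc G) (phi : Cc G) : R :=
  \int[mpos j]_(z in G) val phi z - \int[mneg j]_(z in G) val phi z.

(* initial topology of the pairings with C_c(G) *)
Definition weakstar_open (G : set RR) : set (set (Mloc G)) :=
  [set @pairing G @^-1` O | O in @open {ptws (Cc G) -> R}].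

Definition weakstar_borel (G : set RR) (j : R -> Mloc G) : Prop :=
  forall B, <<s @weakstar_open G >> B -> measurable (`[0, 1] `&` j @^-1` B).

(* f = dm/dl on G; for sigma-finite l and m such an f exists iff m << l *)
Definition is_density (G : set RR) (l m : set RR -> \bar R) (f : RR -> R) :
    Prop :=
  [/\ measurable_fun setT f, (forall z, 0 <= f z) &
    forall A, measurable A -> A `<=` G -> m A = (\int[l]_(z in A) (f z)%:E)%E].

(* f = dj/dl on G, for the Jordan decomposition of j *)
Definition is_signed_density (G : set RR) (l : set RR -> \bar R) (j : Mloc G)
    (f : RR -> R) : Prop :=
  is_density G l (mpos j) f^\+ /\ is_density G l (mneg j) f^\-.

End local_measures.

Section nonlocal_wasserstein.
Context {R : realType} {d : nat}.
Variables (eta : R -> R) (theta : R -> R -> R).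
Local Notation RR := (Rd R d * Rd R d)%type.
Local Notation P := (probability (Rd R d) R).
Local Notation G := (@Gset R d eta).

(* a / b with 0 / 0 = 0 and a / 0 = +oo for a > 0 *)
Definition div0 (a b : R) : \bar R :=
  if b == 0 then if a == 0 then 0%E else +oo%E else (a / b)%:E.

(* All choices of l and of the densities give the same value (and there is
   one such choice by the Radon-Nikodym theorem), so the infimum is over a
   singleton. *)
Definition action (mu : P) (j : Mloc G) : \bar R :=
  ereal_inf [set a | exists (l : {measure set RR -> \bar R}) (f u v : RR -> R),
    [/\ locally_finite_on G l, is_signed_density l j f,
      is_density G l (mu \x leb d)%E u, is_density G l (leb d \x mu)%E v &
      a = (2^-1%:E * \int[l]_(z in G)
        (div0 (f z ^+ 2) (theta (u z) (v z)) * (kernel eta z)%:E))%E]].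

Definition test_function (phi : R * Rd R d -> R) : Prop :=
  [/\ forall k, Ck_on setT k phi, compact (closure [set p | phi p != 0]) &
    closure [set p | phi p != 0] `<=` [set p | 0 < p.1 < 1]].

Definition narrowly_continuous (mu : R -> P) : Prop :=
  forall f : Rd R d -> R, continuous f -> (exists M, forall x, `|f x| <= M) ->
    {within `[0, 1], continuous (fun t => \int[mu t]_x f x)}.

Definition nlgrad (phi : R * Rd R d -> R) (t : R) (z : RR) : R :=
  (phi (t, z.2) - phi (t, z.1)) * kernel eta z.

(* absolute convergence of the flux integral, that of the other one being
   automatic as the derivative of phi is bounded *)
Definition flux_converges (j : R -> Mloc G) (phi : R * Rd R d -> R) : Prop :=
  (\int[lebesgue_measure]_(t in `[0%R, 1%R])
    (\int[mpos (j t)]_(z in G) `|nlgrad phi t z|%:E +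
     \int[mneg (j t)]_(z in G) `|nlgrad phi t z|%:E) < +oo)%E.

Definition continuity_equation (mu : R -> P) (j : R -> Mloc G) : Prop :=
  forall phi, test_function phi -> flux_converges j phi /\
  (\int[lebesgue_measure]_(t in `[0%R, 1%R])
     \int[mu t]_x ((fun s => phi (s, x))^`()%classic t)%:E +
   2^-1%:E * \int[lebesgue_measure]_(t in `[0%R, 1%R])
     (\int[mpos (j t)]_(z in G) (nlgrad phi t z)%:E -
      \int[mneg (j t)]_(z in G) (nlgrad phi t z)%:E) = 0)%E.

(* Only the restrictions of the curves to [0, 1] matter. *)
Definition CE (nu sigma : P) (mu : R -> P) (j : R -> Mloc G) : Prop :=
  [/\ narrowly_continuous mu, weakstar_borel j,
    forall A, measurable A -> mu 0 A = nu A,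
    forall A, measurable A -> mu 1 A = sigma A & continuity_equation mu j].

Definition W (nu sigma : P) : \bar R :=
  sqrte (ereal_inf [set a | exists (mu : R -> P) (j : R -> Mloc G),
    CE nu sigma mu j /\
    a = (\int[lebesgue_measure]_(t in `[0%R, 1%R]) action (mu t) (j t))%E]).

End nonlocal_wasserstein.

(* Main.v *)
(** Lower bounds: test the continuity equation with a(t) chi(x), where chi is a
    bump around 0, and apply Cauchy-Schwarz to the flux. Since
    theta(r, t) <= (theta(1, 0) + e) r + C t, the mass g(t) near 0 satisfies
    |int a' g|^2 <= (action) * int a^2 (theta(1, 0) (int eta) g + o(1)). If
    theta(1, 0) = 0 the right-hand side is negligible, so the action is
    infinite; otherwise theta(1, 0) <= 1/2 and a dyadic approximation of
    a = g^(-1/2) give 4 / int eta.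

    Upper bounds: let densities g_0, g_1, ... run from the target to the Dirac
    mass, g_(k+1) arising from g_k by a jump kernel, and put
    mu_t = sum_k w_k(t) g_k where the weights w_k live at times of order 2^-k.
    Moving mass from level k + 1 to level k costs 8^k S_k, with S_k the cost of
    the k-th kernel. When theta(1, 0) > 0 one contracts towards 0 by steps of
    length at most 1/2, on which eta is bounded below, and finally jumps to 0:
    finitely many S_k are nonzero. When eta(r) >= c r^(-d-s) one uses uniform
    densities on cubes of side proportional to delta lam^k, for which
    S_k = O(delta^s lam^(k s)), and lam^s = 1/16.

    The integral of the action in time needs no measurability, as the integral
    of a nonnegative function is its lower integral. *)
Require Import Defs.
From HB Require Import structures.
From mathcomp Require Import all_boot all_order all_algebra.
From mathcomp Require Import all_classical all_reals all_analysis.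
From mathcomp Require Import measurable_realfun.
From mathcomp Require Import ring lra.
Set Implicit Arguments.
Unset Strict Implicit.
Unset Printing Implicit Defensive.
Import Order.TTheory GRing.Theory Num.Theory.
Import numFieldNormedType.Exports Defs.
Local Open Scope classical_set_scope.
Local Open Scope ring_scope.


(** The factor 8^k has two sources. Level k + 1 empties into level k during times of order 2^-k, so
    the flux is of order 2^k and its square of order 4^k; Cauchy-Schwarz over the levels, with
    weights 2^-(k+1), adds a factor 2^k. With lam^s = 1/16 a geometric series of ratio 1/2 remains.
    The bound holds at every positive time, so integrating it in time is trivial. When theta(1, 0) =
    0, flux out of an atom has infinite action; the curve therefore consists of densities at all
    positive times and leaves the Dirac mass through infinitely many levels. When theta(1, 0) > 0 an
    atom is a possible source and finitely many levels suffice, but the target may be singular, so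
    densities refer to the sum of Lebesgue measure, the Dirac mass and the target. In the lower
    bound, a = g^(-1/2) itself would give 8 / int eta, as the integral of g^(-1/2) over [0, 1] is 2.
    This slack lets four dyadic steps suffice; since g need not be monotone, the steps change at the
    last times at which g takes the values 1/4, 1/16 and 1/64. *)

Section lower_integral.

(** * Lower integrals and changes of density *)

Local Open Scope ereal_scope.
Context d (T : measurableType d) (R : realType).

(* The integral of a nonnegative function is a supremum over the simple
   functions below it, hence is monotone even without measurability. *)
Lemma ge0_le_integral_nonmeas (mu : {measure set T -> \bar R}) (D : set T)
    (f g : T -> \bar R) :
  (forall x, D x -> 0 <= f x) -> (forall x, D x -> f x <= g x) ->
  \int[mu]_(x in D) f x <= \int[mu]_(x in D) g x.
Proof.
move=> f0 fg; have g0 x : D x -> 0 <= g x.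
  by move=> Dx; exact: le_trans (f0 x Dx) (fg x Dx).
rewrite !ge0_integralE//; apply: le_ereal_sup => _ [h hf <-]; exists h => //.
move=> x; apply: le_trans (hf x) _; apply: lee_restrict => y Dy; exact: fg.
Qed.

Import HBNNSimple.

(** Monotone convergence reduces the change of density to level sets of simple functions, for which
    it is the hypothesis. Only subsets of [G] are tested, as [is_density] says nothing off [G]. *)
Lemma ge0_integral_density (m l : {measure set T -> \bar R}) (G : set T)
    (mG : measurable G) (f : T -> R) (N : T -> \bar R) :
  measurable_fun G f -> (forall x, 0 <= f x)%R ->
  (forall A, measurable A -> A `<=` G -> m A = \int[l]_(x in A) (f x)%:E) ->
  measurable_fun G N -> (forall x, G x -> 0 <= N x) ->
  \int[m]_(x in G) N x = \int[l]_(x in G) (N x * (f x)%:E).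
Proof.
move=> mf f0 mE mN N0.
pose h := nnsfun_approx mG mN.
have hN x : G x -> (EFin \o h n) x @[n --> \oo] --> N x.
  by move=> Gx; exact: cvg_nnsfun_approx.
have -> : \int[m]_(x in G) N x = lim (\int[m]_(x in G) (h n x)%:E @[n --> \oo]).
  under eq_integral => x /[!inE] /hN /cvg_lim <- //.
  apply: monotone_convergence => //.
  - move=> n; apply/measurable_EFinP.
    by apply: (measurable_funS measurableT) => //; exact/measurable_funP.
  - by move=> n x Gx; rewrite lee_fin.
  - by move=> x Gx a b ab; rewrite lee_fin; exact/lefP/nd_nnsfun_approx.
have -> : \int[l]_(x in G) (N x * (f x)%:E) =
    lim (\int[l]_(x in G) ((h n x)%:E * (f x)%:E) @[n --> \oo]).
  have hNf x : G x -> N x * (f x)%:E = lim ((h n x)%:E * (f x)%:E @[n --> \oo]).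
    move=> Gx; apply/esym/cvg_lim => //; apply: cvgeZr => //; exact: hN.
  under eq_integral => x /[!inE] /hNf -> //.
  apply: monotone_convergence => //.
  - move=> n; apply: emeasurable_funM; apply/measurable_EFinP => //.
    by apply: (measurable_funS measurableT) => //; exact/measurable_funP.
  - by move=> n x Gx; rewrite mule_ge0 ?lee_fin.
  - move=> x Gx a b ab; rewrite lee_wpmul2r ?lee_fin//.
    exact/lefP/nd_nnsfun_approx.
suff suf n : \int[m]_(x in G) (h n x)%:E =
    \int[l]_(x in G) ((h n x)%:E * (f x)%:E).
  by under eq_fun do rewrite suf.
have mpre r : measurable (h n @^-1` [set r]) by [].
transitivity (\int[m]_(x in G)
   (\sum_(y \in range (h n)) (y * \1_(h n @^-1` [set y]) x)%:E)).
  by apply: eq_integral => t tE; rewrite /= fimfunE -fsumEFin.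
have indich r : measurable_fun G (fun x => (r * \1_(h n @^-1` [set r]) x)%:E).
  by apply: (measurable_comp measurableT) => //; exact: measurable_funM.
rewrite ge0_integral_fsum//; last by move=> k y Ey; exact: nnfun_muleindic_ge0.
transitivity (\int[l]_(x in G) (\sum_(y \in range (h n))
    (y * \1_(h n @^-1` [set y]) x)%:E * (f x)%:E)); last first.
  under [RHS]eq_integral => x xE.
    rewrite [X in X%:E * _](_ : h n x =
      (\sum_(y \in range (h n)) y * \1_(h n @^-1` [set y]) x)%R); last first.
      by rewrite [LHS]fimfunE.
    rewrite -fsumEFin// ge0_mule_fsuml; last first.
      by move=> y; exact: nnfun_muleindic_ge0.
    over.
  by [].
rewrite ge0_integral_fsum//; last 2 first.
  - by move=> y; apply: emeasurable_funM => //; exact/measurable_EFinP.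
  - move=> k y Ey; apply: mule_ge0; last by rewrite lee_fin.
    exact: nnfun_muleindic_ge0.
apply: eq_fsbigr => r rhn.
have r0 : (0 <= r)%R by move: rhn; rewrite inE => -[t _ <-].
under [in LHS]eq_integral do rewrite EFinM.
under [in RHS]eq_integral do rewrite EFinM -muleA.
rewrite integralZl_indic_nnsfun// ge0_integralZl//; last first.
- by move=> x Gx; rewrite mule_ge0 ?lee_fin.
- apply: emeasurable_funM; first exact/measurable_EFinP/measurable_indic.
  exact/measurable_EFinP.
congr (_ * _); rewrite integral_indic//.
under eq_integral do rewrite muleC.
rewrite (eq_integral ((EFin \o f) \_ (h n @^-1` [set r]))); last first.
  by move=> x xE; rewrite epatch_indic.
by rewrite -integral_mkcondr -mE// 1?setIC//; exact: measurableI.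
Qed.

(** Multiplication by the nonnegative [f] commutes with taking positive and negative parts. *)
Lemma integral_density (m l : {measure set T -> \bar R}) (G : set T)
    (mG : measurable G) (f : T -> R) (N : T -> \bar R) :
  measurable_fun G f -> (forall x, 0 <= f x)%R ->
  (forall A, measurable A -> A `<=` G -> m A = \int[l]_(x in A) (f x)%:E) ->
  measurable_fun G N ->
  \int[m]_(x in G) N x = \int[l]_(x in G) (N x * (f x)%:E).
Proof.
move=> mf f0 mE mN; rewrite integralE [RHS]integralE.
rewrite (ge0_integral_density mG mf f0 mE)//; last exact: measurable_funepos.
rewrite (ge0_integral_density mG mf f0 mE)//; last exact: measurable_funeneg.
congr (_ - _); apply: eq_integral => x _.
  rewrite !funeposE; have := f0 x; rewrite le_eqVlt => /predU1P[<-|fx].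
    by rewrite !mule0 maxxx.
  by rewrite [in RHS]muleC [LHS]muleC maxe_pMr ?mule0// ltW.
rewrite !funenegE -mulNe; have := f0 x; rewrite le_eqVlt => /predU1P[<-|fx].
  by rewrite !mule0 maxxx.
by rewrite [in RHS]muleC [LHS]muleC maxe_pMr ?mule0// ltW.
Qed.

End lower_integral.

(** * Continuity and Borel sets in products *)

Section product_space.
Context {R : realType}.
Implicit Types d : nat.

Lemma continuous_sum (T : topologicalType) (I : Type) (s : seq I)
    (F : I -> T -> R) :
  (forall i, continuous (F i)) -> continuous (fun x => \sum_(i <- s) F i x).
Proof.
move=> cF; elim: s => [|i s ih] x.
  by under eq_fun do rewrite big_nil; exact: cvg_cst.
by under eq_fun do rewrite big_cons; apply: cvgD; [exact: cF|exact: ih].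
Qed.

Lemma Rd_continuousP d (T : topologicalType) (f : T -> Rd R d) :
  (forall i, continuous (fun x => f x ord0 i)) -> continuous f.
Proof.
move=> cf x; apply/cvg_ballP => e e0.
have : \forall y \near x, forall i : 'I_d, `|f x ord0 i - f y ord0 i| < e.
  apply: filter_forall => i.
  by have /cvgrPdist_lt := cf i x; apply.
by apply: filterS => y h; split => // i j; rewrite ord1; exact: h.
Qed.

(** The product carries the product sigma-algebra, which does not contain the open sets by
    definition. Identifying pairs with vectors of [Rd R (d + d)], by a map that is measurable
    coordinatewise, transfers the question to a Borel sigma-algebra. *)
Lemma open_measurable_RR d (U : set (Rd R d * Rd R d)) : open U -> measurable U.
Proof.
move=> oU.
pose join (z : Rd R d * Rd R d) : Rd R (d + d) := row_mx z.1 z.2.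
pose split (w : Rd R (d + d)) : Rd R d * Rd R d := (lsubmx w, rsubmx w).
have joinK z : split (join z) = z.
  by case: z => x y; rewrite /split /join row_mxKl row_mxKr.
have -> : U = join @^-1` (split @^-1` U).
  by apply/seteqP; split => z /=; rewrite joinK.
have cl : continuous (fun w : Rd R (d + d) => lsubmx w : Rd R d).
  apply: Rd_continuousP => i; under eq_fun do rewrite mxE.
  exact: coord_continuous.
have cr : continuous (fun w : Rd R (d + d) => rsubmx w : Rd R d).
  apply: Rd_continuousP => i; under eq_fun do rewrite mxE.
  exact: coord_continuous.
rewrite -[X in measurable X]setTI.
suff mj : measurable_fun setT join.
  apply: mj => //; apply: open_measurable_Rd; apply: open_comp => // w _.
  exact: (cvg_pair (cl w) (cr w)).
apply: measurable_fun_Rd => i; rewrite /join; case: (splitP i) => j ij.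
  rewrite (_ : (fun _ => _) = (fun x : Rd R d => x ord0 j) \o fst).
    exact: measurableT_comp (measurable_coord _) measurable_fst.
  apply/funext => z /=; rewrite (_ : i = lshift d j); last exact: val_inj.
  by rewrite row_mxEl.
rewrite (_ : (fun _ => _) = (fun x : Rd R d => x ord0 j) \o snd).
  exact: measurableT_comp (measurable_coord _) measurable_snd.
apply/funext => z /=; rewrite (_ : i = rshift d j); last exact: val_inj.
by rewrite row_mxEr.
Qed.

Lemma continuous_measurable_Rd d (f : Rd R d -> R) :
  continuous f -> measurable_fun setT f.
Proof.
move=> cf; apply: (measurability _ (RGenOpens.measurableE R)).
move=> _ [_ [a [b ->] <-]]; rewrite setTI; apply: open_measurable_Rd.
by apply: open_comp; [move=> x _; exact: cf|exact: interval_open].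
Qed.

Lemma within_continuous_measurable_RR d (G : set (Rd R d * Rd R d)) f :
  measurable G -> {within G, continuous f} -> measurable_fun G (f : _ -> R).
Proof.
move=> mG cf; apply: (measurability _ (RGenOpens.measurableE R)).
move=> _ [_ [a [b ->] <-]].
have oab : open (`]a, b[%classic : set R) by exact: interval_open.
have oG : open (f @^-1` `]a, b[%classic : set (subspace G)).
  exact: (continuousP _).1 cf _ oab.
have [V oV VE] := (open_subspaceP _ _).1 oG.
have -> : G `&` f @^-1` `]a, b[ = V `&` G by rewrite VE setIC.
by apply: measurableI => //; exact: open_measurable_RR.
Qed.

End product_space.

(** * The Euclidean norm *)

Section euclidean_norm.
Context {R : realType} {d : nat}.
Implicit Types (x y : Rd R d) (z : Rd R d * Rd R d).

Lemma enorm_ge0 x : 0 <= enorm x. Proof. exact: sqrtr_ge0. Qed.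

Lemma enorm_sqr x : enorm x ^+ 2 = \sum_i x ord0 i ^+ 2.
Proof. by rewrite sqr_sqrtr// sumr_ge0// => i _; rewrite sqr_ge0. Qed.

Lemma enorm_le x r : 0 <= r -> \sum_i x ord0 i ^+ 2 <= r ^+ 2 -> enorm x <= r.
Proof. by move=> r0 xr; rewrite -(@ler_pXn2r _ 2)// ?nnegrE ?enorm_ge0// enorm_sqr. Qed.

Lemma enorm_eq0 x : (enorm x == 0) = (x == 0).
Proof.
apply/eqP/eqP => [x0|->]; last first.
  by rewrite /enorm big1 ?sqrtr0// => i _; rewrite mxE expr0n.
have /eqP : enorm x ^+ 2 = 0 by rewrite x0 expr0n.
rewrite enorm_sqr psumr_eq0 => [|i _]; last exact: sqr_ge0.
move=> /allP xi; apply/rowP => i; rewrite mxE.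
by have := xi i (mem_index_enum _); rewrite /= sqrf_eq0 => /eqP.
Qed.

Lemma enorm_gt0 x : (0 < enorm x) = (x != 0).
Proof. by rewrite lt_neqAle enorm_ge0 andbT eq_sym enorm_eq0. Qed.

Lemma enormN x : enorm (- x) = enorm x.
Proof. by congr Num.sqrt; apply: eq_bigr => i _; rewrite mxE sqrrN. Qed.

Lemma enorm_le_sup x r : 0 <= r -> (forall i, `|x ord0 i| <= r) ->
  enorm x <= Num.sqrt d%:R * r.
Proof.
move=> r0 xr; apply: enorm_le; first by rewrite mulr_ge0 ?sqrtr_ge0.
have -> : (Num.sqrt d%:R * r) ^+ 2 = \sum_(i < d) r ^+ 2.
  by rewrite exprMn sqr_sqrtr// sumr_const card_ord mulr_natl.
by apply: ler_sum => i _; rewrite -real_normK ?num_real// ler_pXn2r ?nnegrE.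
Qed.

Lemma ler_coord_enorm x i : `|x ord0 i| <= enorm x.
Proof.
rewrite -(@ler_pXn2r _ 2)// ?nnegrE ?enorm_ge0//.
rewrite enorm_sqr real_normK ?num_real// (bigD1 i)//= lerDl.
by rewrite sumr_ge0// => j _; rewrite sqr_ge0.
Qed.

Lemma enorm_continuous : continuous (@enorm R d).
Proof.
move=> x; apply: continuous_comp; last exact: sqrt_continuous.
apply: continuous_sum => i y.
by apply: (@continuous_comp _ _ _ (fun u : Rd R d => u ord0 i)
  (fun t : R => t ^+ 2)); [exact: coord_continuous|exact: exprn_continuous].
Qed.

Lemma continuous_fst_sub_snd : continuous (fun z => z.1 - z.2).
Proof. by move=> z; apply: cvgB; [exact: cvg_fst|exact: cvg_snd]. Qed.

Lemma enorm_sub_continuous : continuous (fun z => enorm (z.1 - z.2)).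
Proof.
move=> z; apply: continuous_comp; last exact: enorm_continuous.
exact: continuous_fst_sub_snd.
Qed.

Lemma measurable_enorm_sub : measurable_fun setT (fun z => enorm (z.1 - z.2)).
Proof.
apply: measurableT_comp; first exact: measurable_enorm.
apply: measurable_fun_Rd => i; under eq_fun do rewrite 2!mxE.
apply: measurable_funB.
  exact: measurableT_comp (measurable_coord _) measurable_fst.
exact: measurableT_comp (measurable_coord _) measurable_snd.
Qed.

End euclidean_norm.

(** * The radial profile of a weight kernel *)

Section weight_kernel_theory.
Context {R : realType} {d : nat} (eta : R -> R).
Implicit Types (x y : Rd R d) (z : Rd R d * Rd R d).
Hypothesis keta : weight_kernel d eta.

(** The value of [eta] at 0 is unconstrained. Replacing it by 0 makes [Gset] the set where the
    profile is positive, and gives a Borel function on the whole line. *)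
Definition profile (r : R) : R := if 0 < r then eta r else 0.

Lemma profile_ge0 r : 0 <= profile r.
Proof. by rewrite /profile; case: ifPn => // r0; exact: wk_ge0 keta _ r0. Qed.

Lemma profile_gt0 r : (0 < profile r) = (0 < r) && (0 < eta r).
Proof. by rewrite /profile; case: (ltP 0 r) => r0 //=; rewrite ltxx. Qed.

Lemma measurable_profile : measurable_fun setT profile.
Proof.
apply: (measurable_fun_if measurableT) => //=.
- exact: measurable_fun_ltr.
- rewrite setTI (_ : _ @^-1` _ = `]0, +oo[%classic); last first.
    by apply/seteqP; split => r /=; rewrite in_itv/= andbT.
  (* [eta] is monotone on the positive half-line only; composing with [expR] gives a function
     monotone on all of R. *)
  apply: (@eq_measurable_fun _ _ _ _ _ ((eta \o expR) \o (@ln R))).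
    by move=> r; rewrite inE/= in_itv/= andbT => r0; rewrite lnK.
  apply: measurableT_comp; last first.
    by apply/measurable_funTS; exact: measurable_ln.
  apply: nonincreasing_measurable => // r s rs.
  by apply: (wk_nonincreasing keta); rewrite ?expR_gt0// ler_expR.
Qed.

(** As 1 lies in the closure of the positivity set, positive values occur arbitrarily close to 1,
    and monotonicity carries them down to [r]. *)
Lemma eta_gt0 r : 0 < r -> r < 1 -> 0 < eta r.
Proof.
move=> r0 r1; have /(_ (ball (1 : R) (1 - r))) : closure [set r | 0 < r /\ 0 < eta r] 1.
  by apply: (wk_support keta); rewrite /= in_itv/= ltr01 lexx.
case; first by apply: nbhsx_ballx; rewrite subr_gt0.
move=> s [[s0 es] ]; rewrite /ball/= => sr.
apply: (lt_le_trans es); apply: (wk_nonincreasing keta) => //.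
by move: sr; rewrite ltr_norml => /andP[_]; lra.
Qed.

Lemma kernelE z : z.1 != z.2 -> kernel eta z = profile (enorm (z.1 - z.2)).
Proof. by move=> z12; rewrite /profile enorm_gt0 subr_eq0 z12. Qed.

Lemma GsetE : @Gset R d eta = [set z | 0 < profile (enorm (z.1 - z.2))].
Proof.
apply/seteqP; split => z; rewrite /Gset/= profile_gt0 enorm_gt0 subr_eq0.
  by move=> [-> ->].
by move=> /andP[-> ?].
Qed.

Lemma Gset_kernelE z : Gset eta z -> kernel eta z = profile (enorm (z.1 - z.2)).
Proof. by case => /kernelE. Qed.

Lemma measurable_profile_sub :
  measurable_fun setT (fun z => profile (enorm (z.1 - z.2))).
Proof. exact: measurableT_comp measurable_profile measurable_enorm_sub. Qed.

Lemma measurable_Gset : measurable (@Gset R d eta).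
Proof.
rewrite GsetE (_ : [set _ | _] =
  (fun z => profile (enorm (z.1 - z.2))) @^-1` `]0, +oo[); last first.
  by apply/seteqP; split => z /=; rewrite in_itv/= andbT.
by rewrite -[X in measurable X]setTI; exact: measurable_profile_sub.
Qed.

Lemma measurable_weight : measurable_fun (@Gset R d eta) (kernel eta).
Proof.
apply: (eq_measurable_fun (fun z => profile (enorm (z.1 - z.2)))).
  by move=> z; rewrite inE => /Gset_kernelE.
by apply: measurable_funTS; exact: measurable_profile_sub.
Qed.

End weight_kernel_theory.


(** * Translation invariance of Lebesgue measure, and cubes *)

Section lebesgue_translation.
Context {R : realType}.
Local Open Scope ereal_scope.

Lemma lebesgue_measure_translate (c : R) (A : set R) : measurable A ->
  lebesgue_measure ((+%R c) @^-1` A) = lebesgue_measure A.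
Proof.
move=> mA.
have mS : measurable_fun setT ((+%R c) : measurableTypeR R -> measurableTypeR R).
  exact: measurable_funD.
pose S : {mfun _ >-> _} := HB.pack ((+%R c) : measurableTypeR R -> measurableTypeR R)
  (isMeasurableFun.Build _ _ _ _ _ mS).
apply/esym/(@lebesgue_measure_unique R (pushforward lebesgue_measure S)) => //.
move=> _ [[a b]] _ <-; rewrite [RHS](_ : _ = lebesgue_measure `](a - c)%R, (b - c)%R]%classic).
  rewrite !lebesgue_measure_itv/= !lte_fin ltrD2r; case: ifP => // _.
  by rewrite -!EFinB; congr EFin; ring.
congr (lebesgue_measure _).
by apply/seteqP; split => x /=; rewrite !in_itv/= ltrBlDl lerBrDl.
Qed.

(** Induction on the dimension: a translation acts separately on the first coordinate and on the
    others, and a product measure is determined by its values on rectangles. *)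
Lemma leb_translate d (c : Rd R d) (A : set (Rd R d)) : measurable A ->
  leb d ((fun x => c + x)%R @^-1` A) = leb d A.
Proof.
elim: d c A => [|d ih] c A mA.
  rewrite (_ : _ @^-1` A = A)//; apply/seteqP.
  by split => x /=; rewrite (_ : (c + x)%R = x)//; apply/rowP => -[].
pose c' : Rd R d := (uncons_Rd c).2.
have mS : measurable_fun setT (fun p : measurableTypeR R * Rd R d =>
    ((c ord0 ord0 + p.1)%R, (c' + p.2)%R) : measurableTypeR R * Rd R d).
  apply/measurable_fun_pairP; split => /=.
    by apply: measurable_funD => //; exact: measurable_fst.
  apply: measurable_fun_Rd => i; under eq_fun do rewrite mxE.
  apply: measurable_funD => //.
  exact: measurableT_comp (measurable_coord _) measurable_snd.
pose S : {mfun _ >-> _} := HB.pack (fun p : measurableTypeR R * Rd R d =>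
    ((c ord0 ord0 + p.1)%R, (c' + p.2)%R) : measurableTypeR R * Rd R d)
  (isMeasurableFun.Build _ _ _ _ _ mS).
rewrite /= /leb_step /pushforward -comp_preimage.
rewrite (_ : _ \o _ = @cons_Rd R d \o S); last first.
  apply/funext => -[a v]; apply/rowP => i /=; rewrite !mxE.
  by case: (unliftP ord0 i) => [j|] ->/=; rewrite ?mxE.
rewrite comp_preimage.
have mB : measurable (@cons_Rd R d @^-1` A).
  by rewrite -[X in measurable X]setTI; exact: measurable_cons_Rd.
apply/esym/(@product_measure_unique _ _ _ _ _ lebesgue_measure (leb d)
  (pushforward (lebesgue_measure \x leb d) S)) => // U V mU mV.
rewrite [LHS](_ : _ = (lebesgue_measure \x leb d)
  (((+%R (c ord0 ord0)) @^-1` U) `*` ((fun x => c' + x)%R @^-1` V)))//.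
have mU' : measurable ((+%R (c ord0 ord0)) @^-1` U).
  by rewrite -[X in measurable X]setTI; apply: measurable_funD.
have mV' : measurable ((fun x => c' + x)%R @^-1` V).
  rewrite -[X in measurable X]setTI.
  suff : measurable_fun setT (fun x : Rd R d => c' + x)%R by exact.
  apply: measurable_fun_Rd => i; under eq_fun do rewrite mxE.
  by apply: measurable_funD => //; exact: measurable_coord.
rewrite product_measure1E//; congr (_ * _); last exact: ih.
exact: lebesgue_measure_translate.
Qed.

Lemma measurable_translate d (c : Rd R d) :
  measurable_fun setT (fun x : Rd R d => (c + x)%R).
Proof.
apply: measurable_fun_Rd => i; under eq_fun do rewrite mxE.
by apply: measurable_funD => //; exact: measurable_coord.
Qed.

Lemma ge0_integral_translate d (c : Rd R d) (f : Rd R d -> \bar R) :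
  measurable_fun setT f -> (forall x, 0 <= f x) ->
  \int[leb d]_x f (c + x)%R = \int[leb d]_x f x.
Proof.
move=> mf f0; have mc := measurable_translate c.
pose S : {mfun _ >-> _} := HB.pack (fun x : Rd R d => (c + x)%R)
  (isMeasurableFun.Build _ _ _ _ _ mc).
rewrite [RHS](@eq_measure_integral _ _ _ _ (pushforward (leb d) S)); last first.
  by move=> A mA _; apply/esym/leb_translate.
by rewrite ge0_integral_pushforward//; exact: measurable_translate.
Qed.

Lemma leb_point d (x : Rd R d) : (0 < d)%N -> leb d [set x] = 0.
Proof.
move=> d0.
have <- : [set y : Rd R d | forall i, y ord0 i \in `[x ord0 i, x ord0 i]] = [set x].
  apply/seteqP; split => [y /= h|y -> i]; last by rewrite in_itv/= !lexx.
  apply/rowP => i; have := h i; rewrite in_itv/= => h'.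
  by apply/esym/le_anti.
by rewrite leb_box// (bigD1 (Ordinal d0))//= subrr mul0r.
Qed.

(** The closed balls of the sup norm. Their volume is explicit and they are described
    coordinatewise, which is why cutoffs and jump kernels are built on them. *)
Definition cube d (c : Rd R d) (r : R) : set (Rd R d) :=
  [set x | forall i, (`|x ord0 i - c ord0 i| <= r)%R].

Lemma cubeE d (c : Rd R d) (r : R) : cube c r = [set x | forall i,
  x ord0 i \in `[(c - const_mx r : Rd R d)%R ord0 i,
                 (c + const_mx r : Rd R d)%R ord0 i]].
Proof.
apply/seteqP; split => x /= h i; move: (h i);
  by rewrite !mxE in_itv/= ler_distl.
Qed.

Lemma measurable_cube d (c : Rd R d) r : measurable (cube c r).
Proof.
rewrite (_ : cube c r = \bigcap_(i in [set: 'I_d])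
   ((fun x : Rd R d => x ord0 i) @^-1` `[(c ord0 i - r)%R, (c ord0 i + r)%R])).
  apply: fin_bigcap_measurable => // i _.
  by rewrite -[X in measurable X]setTI; exact: measurable_coord.
apply/seteqP; split => x h i; move: (h i); rewrite /= in_itv/= ler_distl//.
exact.
Qed.

Lemma measurable_point_Rd d (c : Rd R d) : measurable [set c].
Proof.
rewrite (_ : [set c] = cube c 0); first exact: measurable_cube.
apply/seteqP; split => [x -> i|x h] /=; first by rewrite subrr normr0.
by apply/rowP => i; have := h i; rewrite normr_le0 subr_eq0 => /eqP.
Qed.

Lemma leb_cube d (c : Rd R d) r : (0 <= r)%R ->
  leb d (cube c r) = ((2 * r) ^+ d)%:E.
Proof.
move=> r0; rewrite cubeE leb_box; last by move=> i; rewrite !mxE; lra.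
congr EFin; rewrite (eq_bigr (fun=> (2 * r)%R)) ?prodr_const ?card_ord//.
by move=> i _; rewrite !mxE; ring.
Qed.

End lebesgue_translation.


(** * Integrals of the kernel *)

Section kernel_integrals.
Context {R : realType} {d : nat} (eta : R -> R).
Implicit Types (x y : Rd R d).
Hypothesis keta : weight_kernel d eta.
Local Open Scope ereal_scope.

Lemma measurable_profile_enorm :
  measurable_fun setT (fun y : Rd R d => profile eta (enorm y)).
Proof. exact: measurableT_comp (measurable_profile keta) measurable_enorm. Qed.

Lemma measurable_profile_subl x :
  measurable_fun setT (fun y : Rd R d => profile eta (enorm (x - y)%R)).
Proof.
rewrite (_ : (fun _ => _) = (fun y => profile eta (enorm (- x + y)%R))).
  exact: measurableT_comp measurable_profile_enorm (measurable_translate _).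
by apply/funext => y; rewrite -enormN opprB addrC.
Qed.

Lemma measurable_profile_subr y :
  measurable_fun setT (fun x : Rd R d => profile eta (enorm (x - y)%R)).
Proof.
under eq_fun do rewrite -enormN opprB.
exact: measurable_profile_subl.
Qed.

Lemma integral_profile_subr y :
  \int[leb d]_x (profile eta (enorm (x - y)%R))%:E =
  \int[leb d]_x (profile eta (enorm x))%:E.
Proof.
have := @ge0_integral_translate R d (- y)%R
  (fun x => (profile eta (enorm x))%:E).
move=> <-; first by apply: eq_integral => x _; rewrite addrC.
  by apply/measurable_EFinP; exact: measurable_profile_enorm.
by move=> x; rewrite lee_fin (profile_ge0 keta).
Qed.

Lemma integral_profile_subl x :
  \int[leb d]_y (profile eta (enorm (x - y)%R))%:E =
  \int[leb d]_y (profile eta (enorm y))%:E.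
Proof.
rewrite -[RHS](integral_profile_subr x); apply: eq_integral => y _.
by rewrite -enormN opprB.
Qed.

(** The integrands differ at most at the origin, a null set because [d] is positive. *)
Lemma integral_eta_profile (D : set (Rd R d)) : (0 < d)%N -> measurable D ->
  \int[leb d]_(y in D) (eta (enorm y))%:E =
  \int[leb d]_(y in D) (profile eta (enorm y))%:E.
Proof.
move=> d0 mD; have e0 : enorm (0%R : Rd R d) = 0%R by apply/eqP; rewrite enorm_eq0.
have etaE y : eta (enorm y) = (profile eta (enorm y) + eta 0 * \1_[set 0%R] y)%R.
  rewrite /profile enorm_gt0 indicE; have [->|y0] := eqVneq y 0%R.
    by rewrite e0 mem_set// mulr1 add0r.
  by rewrite memNset ?mulr0 ?addr0//; exact/eqP.
have m0 := @measurable_point_Rd R d 0%R.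
apply: ae_eq_integral => //.
- apply/measurable_EFinP; under eq_fun do rewrite etaE.
  apply/measurable_funTS/measurable_funD; first exact: measurable_profile_enorm.
  by apply: measurable_funM => //; exact: measurable_indic.
- by apply/measurable_EFinP/measurable_funTS; exact: measurable_profile_enorm.
- exists [set 0%R]; split => //; first exact: leb_point.
  move=> y /= /not_implyP[Dy]; apply: contra_notP => y0.
  by rewrite etaE indicE memNset// mulr0 addr0.
Qed.

(** Outside the unit ball the weight in the moment condition is 1, so that condition bounds the rest
    of the integral. *)
Lemma integral_profile_lty : (0 < d)%N ->
  \int[leb d]_(y in eball 1) (eta (enorm y))%:E < +oo ->
  \int[leb d]_y (profile eta (enorm y))%:E < +oo.
Proof.
move=> d0; have mB := @measurable_eball R d 1.
rewrite integral_eta_profile// => h; have mf := measurable_profile_enorm.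
have mf' D : measurable_fun D (fun y : Rd R d => (profile eta (enorm y))%:E).
  by apply/measurable_funTS/measurable_EFinP.
have f0 y : 0 <= (profile eta (enorm y))%:E by rewrite lee_fin (profile_ge0 keta).
rewrite -(setvU (eball 1)) ge0_integral_setU//; last 2 first.
- exact: measurableC.
- by apply/disj_set2P; rewrite setIC setICr.
rewrite lte_add_pinfty//.
apply: le_lt_trans (wk_moment keta); rewrite integral_mkcond.
apply: ge0_le_integral_nonmeas => y _; first exact: erestrict_ge0.
rewrite /patch; case: ifPn => [|_]; last first.
  rewrite lee_fin; have [->|y0] := eqVneq y 0%R.
    have -> : enorm (0%R : Rd R d) = 0%R by apply/eqP; rewrite enorm_eq0.
    by rewrite expr0n/= min_r ?mul0r.
  by rewrite mulr_ge0 ?le_min ?sqr_ge0 ?ler01// (wk_ge0 keta)// enorm_gt0.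
rewrite inE/= /eball/= => /negP; rewrite -leNgt => y1.
have y0 : (0 < enorm y)%R by apply: lt_le_trans y1.
rewrite lee_fin /profile y0 min_l ?mul1r//.
by rewrite -[leLHS](expr1n _ 2) ler_pXn2r ?nnegrE// ltW.
Qed.

Lemma integral_profile_gt0 : (0 < d)%N ->
  0 < \int[leb d]_y (profile eta (enorm y))%:E.
Proof.
(* The cube of half-side [r] lies in the Euclidean ball of radius 1/2, where [eta] is at least its
   positive value at 1/2. *)
move=> d0; pose r : R := ((Num.sqrt d%:R * 2)^-1)%R.
have sd : (0 < (Num.sqrt d%:R : R))%R by rewrite sqrtr_gt0 ltr0n.
have r0 : (0 < r)%R by rewrite invr_gt0 mulr_gt0.
have mc := @measurable_cube R d 0%R r.
have m0 := @measurable_point_Rd R d 0%R.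
have mD : measurable (cube (0%R : Rd R d) r `\ 0%R) by exact: measurableD.
apply: (@lt_le_trans _ _ (\int[leb d]_(y in cube 0%R r `\ 0%R) (eta (2^-1))%:E)).
  rewrite integral_cst//.
  rewrite mule_gt0//.
    by rewrite lte_fin (eta_gt0 keta) ?invr_gt0// invf_lt1 ?ltr1n.
  have lc := leb_cube (0%R : Rd R d) (ltW r0).
  rewrite measureD//; last by rewrite [X in X < _]lc ltry.
  rewrite [X in _ - X](_ : _ = 0); last first.
    apply: (@subset_measure0 _ _ R (leb d) _ [set 0%R]) => //.
    - exact: measurableI.
    - exact: leb_point.
  by rewrite sube0 [X in _ < X]lc lte_fin exprn_gt0// mulr_gt0.
rewrite integral_mkcond; apply: ge0_le_integral_nonmeas => y _.
  apply: erestrict_ge0 => z _; rewrite lee_fin ltW//.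
  by rewrite (eta_gt0 keta) ?invr_gt0// invf_lt1 ?ltr1n.
rewrite /patch; case: ifPn => [|_]; last by rewrite lee_fin (profile_ge0 keta).
rewrite inE => -[yc /eqP y0]; rewrite lee_fin /profile enorm_gt0 y0.
apply: (wk_nonincreasing keta); first by rewrite enorm_gt0.
have -> : 2^-1%R = (Num.sqrt d%:R * r)%R.
  by rewrite /r invfM mulrA divff ?gt_eqF// mul1r.
apply: enorm_le_sup; first exact: ltW.
by move=> i; have := yc i; rewrite mxE subr0.
Qed.

(** Smallness uniform in the centre [y]: the part of the profile above height [n] has a small
    integral wherever it is centred, and the part below contributes at most [n] times the volume of
    the cube. *)
Lemma integral_profile_cube_small : (0 < d)%N ->
  \int[leb d]_y (profile eta (enorm y))%:E < +oo ->
  forall e : R, (0 < e)%R -> exists2 r : R, (0 < r)%R & forall y,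
    \int[leb d]_(x in cube 0%R r) (profile eta (enorm (x - y)%R))%:E <= e%:E.
Proof.
move=> d0 foo e e0; set f := fun y : Rd R d => profile eta (enorm y).
have mf : measurable_fun setT f := measurable_profile_enorm.
have f0 y : (0 <= f y)%R by exact: profile_ge0 keta _.
have intf : (leb d).-integrable setT (EFin \o f).
  apply/integrableP; split; first exact/measurable_EFinP.
  by under eq_integral do rewrite /= ger0_norm//.
pose rest n y := (f y - Num.min (f y) n%:R)%R.
have mrest n : measurable_fun setT (rest n).
  by apply: measurable_funB => //; exact: measurable_minr.
have rest0 n y : (0 <= rest n y)%R by rewrite subr_ge0 ge_min lexx.
have : \int[leb d]_y (rest n y)%:E @[n --> \oo] --> 0.
  have := @dominated_convergence _ _ _ (leb d) setT measurableT
    (fun n y => (rest n y)%:E) (cst 0) (EFin \o f).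
  rewrite integral0 => -[] //.
  - by move=> n; exact/measurable_EFinP.
  - apply/aeW => y _; apply: cvg_near_cst; near=> n.
    rewrite /rest min_l ?subrr//; near: n; exact: nbhs_infty_ger.
  - apply/aeW => y n _; rewrite gee0_abs ?lee_fin//.
    by rewrite /rest gerBl le_min f0 ler0n.
move=> /fine_cvgP[fin_rest] /cvgrPdist_lt/(_ (e / 2)%R).
rewrite divr_gt0// => /(_ isT) rest_lt.
have [n [nfin nlt]] : exists n, \int[leb d]_y (rest n y)%:E \is a fin_num /\
    (`|0 - fine (\int[leb d]_y (rest n y)%:E)| < e / 2)%R.
  by near \oo => n; exists n; split; near: n.
have restn : \int[leb d]_y (rest n y)%:E <= (e / 2)%:E.
  rewrite -(fineK nfin) lee_fin ltW//; apply: le_lt_trans nlt.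
  by rewrite sub0r normrN ler_norm.
(* The first bound gives (2 r)^d <= 2 r, the second n (2 r) <= e / 2; the summand 4 keeps the
   denominator positive when n = 0. *)
pose r : R := (Num.min 2^-1 (e / (n%:R * 4 + 4)))%R.
have n4 : (0 < n%:R * 4 + 4 :> R)%R by rewrite ltr_wpDl// mulr_ge0.
have r0 : (0 < r)%R by rewrite lt_min invr_gt0 ltr0n divr_gt0.
exists r => // y; have mc := @measurable_cube R d 0%R r.
have msh : measurable_fun setT (fun x => f (x - y)%R).
  exact: measurable_profile_subr.
have mrs : measurable_fun setT (fun x => rest n (x - y)%R).
  apply: measurable_funB => //; exact: measurable_minr.
apply: (@le_trans _ _ (\int[leb d]_(x in cube 0%R r)
    ((rest n (x - y)%R)%:E + n%:R%:E))).
  apply: ge0_le_integral_nonmeas => x _; first by rewrite lee_fin f0.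
  by rewrite -EFinD lee_fin /rest -/(f (x - y)%R) -addrA lerDl addrC subr_ge0 ge_min lexx orbT.
rewrite ge0_integralD//; last 2 first.
- by move=> x _; rewrite lee_fin.
- exact/measurable_EFinP/measurable_funTS.
have lc := leb_cube (0%R : Rd R d) (ltW r0).
rewrite integral_cst// [X in _ + _ * X]lc -EFinM.
rewrite (splitr e) EFinD leeD//.
  apply: le_trans restn; rewrite -[leRHS](@ge0_integral_translate R d (- y)%R).
  - rewrite integral_mkcond; apply: ge0_le_integral_nonmeas => x _.
      by apply: erestrict_ge0 => z _; rewrite lee_fin.
    by rewrite /patch addrC; case: ifPn => // _; rewrite lee_fin.
  - exact/measurable_EFinP.
  - by move=> x; rewrite lee_fin.
have r1 : (2 * r <= 1)%R by rewrite mulrC -ler_pdivlMr// div1r /r ge_min lexx.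
rewrite lee_fin; apply: (@le_trans _ _ (n%:R * (2 * r)))%R.
  rewrite ler_wpM2l// -(prednK d0) exprS ler_piMr//; first by rewrite mulr_ge0// ltW.
  by rewrite exprn_ile1// mulr_ge0// ltW.
have : (r * (n%:R * 4 + 4) <= e)%R.
  by rewrite -ler_pdivlMr// /r ge_min lexx orbT.
have : (0 <= n%:R :> R)%R by [].
by nra.
Unshelve. all: end_near. Qed.

End kernel_integrals.


(** * Calculus of C^k functions *)

Section Ck_theory.
Context {R : realType} {V : normedModType R}.
Implicit Types (f g : V -> R) (x v : V) (k : nat).

(** A directional derivative is a derivative along a line; this makes the one-variable chain rule
    available for scalar functions of [f]. *)
Lemma is_derive1_lineP f x v (df : R) :
  is_derive x v f df <-> is_derive (0 : R) (1 : R) (fun h : R => f (h *: v + x)) df.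
Proof.
have E : 'D_v f x = 'D_(1 : R) (fun h : R => f (h *: v + x)) (0 : R).
  rewrite /derive; set g1 := fun h => h^-1 *: _; set g2 := fun h => h^-1 *: _.
  suff -> : g1 = g2 by [].
  by rewrite funeqE /g1 /g2 => h /=; rewrite addr0 scale0r add0r [_%:A]mulr1.
split=> -[fx fE].
  by split; [exact: (derivable1P f x v).1|rewrite -E].
by split; [exact: (derivable1P f x v).2|rewrite E].
Qed.

Lemma is_derive_comp1 (psi : R -> R) f x v (dpsi df : R) :
  is_derive (f x) 1 psi dpsi -> is_derive x v f df ->
  is_derive x v (psi \o f) (dpsi * df).
Proof.
move=> dp /is_derive1_lineP df'; apply/is_derive1_lineP.
apply: (@is_derive1_comp _ psi (fun h : R => f (h *: v + x))) => //.
by rewrite scale0r add0r.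
Qed.

Lemma Ck_onW k f : Ck_on setT k.+1 f -> Ck_on setT k f.
Proof.
elim: k f => [|k ih] f [cf df]; split => // v; have [dv Dv] := df v.
by split => //; exact: ih.
Qed.

Lemma Ck_on_continuous k f : Ck_on setT k f -> continuous f.
Proof. by case: k => [|k] [cf _] x; apply: cf; rewrite inE. Qed.

Lemma Ck_on_derivable k f x v : Ck_on setT k.+1 f -> derivable f x v.
Proof. by move=> [_ /(_ v)[+ _]]; apply. Qed.

Lemma Ck_on_derive k f v : Ck_on setT k.+1 f -> Ck_on setT k ('D_v f).
Proof. by move=> [_ /(_ v)[_]]. Qed.

(** The form in which closure properties are proved: the derivatives are exhibited by a formula
    whose regularity comes from the induction hypothesis. *)
Lemma Ck_onS k f (Df : V -> V -> R) : continuous f ->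
  (forall v x, is_derive x v f (Df v x)) -> (forall v, Ck_on setT k (Df v)) ->
  Ck_on setT k.+1 f.
Proof.
move=> cf df Ck; split=> [x _|v]; first exact: cf.
split=> [x _|]; first by have [] := df v x.
rewrite (_ : 'D_v f = Df v)//; apply/funext => x.
by have [] := df v x.
Qed.

Lemma Ck_on_cst k (c : R) : Ck_on setT k (cst c : V -> R).
Proof.
elim: k c => [|k ih] c; first by split => // x _; exact: cvg_cst.
apply: (@Ck_onS _ _ (fun _ => cst 0)).
- by move=> x; exact: cvg_cst.
- by move=> v; exact: (ih 0).
Qed.

Lemma Ck_onD k f g : Ck_on setT k f -> Ck_on setT k g -> Ck_on setT k (f + g).
Proof.
elim: k f g => [|k ih] f g Cf Cg; have cf := Ck_on_continuous Cf;
  have cg := Ck_on_continuous Cg.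
  by split => // x _; apply: continuousD; [exact: cf|exact: cg].
apply: (@Ck_onS _ _ (fun v => 'D_v f + 'D_v g)).
- by move=> x; apply: continuousD; [exact: cf|exact: cg].
- move=> v x; have := @Ck_on_derivable _ _ x v Cf; have := @Ck_on_derivable _ _ x v Cg.
  by move=> /derivableP dg /derivableP df; exact: is_deriveD.
- by move=> v; apply: ih; exact: Ck_on_derive.
Qed.

Lemma Ck_onM k f g : Ck_on setT k f -> Ck_on setT k g -> Ck_on setT k (f * g).
Proof.
elim: k f g => [|k ih] f g Cf Cg; have cf := Ck_on_continuous Cf;
  have cg := Ck_on_continuous Cg.
  by split => // x _; apply: continuousM; [exact: cf|exact: cg].
apply: (@Ck_onS _ _ (fun v => f * 'D_v g + g * 'D_v f)).
- by move=> x; apply: continuousM; [exact: cf|exact: cg].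
- move=> v x; have := @Ck_on_derivable _ _ x v Cf; have := @Ck_on_derivable _ _ x v Cg.
  by move=> /derivableP dg /derivableP df; exact: is_deriveM.
- by move=> v; apply: Ck_onD; (apply: ih; [exact: Ck_onW|exact: Ck_on_derive]).
Qed.

Lemma Ck_on_inv k f : (forall x, f x != 0) -> Ck_on setT k f ->
  Ck_on setT k (fun x => (f x)^-1).
Proof.
move=> f0; elim: k => [|k ih] Cf; have cf := Ck_on_continuous Cf;
  have cV : continuous (fun x => (f x)^-1).
- by move=> x; apply: continuousV => //; exact: cf.
- by split => // x _; exact: cV.
- by move=> x; apply: continuousV => //; exact: cf.
- have CV := ih (Ck_onW Cf).
  apply: (@Ck_onS _ _ (fun v => cst (-1) * ((fun x => (f x)^-1) * (fun x => (f x)^-1)) * 'D_v f)) => //.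
    move=> v x.
    have dx := @Ck_on_derivable _ _ x v Cf.
    apply: DeriveDef; first exact: derivableV.
    by rewrite deriveV// !fctE /= /GRing.scale/= mulN1r -expr2 exprVn.
  move=> v; apply: Ck_onM; last exact: Ck_on_derive.
  by apply: Ck_onM; [exact: Ck_on_cst|exact: Ck_onM].
Qed.

Lemma Ck_on_linear k f : continuous f -> linear f -> Ck_on setT k f.
Proof.
move=> cf lf; case: k => [|k]; first by split => // x _; exact: cf.
apply: (@Ck_onS _ _ (fun v => cst (f v))) => //; last first.
  by move=> v; exact: Ck_on_cst.
move=> v x; apply/is_derive1_lineP.
rewrite (_ : (fun h => _) = (id : R -> R) * cst (f v) + cst (f x)); last first.
  by apply/funext => h; rewrite lf.
apply: is_derive_eq.
by rewrite /= scale0r add0r addr0 /GRing.scale/= mulr1.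
Qed.

End Ck_theory.

(** * Flat functions built from exp(-1/x) *)

Section smooth_cutoff.
Context {R : realType}.
Implicit Types (p : {poly R}).

(** The class of functions p(1/x) exp(-1/x), extended by 0, is stable under differentiation; hence
    the polynomial parameter, which the induction on the order of smoothness has to vary. *)
Definition exp_poly p (x : R) : R := if 0 < x then p.[x^-1] * expR (- x^-1) else 0.

Lemma horner_le p : exists2 C : R, 0 <= C &
  forall y, 1 <= y -> `|p.[y]| <= C * y ^+ size p.
Proof.
exists (\sum_(i < size p) `|p`_i|) => [|y y1]; first exact: sumr_ge0.
rewrite horner_coef; apply: le_trans (ler_norm_sum _ _ _) _.
rewrite mulr_suml; apply: ler_sum => i _.
rewrite normrM ler_wpM2l// ger0_norm ?exprn_ge0 ?(le_trans ler01)//.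
by rewrite ler_weXn2l// ltnW.
Qed.

(** The Taylor term of order n + 1 of exp(1/x), with n the size of [p], beats p(1/x) with one power
    of [x] to spare. *)
Lemma exp_poly_le p : exists2 C : R, 0 <= C &
  forall x, `|x| <= 1 -> `|exp_poly p x| <= C * `|x|.
Proof.
have [C C0 pC] := horner_le p; pose n := size p.
exists (C * n.+1`!%:R) => [|x]; first by rewrite mulr_ge0.
rewrite /exp_poly; case: ifPn => [x0|_ _]; last by rewrite normr0 !mulr_ge0.
rewrite gtr0_norm// => x1; have xV1 : 1 <= x^-1 by rewrite invf_ge1.
rewrite normrM (ger0_norm (expR_ge0 _)) expRN.
have xV0 : 0 <= x^-1 by rewrite invr_ge0 ltW.
have ey : x^-1 ^+ n.+1 / n.+1`!%:R <= expR x^-1.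
  by apply: le_trans (expR_ge1Dxn n xV0); rewrite lerDr.
have f0 : 0 < n.+1`!%:R :> R by rewrite ltr0n fact_gt0.
apply: (@le_trans _ _ (C * x^-1 ^+ n * (x^-1 ^+ n.+1 / n.+1`!%:R)^-1)).
  apply: ler_pM; rewrite ?normr_ge0 ?invr_ge0 ?expR_ge0 ?pC//.
  by rewrite lef_pV2 ?posrE ?expR_gt0// divr_gt0// exprn_gt0 ?invr_gt0.
rewrite exprS; have : x^-1 ^+ n != 0 by rewrite expf_neq0// invr_neq0// gt_eqF.
set z := x^-1 ^+ n => z0; rewrite le_eqVlt; apply/orP; left; apply/eqP.
by field; rewrite z0 !gt_eqF.
Qed.

Lemma exp_poly_cvg0 p : exp_poly p x @[x --> (0 : R)] --> (0 : R).
Proof.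
have [C C0 pC] := exp_poly_le p.
apply/cvgr0Pnorm_le => e e0; near=> x.
have x1 : `|x| <= 1 by near: x; exact: (@nbhs0_le R R^o).
apply: le_trans (pC x x1) _.
have xe : `|x| <= e / (C + 1).
  by near: x; apply: (@nbhs0_le R R^o); rewrite divr_gt0// ltr_wpDl.
rewrite ler_pdivlMr in xe; last by rewrite ltr_wpDl.
apply: le_trans xe; rewrite mulrC ler_wpM2l// lerDl.
exact: ler01.
Unshelve. all: end_near. Qed.

Lemma exp_poly0 p x : x <= 0 -> exp_poly p x = 0.
Proof. by rewrite /exp_poly leNgt => /negbTE ->. Qed.

Lemma is_derive_exp_poly p x :
  is_derive x (1 : R) (exp_poly p) (exp_poly ('X^2 * (p - p^`())) x).
Proof.
have [x0|x0|x0] := ltgtP x 0.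
- rewrite exp_poly0 ?ltW//; apply: (@near_eq_is_derive _ _ _ (cst 0)).
    near=> y; rewrite exp_poly0// ltW//; near: y; exact: lt_nbhsl.
- apply: (@near_eq_is_derive _ _ _ (fun y : R => p.[y^-1] * expR (- y^-1))).
    near=> y; rewrite /exp_poly ifT//; near: y; exact: lt_nbhsr.
  have dV : is_derive x (1 : R) (fun y : R => y^-1) (- x ^- 2).
    apply: DeriveDef; first by apply: derivableV; rewrite ?gt_eqF//.
    by rewrite deriveV ?gt_eqF// derive_id /GRing.scale/= mulr1.
  have dp : is_derive x (1 : R) (horner p \o (fun y : R => y^-1))
    (p^`().[x^-1] * - x ^- 2) by exact: is_derive1_comp.
  have dN : is_derive x (1 : R) (fun y : R => - y^-1) (x ^- 2).
    by rewrite -[x ^- 2]opprK; exact: is_deriveN.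
  have de : is_derive x (1 : R) (expR \o (fun y : R => - y^-1))
    (expR (- x^-1) * x ^- 2) by exact: is_derive1_comp.
  have h := is_deriveM dp de; refine (@is_derive_eq _ _ _ _ _ _ _ _ h _).
  rewrite /exp_poly x0 !hornerE/= /GRing.scale/= exprVn; ring.
- rewrite x0 exp_poly0//.
  (* At 0 the difference quotient belongs to the same class, with polynomial X p, and so tends to
     0. *)
  have E : (fun h : R => h^-1 *: (exp_poly p (h *: (1 : R) + 0) - exp_poly p 0)) =
           exp_poly ('X * p).
    apply/funext => h; rewrite addr0 [h *: _]mulr1 [exp_poly p 0]exp_poly0// subr0.
    rewrite /exp_poly; case: ifPn => h0; last by rewrite scaler0.
    by rewrite hornerM hornerX -mulrA.
  have cE : exp_poly ('X * p) @ 0^' --> (0 : R).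
    exact: (cvg_within_filter _ (@exp_poly_cvg0 _)).
  apply: DeriveDef; first by apply/cvg_ex; exists 0; rewrite E.
  by rewrite /derive E; apply: cvg_lim.
Unshelve. all: end_near. Qed.

Lemma exp_poly_continuous p : continuous (exp_poly p).
Proof.
move=> x; apply: differentiable_continuous; apply/derivable1_diffP.
by have [] := is_derive_exp_poly p x.
Qed.

Lemma Ck_on_exp_poly (V : normedModType R) k p (g : V -> R) :
  Ck_on setT k g -> Ck_on setT k (exp_poly p \o g).
Proof.
elim: k p => [|k ih] p Cg; have cg := Ck_on_continuous Cg.
  split => // x _; apply: continuous_comp; [exact: cg|exact: exp_poly_continuous].
apply: (@Ck_onS _ _ _ _ (fun v => (exp_poly ('X^2 * (p - p^`())) \o g) * 'D_v g)).
- move=> x; apply: continuous_comp; [exact: cg|exact: exp_poly_continuous].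
- move=> v x; have /derivableP dg := @Ck_on_derivable _ _ _ _ x v Cg.
  by apply: is_derive_comp1; exact: is_derive_exp_poly.
- move=> v; apply: Ck_onM; last exact: Ck_on_derive.
  by apply: ih; exact: Ck_onW.
Qed.

End smooth_cutoff.


(** * Smooth steps and ramps *)

Section smooth_step.
Context {R : realType}.
Implicit Types (x : R).

(** Smoothness as stability of C^k under composition on the left, over all normed spaces: it
    composes immediately and applies directly to functions of one coordinate of a product. *)
Definition smooth1 (a : R -> R) : Prop :=
  forall (V : normedModType R) k (g : V -> R),
    Ck_on setT k g -> Ck_on setT k (a \o g).

Let e : R -> R := exp_poly 1.

Let e_ge0 x : 0 <= e x.
Proof. by rewrite /e /exp_poly; case: ifPn => // _; rewrite hornerC mul1r expR_ge0. Qed.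

Let e_gt0 x : 0 < x -> 0 < e x.
Proof. by move=> x0; rewrite /e /exp_poly x0 hornerC mul1r expR_gt0. Qed.

Let e0 x : x <= 0 -> e x = 0. Proof. exact: exp_poly0. Qed.

Let smooth1_e : smooth1 e. Proof. by move=> V k g; exact: Ck_on_exp_poly. Qed.

Lemma Ck_on_id k : Ck_on setT k (@id R).
Proof. by apply: Ck_on_linear => // x; exact: cvg_id. Qed.

Lemma smooth1_Ck (a : R -> R) k : smooth1 a -> Ck_on setT k a.
Proof. by move=> /(_ R k id); apply; exact: Ck_on_id. Qed.

Lemma smooth1M a b : smooth1 a -> smooth1 b -> smooth1 (a * b).
Proof.
by move=> sa sb V k g Cg; apply: (@Ck_onM _ _ _ (a \o g) (b \o g)); [exact: sa|exact: sb].
Qed.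

Lemma smooth1D a b : smooth1 a -> smooth1 b -> smooth1 (a + b).
Proof.
by move=> sa sb V k g Cg; apply: (@Ck_onD _ _ _ (a \o g) (b \o g)); [exact: sa|exact: sb].
Qed.

Lemma smooth1_cst c : smooth1 (cst c).
Proof. by move=> V k g _; exact: (@Ck_on_cst _ _ k c). Qed.

Lemma smooth1_affine (u v : R) : smooth1 (fun x => u * x + v).
Proof.
move=> V k g Cg.
by apply: (@Ck_onD _ _ _ (cst u * g) (cst v));
  [apply: Ck_onM => //|]; exact: Ck_on_cst.
Qed.

Lemma smooth1_comp a b : smooth1 a -> smooth1 b -> smooth1 (a \o b).
Proof. by move=> sa sb V k g Cg; apply: (sa _ _ (b \o g)); exact: sb. Qed.

Definition smooth_step x : R := e x / (e x + e (1 - x)).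

Let step_den x : 0 < e x + e (1 - x).
Proof.
have [x0|x0] := leP x 0; last by rewrite ltr_wpDr ?e_gt0.
by rewrite ltr_wpDl// e_gt0// subr_gt0 (le_lt_trans x0).
Qed.

Lemma smooth1_step : smooth1 smooth_step.
Proof.
apply: (@smooth1M e (fun x => (e x + e (1 - x))^-1)) => // V k g Cg.
apply: (@Ck_on_inv _ _ _ (fun v => e (g v) + e (1 - g v))) => [v|].
  by rewrite gt_eqF.
apply: (@Ck_onD _ _ _ (e \o g)); first exact: smooth1_e.
apply: (smooth1_e (g := fun v => 1 - g v)).
rewrite (_ : (fun v => _) = (fun x => -1 * x + 1) \o g); first exact: smooth1_affine.
by apply/funext => v /=; rewrite mulN1r addrC.
Qed.

Lemma smooth_step_le0 x : x <= 0 -> smooth_step x = 0.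
Proof. by move=> x0; rewrite /smooth_step e0// mul0r. Qed.

Lemma smooth_step_ge1 x : 1 <= x -> smooth_step x = 1.
Proof.
move=> x1; rewrite /smooth_step [e (1 - x)]e0 ?subr_le0// addr0 divff//.
by rewrite gt_eqF// e_gt0// (lt_le_trans ltr01).
Qed.

Lemma smooth_step_ge0 x : 0 <= smooth_step x.
Proof. by rewrite divr_ge0// ltW. Qed.

Lemma smooth_step_le1 x : smooth_step x <= 1.
Proof. by rewrite ler_pdivrMr// mul1r lerDl. Qed.

Let de x := exp_poly ('X^2 * (1 - 1^`())) x : R.

Let de_ge0 x : 0 <= de x.
Proof.
rewrite /de /exp_poly derivC subr0 mulr1; case: ifPn => // x0.
by rewrite hornerXn mulr_ge0 ?sqr_ge0 ?expR_ge0.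
Qed.

(** The sign that makes the derivative of a ramp a probability density. The numerator of the
    quotient rule simplifies to e'(x) e(1 - x) + e(x) e'(1 - x). *)
Lemma derive_smooth_step_ge0 x : 0 <= smooth_step^`()%classic x.
Proof.
have d1 : is_derive x (1 : R) e (de x) := is_derive_exp_poly 1 x.
have d0 : is_derive x (1 : R) (fun y : R => 1 - y) (-1).
  rewrite (_ : (fun y : R => 1 - y) = cst 1 - id)//.
  by apply: is_derive_eq; rewrite sub0r.
have d2 : is_derive x (1 : R) (e \o (fun y : R => 1 - y)) (de (1 - x) * -1).
  by apply: is_derive1_comp; exact: is_derive_exp_poly.
have d3 := is_deriveD d1 d2.
have n0 : (e + (e \o (fun y : R => 1 - y))) x != 0 by exact: (lt0r_neq0 (step_den x)).
pose u := e x + e (1 - x).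
have u0 : u != 0 by rewrite gt_eqF// /u step_den.
have d4 : is_derive x (1 : R) (fun y : R => (e y + e (1 - y))^-1)
  (- u ^- 2 *: (de x + de (1 - x) * -1)) := is_deriveV n0 d3.
have := is_deriveM d1 d4 => -[_]; rewrite derive1E => ->.
rewrite /GRing.scale/=.
have -> : (e x + e (1 - x))^-1 * de x = u^-1 * de x by [].
have eu : e (1 - x) = u - e x by rewrite /u; ring.
rewrite (_ : _ + _ = (de x * e (1 - x) + e x * de (1 - x)) / u ^+ 2); last first.
  by rewrite eu; field; exact: u0.
by rewrite divr_ge0 ?sqr_ge0// addr_ge0// mulr_ge0.
Qed.

Lemma smooth1_derivable a r : smooth1 a -> derivable a r (1 : R).
Proof. by move=> sa; apply: (@Ck_on_derivable _ _ 0); exact: smooth1_Ck. Qed.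

Lemma smooth1_derive_continuous a : smooth1 a -> continuous (a^`()%classic).
Proof.
move=> sa; have C := smooth1_Ck 1 sa.
have := Ck_on_continuous (Ck_on_derive (1 : R) C).
by rewrite (_ : a^`()%classic = 'D_(1 : R) a)//; apply/funext => r; rewrite derive1E.
Qed.

Lemma smooth1_continuous a : smooth1 a -> continuous a.
Proof. by move=> sa; exact: Ck_on_continuous (smooth1_Ck 0 sa). Qed.

Definition ramp (s tau r : R) : R := smooth_step ((r - s) / tau).

Lemma smooth1_ramp s tau : smooth1 (ramp s tau).
Proof.
rewrite (_ : ramp s tau = smooth_step \o (fun r => tau^-1 * r + - (s / tau))).
  by apply: smooth1_comp; [exact: smooth1_step|exact: smooth1_affine].
by apply/funext => r; rewrite /ramp/=; congr smooth_step; ring.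
Qed.

Lemma ramp_ge0 s tau r : 0 <= ramp s tau r. Proof. exact: smooth_step_ge0. Qed.

Lemma ramp_le1 s tau r : ramp s tau r <= 1. Proof. exact: smooth_step_le1. Qed.

Lemma ramp0 s tau r : 0 < tau -> r <= s -> ramp s tau r = 0.
Proof.
by move=> t0 rs; apply: smooth_step_le0; rewrite pmulr_lle0 ?invr_gt0// subr_le0.
Qed.

Lemma ramp1 s tau r : 0 < tau -> s + tau <= r -> ramp s tau r = 1.
Proof.
by move=> t0 rs; apply: smooth_step_ge1; rewrite ler_pdivlMr// mul1r lerBrDl.
Qed.

Lemma derive_ramp_ge0 s tau r : 0 < tau -> 0 <= (ramp s tau)^`()%classic r.
Proof.
move=> t0; rewrite (_ : ramp s tau = smooth_step \o (fun r => tau^-1 * r + - (s / tau))).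
  rewrite derive1_comp; [|exact/smooth1_derivable/smooth1_affine|
    exact/smooth1_derivable/smooth1_step].
  apply: mulr_ge0; first exact: derive_smooth_step_ge0.
  have : is_derive r (1 : R) (fun x : R => tau^-1 * x + - (s / tau)) tau^-1.
    apply: (@is_derive_eq _ _ _ (cst tau^-1 * id + cst (- (s / tau)))).
    by rewrite /GRing.scale/=; ring.
  by move=> [_]; rewrite derive1E => ->; rewrite invr_ge0 ltW.
by apply/funext => x; rewrite /ramp/=; congr smooth_step; ring.
Qed.

Lemma derive_ramp_eq0 s tau r : 0 < tau -> (r < s) || (s + tau < r) ->
  (ramp s tau)^`()%classic r = 0.
Proof.
move=> t0 /orP[rs|rs]; rewrite derive1E.
  rewrite (@near_eq_derive R R R _ (cst (0 : R))) ?derive_cst//.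
  by near=> x; rewrite ramp0// ltW//; near: x; exact: lt_nbhsl.
rewrite (@near_eq_derive R R R _ (cst (1 : R))) ?derive_cst//.
by near=> x; rewrite ramp1// ltW//; near: x; exact: lt_nbhsr.
Unshelve. all: end_near. Qed.

Local Notation mu := (@lebesgue_measure R).

Lemma within_continuous_integrable (f : R -> R) :
  {within `[0, 1], continuous f} -> mu.-integrable `[0, 1] (EFin \o f).
Proof.
by move=> cf; apply: continuous_compact_integrable => //; exact: segment_compact.
Qed.

(** The derivative of the ramp is a probability density carried by [s, s + tau], so integrating
    against it averages [g] over that interval. *)
Lemma ramp_integral (g : R -> R) s tau gam eps :
  {within `[0, 1], continuous g} -> 0 <= s -> s + tau <= 1 -> 0 < tau ->
  (forall r, s <= r <= s + tau -> `|g r - gam| <= eps) ->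
  `|\int[mu]_(r in `[0, 1]) ((ramp s tau)^`()%classic r * g r) - gam| <= eps.
Proof.
move=> cg s0 s1 t0 geps; set D := (ramp s tau)^`()%classic.
have cD : continuous D := smooth1_derive_continuous (smooth1_ramp s tau).
have D0 r : 0 <= D r by exact: derive_ramp_ge0.
have eps0 : 0 <= eps by apply: le_trans (geps s _); rewrite ?lexx//= lerDl ltW.
have iD : mu.-integrable `[0, 1] (EFin \o D).
  by apply: within_continuous_integrable; exact: continuous_subspaceT.
have ID : \int[mu]_(r in `[0, 1]) D r = 1.
  rewrite /Rintegral (@continuous_FTC2 _ D (ramp s tau))//.
  - by rewrite ramp1// ramp0// sube0.
  - exact: continuous_subspaceT.
  - have cr := smooth1_continuous (smooth1_ramp s tau).
    split; [|exact: cvg_at_right_filter (cr _)|exact: cvg_at_left_filter (cr _)].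
    by move=> x _; exact: smooth1_derivable (smooth1_ramp s tau).
have cDg : {within `[0, 1], continuous (fun r => D r * g r)}.
  by move=> x; apply: cvgM; [exact: continuous_subspaceT|exact: cg].
have iDg := within_continuous_integrable cDg.
have -> : gam = \int[mu]_(r in `[0, 1]) (D r * gam) by rewrite RintegralZr// ID mul1r.
have cDgam : {within `[0, 1], continuous (fun r => D r * gam)}.
  by apply: continuous_subspaceT => x; apply: cvgM; [exact: cD|exact: cvg_cst].
have iDgam := within_continuous_integrable cDgam.
have iB : mu.-integrable `[0, 1] (EFin \o (fun r => D r * g r - D r * gam)).
  by apply: within_continuous_integrable; exact: within_continuousB.
rewrite -RintegralB//; apply: le_trans (le_normr_Rintegral _ iB) _ => //.
apply: (@le_trans _ _ (\int[mu]_(r in `[0, 1]) (D r * eps))); last first.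
  by rewrite RintegralZr// ID mul1r.
have iDe : mu.-integrable `[0, 1] (EFin \o (fun r => D r * eps)).
  apply: within_continuous_integrable; apply: continuous_subspaceT => x.
  by apply: cvgM; [exact: cD|exact: cvg_cst].
apply: le_Rintegral => //.
- exact: integrable_norm.
- move=> r _; rewrite -mulrBr normrM ger0_norm//.
  have [rs|rs] := boolP ((r < s) || (s + tau < r)).
    by rewrite /D derive_ramp_eq0// !mul0r.
  by rewrite ler_wpM2l// geps//; move: rs; rewrite negb_or -!leNgt.
Qed.

End smooth_step.


(** * Smooth staircases in time *)

Section step_test.
Context {R : realType}.
Local Notation mu := (@lebesgue_measure R).

(** Rises on [s + tau, s + 2 tau] and falls on [t - 2 tau, t - tau]; the margins of width [tau] keep
    plateaus over consecutive intervals disjoint and away from the ends of [0, 1]. *)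
Definition plateau (s t tau : R) : R -> R :=
  ramp (s + tau) tau + cst (-1) * ramp (t - 2 * tau) tau.

Lemma smooth1_plateau s t tau : smooth1 (plateau s t tau).
Proof.
apply: smooth1D; first exact: smooth1_ramp.
by apply: smooth1M; [exact: smooth1_cst|exact: smooth1_ramp].
Qed.

Lemma plateau01 s t tau r : 0 < tau -> 4 * tau <= t - s ->
  0 <= plateau s t tau r <= 1.
Proof.
move=> t0 st; rewrite /plateau !fctE/= mulN1r.
have := ramp_le1 (s + tau) tau r; have := ramp_ge0 (s + tau) tau r.
have [rt|rt] := leP r (t - 2 * tau).
  by rewrite (ramp0 _ rt)// subr0 => -> ->.
rewrite [ramp (s + tau) tau r]ramp1//; last by lra.
have := ramp_le1 (t - 2 * tau) tau r; have := ramp_ge0 (t - 2 * tau) tau r.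
by lra.
Qed.

Lemma plateau_neq0 s t tau r : 0 < tau -> 4 * tau <= t - s ->
  plateau s t tau r != 0 -> s + tau <= r <= t - tau.
Proof.
move=> t0 st; apply: contraNT; rewrite negb_and -!ltNge => /orP[rs|rs].
  by rewrite /plateau !fctE/= !ramp0 ?mulr0 ?addr0//; lra.
by rewrite /plateau !fctE/= !ramp1 ?mulr1 ?subrr//; lra.
Qed.

Lemma derive_plateau s t tau r : (plateau s t tau)^`()%classic r =
  (ramp (s + tau) tau)^`()%classic r - (ramp (t - 2 * tau) tau)^`()%classic r.
Proof.
have d1 : derivable (ramp (s + tau) tau) r 1 := smooth1_derivable (smooth1_ramp _ _).
have d2 : derivable (ramp (t - 2 * tau) tau) r 1 := smooth1_derivable (smooth1_ramp _ _).
have dc : derivable (cst (-1) : R -> R) r 1 by exact: derivable_cst.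
rewrite !derive1E /plateau (deriveD d1 (derivableM dc d2)) (deriveM dc d2).
by rewrite derive_cst scaler0 addr0 [_ *: _]mulN1r.
Qed.

Lemma within_continuous_eps (g : R -> R) x e : {within `[0, 1], continuous g} ->
  0 <= x <= 1 -> 0 < e -> exists2 del, 0 < del & forall y, 0 <= y <= 1 ->
    `|y - x| <= del -> `|g y - g x| <= e.
Proof.
move=> /subspace_continuousP cg x01 e0.
have := cg x; rewrite /= in_itv/= => /(_ x01) /cvgrPdist_le/(_ _ e0).
rewrite near_withinE => /nbhs_ballP[del /= del0 H].
exists (del / 2); first by rewrite divr_gt0.
move=> y y01 yx; rewrite distrC; apply: H; last by rewrite in_itv.
by rewrite /ball/= distrC (le_lt_trans yx)// ltr_pdivrMr// ltr_pMr// ltr1n.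
Qed.

Lemma plateau_integral (g : R -> R) s t e : {within `[0, 1], continuous g} ->
  0 <= s -> s < t -> t <= 1 -> 0 < e -> exists2 tau0, 0 < tau0 &
  forall tau, 0 < tau -> tau <= tau0 -> 4 * tau <= t - s /\
  `|\int[mu]_(r in `[0, 1]) ((plateau s t tau)^`()%classic r * g r)
    - (g s - g t)| <= e.
Proof.
move=> cg s0 st t1 e0.
have e2 : 0 < e / 2 by rewrite divr_gt0.
have [] := @within_continuous_eps g s (e / 2) cg _ e2; first by lra.
move=> d1 d10 H1.
have [] := @within_continuous_eps g t (e / 2) cg _ e2; first by lra.
move=> d2 d20 H2.
have [m [m0 m1 m2 m3]] : exists m, [/\ 0 < m, m <= d1, m <= d2 & m <= t - s].
  exists (Num.min d1 (Num.min d2 (t - s))).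
  by rewrite !lt_min d10 d20 subr_gt0 st !ge_min !lexx ?orbT; split.
exists (m / 4) => [|tau tau0 tm]; first by rewrite divr_gt0.
have tm4 : 4 * tau <= m by lra.
split; first by lra.
have cramp s' : {within `[0, 1], continuous (fun r => (ramp s' tau)^`()%classic r * g r)}.
  move=> x; apply: cvgM; last exact: cg.
  by apply: continuous_subspaceT => y; exact: smooth1_derive_continuous (smooth1_ramp _ _) y.
have iramp s' := within_continuous_integrable (cramp s').
have -> : \int[mu]_(r in `[0, 1]) ((plateau s t tau)^`()%classic r * g r) =
  \int[mu]_(r in `[0, 1]) ((ramp (s + tau) tau)^`()%classic r * g r) -
  \int[mu]_(r in `[0, 1]) ((ramp (t - 2 * tau) tau)^`()%classic r * g r).
  rewrite -RintegralB//; apply: eq_Rintegral => r _.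
  by rewrite derive_plateau mulrBl.
have h1 : `|\int[mu]_(r in `[0, 1]) ((ramp (s + tau) tau)^`()%classic r * g r) - g s| <= e / 2.
  apply: ramp_integral => //; [by lra|by lra|] => r rI; apply: H1; first by lra.
  by rewrite ger0_norm; lra.
have h2 : `|\int[mu]_(r in `[0, 1]) ((ramp (t - 2 * tau) tau)^`()%classic r * g r) - g t| <= e / 2.
  apply: ramp_integral => //; [by lra|by lra|] => r rI; apply: H2; first by lra.
  by rewrite ler0_norm; lra.
set A := \int[mu]_(r in _) _ in h1 *; set B := \int[mu]_(r in _) _ in h2 *.
rewrite (_ : _ - _ = (A - g s) - (B - g t)); last by ring.
by rewrite (splitr e); apply: le_trans (ler_normB _ _) _; exact: lerD.
Qed.

(* [a] is a smooth approximation of the step function with value [c i] on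
   ]T i, T i.+1[. *)
Lemma smooth_staircase n (T c : nat -> R) (g : R -> R) e :
  {within `[0, 1], continuous g} -> T 0%N = 0 -> T n = 1 ->
  (forall i, (i < n)%N -> T i < T i.+1) -> (forall i, 0 <= c i) -> 0 < e ->
  exists (a : R -> R) (tau : R), [/\ 0 < tau, smooth1 a,
    forall r, a r != 0 -> tau <= r <= 1 - tau,
    forall r, a r != 0 -> exists2 i, (i < n)%N &
      T i < r < T i.+1 /\ 0 <= a r <= c i &
    `|\int[mu]_(r in `[0, 1]) (a^`()%classic r * g r)
      - \sum_(i < n) c i * (g (T i) - g (T i.+1))| <= e].
Proof.
move=> cg T0 Tn TS c0 e0.
have Tle j : (j <= n)%N -> forall i, (i <= j)%N -> T i <= T j.
  elim: j => [_ i|j ih jn i]; first by rewrite leqn0 => /eqP ->.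
  rewrite leq_eqVlt => /predU1P[->//|]; rewrite ltnS => ij.
  by rewrite (le_trans (ih (ltnW jn) i ij))// ltW// TS.
have T_ge0 i : (i <= n)%N -> 0 <= T i by move=> iN; rewrite -T0; exact: Tle.
have T_le1 i : (i <= n)%N -> T i <= 1 by move=> iN; rewrite -Tn; exact: Tle.
(* An error e / C per plateau, weighted by [c i], sums to at most e; the summand 1 keeps [C]
   positive. *)
pose C := 1 + \sum_(i < n) c i.
have C0 : 0 < C by rewrite ltr_pwDl// sumr_ge0.
have eC : 0 < e / C by rewrite divr_gt0.
have [tau [tau0 tauP]] : exists tau, 0 < tau /\ forall i, (i < n)%N ->
    4 * tau <= T i.+1 - T i /\
    `|\int[mu]_(r in `[0, 1]) ((plateau (T i) (T i.+1) tau)^`()%classic r * g r)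
    - (g (T i) - g (T i.+1))| <= e / C.
  suff : forall m, (m <= n)%N -> exists2 tau0, 0 < tau0 & forall tau, 0 < tau ->
    tau <= tau0 -> forall i, (i < m)%N -> 4 * tau <= T i.+1 - T i /\
    `|\int[mu]_(r in `[0, 1]) ((plateau (T i) (T i.+1) tau)^`()%classic r * g r)
    - (g (T i) - g (T i.+1))| <= e / C.
    move=> /(_ n (leqnn n))[tau0 tau00 H]; exists tau0; split => // i.
    exact: H.
  elim=> [_|m ih mn]; first by exists 1.
  have [t1 t10 H1] := ih (ltnW mn).
  have [t2 t20 H2] := plateau_integral cg (T_ge0 _ (ltnW mn)) (TS _ mn) (T_le1 _ mn) eC.
  exists (Num.min t1 t2); first by rewrite lt_min t10.
  move=> tau tau0; rewrite le_min => /andP[tt1 tt2] i.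
  by rewrite ltnS leq_eqVlt => /predU1P[->|im]; [exact: H2|exact: H1].
pose p i := plateau (T i) (T i.+1) tau.
pose a : R -> R := \sum_(i < n) (cst (c i) * p i).
have aE r : a r = \sum_(i < n) c i * p i r by rewrite /a fct_sumE.
have p01 i r : (i < n)%N -> 0 <= p i r <= 1.
  by move=> iN; have [t4 _] := tauP i iN; exact: plateau01.
have pn i r : (i < n)%N -> p i r != 0 -> T i + tau <= r <= T i.+1 - tau.
  by move=> iN; have [t4 _] := tauP i iN; exact: plateau_neq0.
have a_neq0 r : a r != 0 -> exists2 i, (i < n)%N &
    T i + tau <= r <= T i.+1 - tau /\ 0 <= a r <= c i.
  move=> ar; have [i pi] : exists i : 'I_n, p i r != 0.
    apply/existsP; apply: contraNT ar; rewrite negb_exists => /forallP pr.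
    rewrite aE big1// => i _; have := pr i; rewrite negbK => /eqP ->.
    by rewrite mulr0.
  have rI := pn _ _ (ltn_ord i) pi; exists i => //; split => //.
  have -> : a r = c i * p i r.
    rewrite aE (bigD1 i)//= big1 ?addr0// => j ji.
    apply/eqP; rewrite mulf_eq0; apply/orP; right; apply: contraNT ji => pj.
    have /andP[rJ1 rJ2] := pn _ _ (ltn_ord j) pj; have /andP[rI1 rI2] := rI.
    have [lt_ij|lt_ij|/ord_inj ->//] := ltngtP (nat_of_ord j) i; exfalso.
      have Tij : T j.+1 <= T i by exact: Tle (ltnW (ltn_ord i)) _ lt_ij.
      by move: rI1 rJ2 Tij tau0; clear; lra.
    have Tij : T i.+1 <= T j by exact: Tle (ltnW (ltn_ord j)) _ lt_ij.
    by move: rJ1 rI2 Tij tau0; clear; lra.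
  have /andP[p0 p1] := p01 i r (ltn_ord i).
  by rewrite mulr_ge0//= ler_piMr.
exists a, tau; split => //.
- rewrite /a; elim/big_ind : _ => [|f h sf sh|i _].
  + exact: smooth1_cst.
  + exact: smooth1D.
  + by apply: smooth1M; [exact: smooth1_cst|exact: smooth1_plateau].
- move=> r /a_neq0[i iN [rI _]].
  by have := T_ge0 i (ltnW iN); have := T_le1 i.+1 iN; lra.
- by move=> r /a_neq0[i iN [rI aI]]; exists i => //; split => //; lra.
have dc i r : derivable (cst (c i) : R -> R) r 1 by exact: derivable_cst.
have dp i r : derivable (p i) r 1 := smooth1_derivable (smooth1_plateau _ _ _).
have dE r : a^`()%classic r = \sum_(i < n) c i * (p i)^`()%classic r.
  rewrite derive1E /a derive_sum => [|i].
    apply: eq_bigr => i _.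
    by rewrite (deriveM (dc i r) (dp i r)) derive_cst scaler0 addr0 derive1E.
  exact: derivableM.
have cp i : {within `[0, 1], continuous (fun r => (p i)^`()%classic r * g r)}.
  move=> x; apply: cvgM; last exact: cg.
  apply: continuous_subspaceT => y.
  exact: smooth1_derive_continuous (smooth1_plateau _ _ _) y.
have ip i := within_continuous_integrable (cp i).
have -> : \int[mu]_(r in `[0, 1]) (a^`()%classic r * g r) =
    \sum_(i < n) c i * \int[mu]_(r in `[0, 1]) ((p i)^`()%classic r * g r).
  transitivity (fine (\int[mu]_(r in `[0%R, 1%R])
      (\sum_(i < n) ((c i)%:E * ((p i)^`()%classic r * g r)%:E))%E)%E).
    congr fine; apply: eq_integral => r _; rewrite dE mulr_suml -sumEFin.
    by apply: eq_bigr => i _; rewrite -mulrA EFinM.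
  rewrite integral_sum//; last first.
    by move=> i; exact: (@integrableZl _ _ _ mu _ _ (c i) _ (ip i)).
  rewrite (eq_bigr (fun i : 'I_n =>
      (c i * \int[mu]_(r in `[0, 1]) ((p i)^`()%classic r * g r))%:E)).
    by rewrite sumEFin.
  move=> i _; rewrite integralZl//; last exact: ip.
  by rewrite -[X in (_ * X)%E]fineK//; apply: integrable_fin_num => //; exact: ip.
rewrite -sumrB; apply: le_trans (ler_norm_sum _ _ _) _.
apply: (@le_trans _ _ (\sum_(i < n) c i * (e / C))).
  apply: ler_sum => i _; rewrite -mulrBr normrM ger0_norm// ler_wpM2l//.
  by have [_] := tauP i (ltn_ord i).
rewrite -mulr_suml mulrCA; apply: ler_piMr; first exact: ltW.
by rewrite ler_pdivrMr// mul1r /C lerDr ler01.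
Qed.

End step_test.


(** * Cutoffs in space and product test functions *)

Section cutoff.
Context {R : realType}.

Let e : R -> R := exp_poly 1.

Let eE x : 0 < x -> e x = expR (- x^-1).
Proof. by move=> x0; rewrite /e /exp_poly x0 hornerC mul1r. Qed.

Definition bump (u : R) : R := (expR (- 1))^-2 * (e (1 + u) * e (1 - u)).

Lemma smooth1_bump : smooth1 bump.
Proof.
apply: (@smooth1M _ (cst ((expR (- 1))^-2)) (fun u => e (1 + u) * e (1 - u))).
  exact: smooth1_cst.
have se : smooth1 e by move=> V k g; exact: Ck_on_exp_poly.
apply: (@smooth1M _ (fun u => e (1 + u)) (fun u => e (1 - u))).
  rewrite (_ : (fun u => _) = e \o (fun u => 1 * u + 1)).
    by apply: smooth1_comp => //; exact: smooth1_affine.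
  by apply/funext => u /=; rewrite mul1r addrC.
rewrite (_ : (fun u => _) = e \o (fun u => -1 * u + 1)).
  by apply: smooth1_comp => //; exact: smooth1_affine.
by apply/funext => u /=; rewrite mulN1r addrC.
Qed.

Lemma bump_neq0 u : bump u != 0 -> `|u| < 1.
Proof.
rewrite /bump !mulf_eq0 !negb_or => /andP[_ /andP[h1 h2]].
rewrite ltr_norml; apply/andP; split.
  by rewrite ltNge; apply: contra h1 => u1; rewrite /e exp_poly0//; lra.
by rewrite ltNge; apply: contra h2 => u1; rewrite /e exp_poly0//; lra.
Qed.

Lemma bump0 : bump 0 = 1.
Proof.
by rewrite /bump addr0 subr0 eE// invr1 -expr2 mulVf// expf_neq0// gt_eqF ?expR_gt0.
Qed.

Lemma bump_ge0 u : 0 <= bump u.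
Proof.
have e_ge0 x : 0 <= e x.
  by rewrite /e /exp_poly; case: ifPn => // _; rewrite hornerC mul1r expR_ge0.
by apply: mulr_ge0; [rewrite invr_ge0 exprn_ge0// expR_ge0|exact: mulr_ge0].
Qed.

Lemma bump_le1 u : bump u <= 1.
Proof.
have [->//|] := eqVneq (bump u) 0; move=> /bump_neq0; rewrite ltr_norml => /andP[u1 u2].
have p1 : 0 < 1 + u by lra.
have p2 : 0 < 1 - u by lra.
rewrite /bump !eE// -expRD -expRM_natr -expRN -expRD -[leRHS]expR0 ler_expR.
rewrite mulrC mulrN1 opprK.
have -> : 2 + (- (1 + u)^-1 - (1 - u)^-1) = - (2 * u ^+ 2 / ((1 + u) * (1 - u))).
  by field; rewrite !gt_eqF.
by rewrite oppr_le0; apply: divr_ge0; apply: mulr_ge0; rewrite ?sqr_ge0 ?ltW.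
Qed.

(** A product over the coordinates inherits smoothness from one variable and vanishes off a cube. *)
Definition cutoff d (r : R) (x : Rd R d) : R := \prod_i bump (x ord0 i / r).

Lemma cutoff_ge0 d r (x : Rd R d) : 0 <= cutoff r x.
Proof. by apply: prodr_ge0 => i _; exact: bump_ge0. Qed.

Lemma cutoff_le1 d r (x : Rd R d) : cutoff r x <= 1.
Proof. by apply: prodr_ile1 => i _; rewrite bump_ge0 bump_le1. Qed.

Lemma cutoff0 d r : cutoff r (0 : Rd R d) = 1.
Proof. by rewrite /cutoff big1// => i _; rewrite mxE mul0r bump0. Qed.

Lemma cutoff_neq0 d r (x : Rd R d) : 0 < r -> cutoff r x != 0 -> cube 0 r x.
Proof.
move=> r0 /prodf_neq0 h i; have := bump_neq0 (h i isT).
by rewrite mxE subr0 normrM normfV (gtr0_norm r0) ltr_pdivrMr// mul1r => /ltW.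
Qed.

Lemma Ck_on_cutoff d r (V : normedModType R) (L : V -> Rd R d) k :
  (forall i, continuous (fun v => L v ord0 i)) ->
  (forall i, linear (fun v => L v ord0 i)) ->
  Ck_on setT k (fun v => cutoff r (L v)).
Proof.
move=> cL lL; rewrite (_ : (fun v => _) =
    \prod_(i < d) ((bump \o (fun u => r^-1 * u + 0)) \o (fun v => L v ord0 i))).
  apply: (@big_ind _ (fun f : V -> R => Ck_on setT k f)).
  - exact: (@Ck_on_cst R V k 1).
  - by move=> f g; exact: Ck_onM.
  - move=> i _; apply: smooth1_comp; [exact: smooth1_bump|exact: smooth1_affine|].
    by apply: Ck_on_linear; [exact: cL|exact: lL].
apply/funext => v; rewrite fct_prodE; apply: eq_bigr => i _ /=.
by rewrite addr0 mulrC.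
Qed.

Lemma cutoff_continuous d r : continuous (@cutoff d r).
Proof.
apply: (@Ck_on_continuous _ _ 0); apply: (@Ck_on_cutoff d r (Rd R d) id 0).
  by move=> i; exact: coord_continuous.
by move=> i c u v /=; rewrite !mxE.
Qed.

Lemma test_function_tensor d (a : R -> R) tau r : smooth1 a -> 0 < tau -> 0 < r ->
  (forall t, a t != 0 -> tau <= t <= 1 - tau) ->
  test_function (fun p : R * Rd R d => a p.1 * cutoff r p.2).
Proof.
move=> sa tau0 r0 asupp.
pose K : set (R * Rd R d) := `[tau, 1 - tau] `*` cube 0 r.
have cK : compact K.
  apply: compact_setX; first exact: segment_compact.
  apply: bounded_closed_compact.
    exists r; split; first exact: num_real.
    move=> M rM x /= xr; rewrite /Num.Def.normr/= mx_normrE.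
    apply: (le_trans _ (ltW rM)); apply: bigmax_le; first exact: ltW.
    by move=> [i j] _ /=; rewrite ord1; have := xr j; rewrite mxE subr0.
  have -> : cube (0 : Rd R d) r = \bigcap_(i in [set: 'I_d])
      ((fun x : Rd R d => x ord0 i) @^-1` `[- r, r]).
    apply/seteqP; split => x h i; have := h i; rewrite /= mxE subr0 in_itv/= ler_norml//.
    exact.
  apply: closed_bigI => i _; apply: closed_comp => [x _|]; first exact: coord_continuous.
  exact: interval_closed.
have clK : closed K by apply: compact_closed cK; exact: norm_hausdorff.
have subK : closure [set p | a p.1 * cutoff r p.2 != 0] `<=` K.
  rewrite closureE; apply: smallest_sub => // -[t x] /=.
  rewrite mulf_eq0 negb_or => /andP[at0 cx]; split => /=.
    by rewrite in_itv/= asupp.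
  exact: cutoff_neq0.
split.
- move=> k; apply: (@Ck_onM _ _ k (fun p : R * Rd R d => a p.1)).
    apply: sa; apply: Ck_on_linear => //.
    by move=> x; exact: cvg_fst.
  apply: Ck_on_cutoff => i; last by move=> c u v; rewrite /= !mxE.
  move=> p; apply: (@continuous_comp _ _ _ snd (fun x : Rd R d => x ord0 i)).
    exact: cvg_snd.
  exact: coord_continuous.
- apply: (subclosed_compact _ cK) => //; exact: closed_closure.
- move=> p /subK[/=]; rewrite in_itv/= => + _; lra.
Qed.

End cutoff.


(** * Bounds on the interpolation function *)

Section interpolation_theory.
Context {R : realType} (theta : R -> R -> R).
Hypothesis itheta : interpolation theta.
Implicit Types r s t : R.

Lemma itp_mono2 r s r' s' : 0 <= r -> r <= r' -> 0 <= s -> s <= s' ->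
  theta r s <= theta r' s'.
Proof.
move=> r0 rr' s0 ss'; have r'0 := le_trans r0 rr'; have s'0 := le_trans s0 ss'.
apply: (le_trans (itp_mono itheta r0 rr' s0)).
by rewrite (itp_sym itheta)// [leRHS](itp_sym itheta)//; exact: (itp_mono itheta).
Qed.

Lemma itp_diag t : 0 <= t -> theta t t = t.
Proof.
rewrite le_eqVlt => /predU1P[<-|t0].
  (* Homogeneity with factor 2 at the origin gives theta(0, 0) = 2 theta(0, 0). *)
  have := itp_homogeneous itheta (ltr0Sn R 1) (lexx 0) (lexx 0).
  by rewrite mulr0; lra.
have := itp_homogeneous itheta t0 ler01 ler01.
by rewrite !mulr1 (itp_11 itheta) mulr1.
Qed.

(** Monotonicity compares with the point (m, m) of the diagonal, where homogeneity gives the value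
    m. *)
Lemma itp_ge_min r s : 0 <= r -> 0 <= s -> Num.min r s <= theta r s.
Proof.
move=> r0 s0; have m0 : 0 <= Num.min r s by rewrite le_min r0.
by rewrite -{1}(itp_diag m0); apply: itp_mono2; rewrite ?ge_min ?lexx ?orbT.
Qed.

Lemma itp_le_max r s : 0 <= r -> 0 <= s -> theta r s <= Num.max r s.
Proof.
move=> r0 s0; have m0 : 0 <= Num.max r s by rewrite le_max r0.
by rewrite -{1}(itp_diag m0); apply: itp_mono2; rewrite ?le_max ?lexx ?orbT.
Qed.

Lemma itp_r0 r : 0 <= r -> theta r 0 = r * theta 1 0.
Proof.
rewrite le_eqVlt => /predU1P[<-|r0]; first by rewrite itp_diag// mul0r.
by rewrite -(itp_homogeneous itheta)// mulr1 mulr0.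
Qed.

Lemma itp_0s s : 0 <= s -> theta 0 s = s * theta 1 0.
Proof. by move=> s0; rewrite (itp_sym itheta)// itp_r0. Qed.

Lemma itp10_ge0 : 0 <= theta 1 0. Proof. exact: (itp_ge0 itheta). Qed.

(** Concavity at the midpoint of (1, 0) and (0, 1), where [theta] equals 1/2. *)
Lemma itp10_le_half : theta 1 0 <= 2^-1.
Proof.
have := itp_concave itheta (_ : 0 <= 2^-1 <= 1) ler01 (lexx 0) (lexx 0) ler01.
rewrite (itp_sym itheta (lexx 0) ler01) !mulr0 !mulr1 addr0 add0r.
rewrite (_ : 1 - 2^-1 = 2^-1 :> R); last by field.
rewrite itp_diag// -mulrDl (_ : 2^-1 + 2^-1 = 1 :> R); last by field.
rewrite mul1r; apply; first by rewrite invr_ge0 ler0n invf_le1// ler1n.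
Qed.

(* By homogeneity the bound reduces to theta 1 z <= theta 1 0 + kappa + C z,
   which holds near z = 0 by continuity. *)
Lemma itp_le_linear kappa : 0 < kappa -> exists2 C, 0 < C &
  forall r s, 0 <= r -> 0 <= s -> theta r s <= (theta 1 0 + kappa) * r + C * s.
Proof.
move=> k0; have [z0 z00 Hz] : exists2 z0, 0 < z0 & forall z, 0 <= z -> z <= z0 ->
    theta 1 z <= theta 1 0 + kappa.
  have /subspace_continuousP/(_ (1, 0)) := itp_continuous itheta.
  rewrite /= => /(_ (conj ler01 (lexx 0))) /cvgrPdist_le/(_ _ k0).
  rewrite near_withinE => /nbhs_ballP[del /= del0 H].
  exists (del / 2) => [|z z0 zd]; first by rewrite divr_gt0.
  have /= := H (1, z); rewrite ler_distl => h.
  have /h : ball ((1 : R), (0 : R)) del (1, z).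
    split => /=; first exact: ballxx.
    rewrite /ball/= sub0r normrN ger0_norm// (le_lt_trans zd)//.
    by rewrite ltr_pdivrMr// ltr_pMr// ltr1n.
  by move=> /(_ (conj ler01 z0)) /= /andP[+ _]; rewrite lerBlDr.
(* The constant serves z > z0, where max(1, z) <= (1 + 1/z0) z bounds theta(1, z). *)
exists (1 + z0^-1) => [|r s r0 s0]; first by rewrite addr_gt0// invr_gt0.
have C0 : 0 < 1 + z0^-1 by rewrite addr_gt0// invr_gt0.
have t0 := itp10_ge0; have th := itp10_le_half.
move: r0; rewrite le_eqVlt => /predU1P[<-|r0].
  rewrite itp_0s// mulr0 add0r mulrC ler_wpM2r//.
  have zV : 0 <= z0^-1 by rewrite invr_ge0 ltW.
  by move: zV th; clear; lra.
pose z := s / r; have z0' : 0 <= z by rewrite divr_ge0// ltW.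
have -> : s = r * z by rewrite /z mulrCA divff ?gt_eqF// mulr1.
rewrite -{1}[r]mulr1 (itp_homogeneous itheta)//.
rewrite (_ : _ + _ = r * ((theta 1 0 + kappa) + (1 + z0^-1) * z)); last by ring.
rewrite ler_pM2l//; have [zz|zz] := leP z z0.
  by apply: (le_trans (Hz _ z0' zz)); rewrite lerDl mulr_ge0// ltW.
apply: (le_trans (itp_le_max ler01 z0')); rewrite ge_max; apply/andP; split.
  have : 1 <= z0^-1 * z by rewrite mulrC ler_pdivlMr// mul1r ltW.
  by rewrite mulrDl mul1r; lra.
have : 0 <= z0^-1 * z by rewrite mulr_ge0// invr_ge0 ltW.
by rewrite mulrDl mul1r; lra.
Qed.

End interpolation_theory.


(** * Affine bounds on lower integrals *)

Section lower_integral_affine.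
Local Open Scope ereal_scope.
Context d (T : measurableType d) (R : realType).
Import HBNNSimple.

Lemma ge0_integral_le_nnsfun (mu : {measure set T -> \bar R}) (D : set T)
    (f : T -> \bar R) (B : \bar R) : measurable D ->
  (forall x, D x -> 0 <= f x) ->
  (forall h : {nnsfun T >-> R}, (forall x, D x -> (h x)%:E <= f x) ->
    \int[mu]_(x in D) (h x)%:E <= B) ->
  \int[mu]_(x in D) f x <= B.
Proof.
move=> mD f0 H; rewrite ge0_integralE//; apply: ge_ereal_sup => _ [h hf <-].
rewrite -integralT_nnsfun.
have hE x : ~ D x -> h x = 0%R.
  move=> Dx; have := hf x; rewrite /patch memNset// lee_fin => h0.
  by apply/le_anti; rewrite h0/=.
have <- : \int[mu]_(x in D) (h x)%:E = \int[mu]_x (h x)%:E.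
  rewrite integral_mkcond; apply: eq_integral => x _; rewrite /patch.
  by case: ifPn => //; rewrite notin_setE => /hE ->.
by apply: H => x Dx; have := hf x; rewrite /patch mem_set.
Qed.

(** Lower integrals are only superadditive in general, but a measurable summand [c] is harmless: for
    a simple h below [f], the positive part of h - c is measurable and lies below alpha g. *)
Lemma le_integral_affine_nonmeas (mu : {measure set T -> \bar R}) (D : set T)
    (f g : T -> \bar R) (alpha : R) (c : T -> R) : measurable D ->
  (0 < alpha)%R -> measurable_fun D c -> (forall x, D x -> (0 <= c x)%R) ->
  (forall x, D x -> 0 <= f x) -> (forall x, D x -> 0 <= g x) ->
  (forall x, D x -> f x <= alpha%:E * g x + (c x)%:E) ->
  \int[mu]_(x in D) f x <=
  alpha%:E * \int[mu]_(x in D) g x + \int[mu]_(x in D) (c x)%:E.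
Proof.
move=> mD a0 mc c0 f0 g0 fg; apply: ge0_integral_le_nnsfun => // h hf.
pose k x : R := (Num.max 0 (h x - c x))%R.
have mk : measurable_fun D k.
  by apply: measurable_maxr => //; apply: measurable_funB => //; apply: measurable_funTS.
have k0 x : (0 <= k x)%R by rewrite /k le_max lexx.
apply: (@le_trans _ _ (\int[mu]_(x in D) ((k x)%:E + (c x)%:E))).
  apply: ge0_le_integral_nonmeas => x _; first by rewrite lee_fin.
  by rewrite -EFinD lee_fin /k -lerBlDr le_max lexx orbT.
rewrite ge0_integralD//; last 3 first.
- by move=> x _; rewrite lee_fin.
- exact/measurable_EFinP.
- exact/measurable_EFinP.
rewrite leeD2r//.
have -> : \int[mu]_(x in D) (k x)%:E =
    alpha%:E * \int[mu]_(x in D) (alpha^-1 * k x)%:E.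
  rewrite -ge0_integralZl_EFin//; last 3 first.
  - by move=> x _; rewrite lee_fin mulr_ge0// invr_ge0 ltW.
  - by apply/measurable_EFinP; exact: measurable_funM.
  - exact: ltW.
  by apply: eq_integral => x _; rewrite -EFinM mulrA divff ?gt_eqF// mul1r.
apply: lee_wpmul2l; first by rewrite lee_fin ltW.
apply: ge0_le_integral_nonmeas => x Dx.
  by rewrite lee_fin mulr_ge0// invr_ge0 ltW.
rewrite EFinM lee_pdivrMl// /k EFin_max ge_max; apply/andP; split.
  by apply: mule_ge0; [rewrite lee_fin ltW|exact: g0].
by rewrite EFinB leeBlDr// (le_trans (hf x Dx))// fg.
Qed.

End lower_integral_affine.

(** * The flux through a cutoff at a fixed time *)

Section action_bound.
Context {R : realType} {d : nat} (eta : R -> R) (theta : R -> R -> R).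
Local Notation RR := (Rd R d * Rd R d)%type.
Local Notation P := (probability (Rd R d) R).
Local Notation G := (@Gset R d eta).
Hypotheses (keta : weight_kernel d eta) (itheta : interpolation theta).
Variables (mu : P) (j : Mloc G) (chi : Rd R d -> R) (q C o H : R).
Hypotheses (mchi : measurable_fun setT chi) (chi01 : forall x, 0 <= chi x <= 1).
Hypotheses (q0 : 0 <= q) (C0 : 0 <= C).
Hypothesis theta_le : forall r s, 0 <= r -> 0 <= s -> theta r s <= q * r + C * s.
Hypothesis HE : (\int[leb d]_y (profile eta (enorm y))%:E)%E = H%:E.
Hypothesis chio : forall y,
  (\int[leb d]_x (chi x * profile eta (enorm (x - y)))%:E <= o%:E)%E.

(** Bounds the integral of (chi(y) - chi(x))^2 theta eta. As (chi(y) - chi(x))^2 <= chi(x) + chi(y),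
    four terms arise: the two with the cutoff in the variable carrying [mu] give [H] times the mass
    near 0, the two with the cutoff in the Lebesgue variable are at most [o]. *)
Let M := 2 * (q * H * (\int[mu]_x chi x) + C * o).

Let keval (z : RR) := profile eta (enorm (z.1 - z.2)).
Let mker : measurable_fun setT keval := measurable_profile_sub keta.
Let ker0 z : 0 <= keval z. Proof. exact: profile_ge0 keta _. Qed.
Let mchi1 : measurable_fun setT (fun z : RR => chi z.1).
Proof. exact: measurableT_comp mchi measurable_fst. Qed.
Let mchi2 : measurable_fun setT (fun z : RR => chi z.2).
Proof. exact: measurableT_comp mchi measurable_snd. Qed.
Let chi_ge0 x : 0 <= chi x. Proof. by case/andP : (chi01 x). Qed.

Local Open Scope ereal_scope.

Let int_chi_fin : \int[mu]_x (chi x)%:E \is a fin_num.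
Proof.
apply: integrable_fin_num => //; apply: measurable_bounded_integrable => //.
  by apply: (le_lt_trans _ (ltry 1%R)); exact: probability_le1.
exists 1%R; split; first exact: num_real.
by move=> r r1 x _ /=; rewrite ger0_norm// (le_trans _ (ltW r1))//; case/andP : (chi01 x).
Qed.

Let weight_mass1 : \int[mu \x leb d]_z (chi z.1 * keval z)%:E =
  (H * (\int[mu]_x chi x)%R)%:E.
Proof.
rewrite fubini_tonelli1//; last 2 first.
- by apply/measurable_EFinP; exact: measurable_funM.
- by move=> z; rewrite lee_fin mulr_ge0.
rewrite /fubini_F /= (eq_integral (fun x => H%:E * (chi x)%:E)) => [|x _].
  rewrite ge0_integralZl_EFin//; last 3 first.
  - by move=> x _; rewrite lee_fin.
  - exact/measurable_EFinP.
  - by rewrite -lee_fin -HE integral_ge0// => y _; rewrite lee_fin (profile_ge0 keta).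
  by rewrite EFinM /Rintegral fineK.
under eq_integral do rewrite EFinM.
rewrite ge0_integralZl_EFin//; last 2 first.
- by move=> y _; rewrite lee_fin (profile_ge0 keta).
- by apply/measurable_EFinP; exact: measurable_profile_subl.
by rewrite integral_profile_subl// HE muleC.
Qed.

Let weight_mass2 : \int[leb d \x mu]_z (chi z.1 * keval z)%:E <= o%:E.
Proof.
rewrite fubini_tonelli2//; last 2 first.
- by apply/measurable_EFinP; exact: measurable_funM.
- by move=> z; rewrite lee_fin mulr_ge0.
apply: (@le_trans _ _ (\int[mu]_y o%:E)).
  apply: ge0_le_integral_nonmeas => y _; last exact: chio.
  by apply: integral_ge0 => x _; rewrite lee_fin mulr_ge0.
rewrite integral_cst// [X in _ * X](_ : _ = 1) ?mule1//.
exact: probability_setT.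
Qed.

Let weight_mass3 : \int[leb d \x mu]_z (chi z.2 * keval z)%:E =
  (H * (\int[mu]_x chi x)%R)%:E.
Proof.
rewrite fubini_tonelli2//; last 2 first.
- by apply/measurable_EFinP; exact: measurable_funM.
- by move=> z; rewrite lee_fin mulr_ge0.
rewrite /fubini_G /= (eq_integral (fun x => H%:E * (chi x)%:E)) => [|x _].
  rewrite ge0_integralZl_EFin//; last 3 first.
  - by move=> x _; rewrite lee_fin.
  - exact/measurable_EFinP.
  - by rewrite -lee_fin -HE integral_ge0// => y _; rewrite lee_fin (profile_ge0 keta).
  by rewrite EFinM /Rintegral fineK.
under eq_integral do rewrite EFinM.
rewrite ge0_integralZl_EFin//; last 2 first.
- by move=> y _; rewrite lee_fin (profile_ge0 keta).
- by apply/measurable_EFinP; exact: measurable_profile_subr.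
by rewrite integral_profile_subr// HE muleC.
Qed.

Let weight_mass4 : \int[mu \x leb d]_z (chi z.2 * keval z)%:E <= o%:E.
Proof.
rewrite fubini_tonelli1//; last 2 first.
- by apply/measurable_EFinP; exact: measurable_funM.
- by move=> z; rewrite lee_fin mulr_ge0.
apply: (@le_trans _ _ (\int[mu]_y o%:E)).
  apply: ge0_le_integral_nonmeas => y _.
    by apply: integral_ge0 => x _; rewrite lee_fin mulr_ge0.
  apply: le_trans (chio y); rewrite le_eqVlt; apply/orP; left; apply/eqP.
  by apply: eq_integral => x _; rewrite /keval/= -enormN opprB.
rewrite integral_cst// [X in _ * X](_ : _ = 1) ?mule1//.
exact: probability_setT.
Qed.

Let mG : measurable G := measurable_Gset keta.

Let density_mass (m l : {measure set RR -> \bar R}) (u : RR -> R) (g : RR -> R) :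
  is_density G l m u -> measurable_fun setT g -> (forall z, 0 <= g z)%R ->
  \int[l]_(z in G) (g z * keval z * u z)%:E <= \int[m]_z (g z * keval z)%:E.
Proof.
move=> [mu' u0 uE] mg g0.
have := @ge0_integral_density _ _ R m l G mG u (fun z => (g z * keval z)%:E).
under eq_integral do rewrite EFinM.
move=> <- //; last 3 first.
- exact: measurable_funTS.
- by apply/measurable_EFinP/measurable_funTS; exact: measurable_funM.
- by move=> z _; rewrite lee_fin mulr_ge0.
by rewrite integral_mkcond; apply: ge0_le_integral_nonmeas => z _;
  [apply: erestrict_ge0 => w _|rewrite /patch; case: ifPn => // _];
  rewrite lee_fin mulr_ge0.
Qed.

(* AM-GM splits |N| |f| <= (alpha f^2/theta + A^2 (chi(y)-chi(x))^2 theta/alpha) eta / 2;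
   the second part is linearised by theta <= q u + C v. *)
Lemma action_flux_bound (A alpha : R) : (0 <= A)%R -> (0 < alpha)%R ->
  `|\int[mpos j]_(z in G) (A * (chi z.2 - chi z.1) * kernel eta z)%:E -
    \int[mneg j]_(z in G) (A * (chi z.2 - chi z.1) * kernel eta z)%:E| <=
  alpha%:E * action theta mu j + (A ^+ 2 * M / (2 * alpha))%:E.
Proof.
move=> A0 a0; pose N z := (A * (chi z.2 - chi z.1) * kernel eta z)%R.
(* The claim becomes a lower bound for the infimum defining [action], so that one admissible choice
   of densities can be fixed; the rearrangement is then undone. *)
rewrite -leeBlDr// -lee_pdivrMl//.
apply: le_ereal_inf_tmp => a [l [f [u [v [lG [fp fm] uE vE ->]]]]].
rewrite lee_pdivrMl// leeBlDr//.
have [mu' u0 _] := uE; have [mv v0 _] := vE.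
have mf : measurable_fun setT f.
  have [mp _ _] := fp; have [mn _ _] := fm.
  rewrite (_ : f = f^\+ \- f^\-)%R; first exact: measurable_funB.
  by apply/funext => z; rewrite -[in LHS](funrposBneg f).
have mN : measurable_fun G N.
  apply: measurable_funM; last exact: (measurable_weight keta).
  by apply/measurable_funTS/measurable_funM => //; exact: measurable_funB.
pose X z := (`|N z| * `|f z|)%R.
pose L z : R := ((chi z.1 * keval z * (q * u z + C * v z) +
                chi z.2 * keval z * (C * u z + q * v z)))%R.
have L0 z : (0 <= L z)%R.
  by rewrite /L addr_ge0// mulr_ge0// ?mulr_ge0// addr_ge0// mulr_ge0.
have mL : measurable_fun setT L.
  apply: measurable_funD; apply: measurable_funM; try exact: measurable_funM;
  by apply: measurable_funD; apply: measurable_funM.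
pose S z := div0 (f z ^+ 2) (theta (u z) (v z)) * (kernel eta z)%:E.
have chi1 x : (chi x <= 1)%R by case/andP : (chi01 x).
have LE z : ((chi z.2 - chi z.1) ^+ 2 * theta (u z) (v z) * keval z <= L z)%R.
  have t1 := theta_le (u0 z) (v0 z).
  have := theta_le (v0 z) (u0 z); rewrite -(itp_sym itheta)// => t2.
  have t0 := itp_ge0 itheta (u0 z) (v0 z).
  have e2 : ((chi z.2 - chi z.1) ^+ 2 <= chi z.1 + chi z.2)%R.
    have := chi_ge0 z.1; have := chi_ge0 z.2; have := chi1 z.1; have := chi1 z.2.
    by nra.
  rewrite (_ : L z = (chi z.1 * (q * u z + C * v z) + chi z.2 * (C * u z + q * v z)) * keval z)%R; last first.
    by rewrite /L; ring.
  rewrite ler_wpM2r//.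
  apply: (@le_trans _ _ ((chi z.1 + chi z.2) * theta (u z) (v z))%R).
    by rewrite ler_wpM2r.
  by rewrite mulrDl lerD// ler_wpM2l// addrC.
have XSL z : G z -> (X z)%:E <= (alpha / 2)%:E * S z + (A ^+ 2 / (2 * alpha) * L z)%:E.
  move=> Gz; have kE := Gset_kernelE Gz; have kz : (0 < keval z)%R.
    by move: Gz; rewrite GsetE.
  have c0 : (0 <= A ^+ 2 / (2 * alpha))%R by rewrite divr_ge0 ?sqr_ge0// mulr_ge0// ltW.
  have t0 := itp_ge0 itheta (u0 z) (v0 z).
  (* Where [theta] vanishes, either the flux density vanishes as well or the action density is
     infinite. *)
  rewrite /S /div0 /X /N kE; case: ifPn => [/eqP th0|th0].
    case: ifPn => [|f0].
      by rewrite sqrf_eq0 => /eqP ->; rewrite normr0 mulr0 mul0e mule0 add0e lee_fin mulr_ge0.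
    by rewrite gt0_mulye ?lte_fin// gt0_muley ?lte_fin ?divr_gt0// addye ?leey.
  rewrite -!EFinM -EFinD lee_fin.
  have th : (0 < theta (u z) (v z))%R by rewrite lt_neqAle eq_sym th0.
  have f2 : (f z ^+ 2 = `|f z| ^+ 2)%R by rewrite real_normK ?num_real.
  rewrite f2.
  set b := theta (u z) (v z) in th LE t0 *.
  rewrite !normrM (ger0_norm A0) (gtr0_norm kz).
  apply: (@le_trans _ _ (alpha / 2 * (`|f z| ^+ 2 / b * keval z) + A ^+ 2 / (2 * alpha) *
     ((chi z.2 - chi z.1) ^+ 2 * b * keval z))%R); last first.
    by rewrite lerD2l ler_wpM2l//; exact: LE.
  rewrite -[((chi z.2 - chi z.1) ^+ 2)%R]real_normK ?num_real//.
  set D := `|chi z.2 - chi z.1|%R; set F := `|f z|%R; rewrite -subr_ge0.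
  rewrite (_ : _ - _ = (alpha * F - A * D * b) ^+ 2 / (2 * alpha * b) * keval z)%R.
    by rewrite mulr_ge0// divr_ge0 ?sqr_ge0// ?mulr_ge0// ltW.
  by field; rewrite !gt_eqF.
have intL : \int[l]_(z in G) (L z)%:E <= M%:E.
  have b1 := density_mass uE mchi1 (fun z => chi_ge0 z.1).
  have b2 := density_mass vE mchi1 (fun z => chi_ge0 z.1).
  have b3 := density_mass uE mchi2 (fun z => chi_ge0 z.2).
  have b4 := density_mass vE mchi2 (fun z => chi_ge0 z.2).
  rewrite (eq_integral (fun z => q%:E * (chi z.1 * keval z * u z)%:E +
     (C%:E * (chi z.1 * keval z * v z)%:E + (C%:E * (chi z.2 * keval z * u z)%:E +
      q%:E * (chi z.2 * keval z * v z)%:E)))); last first.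
    by move=> z _; rewrite -!EFinM -!EFinD /L; congr EFin; ring.
  have mm (g w : RR -> R) (c : R) : measurable_fun setT g -> measurable_fun setT w ->
      measurable_fun G (fun z => c%:E * (g z * keval z * w z)%:E).
    move=> mg mw; apply/measurable_funTS/measurable_funeM/measurable_EFinP.
    by apply: measurable_funM => //; exact: measurable_funM.
  have mm' (g w : RR -> R) : measurable_fun setT g -> measurable_fun setT w ->
      measurable_fun G (fun z => (g z * keval z * w z)%:E).
    move=> mg mw; apply/measurable_funTS/measurable_EFinP.
    by apply: measurable_funM => //; exact: measurable_funM.
  have g0 (g w : RR -> R) (c : R) : (forall z, 0 <= g z)%R -> (forall z, 0 <= w z)%R ->
      (0 <= c)%R -> forall z, G z -> 0 <= c%:E * (g z * keval z * w z)%:E.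
    by move=> g0 w0 c0 z _; rewrite mule_ge0 ?lee_fin// !mulr_ge0.
  have g0' (g w : RR -> R) : (forall z, 0 <= g z)%R -> (forall z, 0 <= w z)%R ->
      forall z, G z -> 0 <= (g z * keval z * w z)%:E.
    by move=> g0'' w0 z _; rewrite lee_fin !mulr_ge0.
  have c1 (z : RR) : (0 <= chi z.1)%R by []. have c2 (z : RR) : (0 <= chi z.2)%R by [].
  have n1 := g0 (fun z => chi z.1) u q c1 u0 q0.
  have n2 := g0 (fun z => chi z.1) v C c1 v0 C0.
  have n3 := g0 (fun z => chi z.2) u C c2 u0 C0.
  have n4 := g0 (fun z => chi z.2) v q c2 v0 q0.
  have m1 := mm (fun z => chi z.1) u q mchi1 mu'.
  have m2 := mm (fun z => chi z.1) v C mchi1 mv.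
  have m3 := mm (fun z => chi z.2) u C mchi2 mu'.
  have m4 := mm (fun z => chi z.2) v q mchi2 mv.
  have n34 z (Gz : G z) := adde_ge0 (n3 z Gz) (n4 z Gz).
  have n234 z (Gz : G z) := adde_ge0 (n2 z Gz) (n34 z Gz).
  have m34 := emeasurable_funD m3 m4.
  have m234 := emeasurable_funD m2 m34.
  rewrite ge0_integralD// ge0_integralD// ge0_integralD//.
  have k1 := g0' (fun z => chi z.1) u c1 u0.
  have k2 := g0' (fun z => chi z.1) v c1 v0.
  have k3 := g0' (fun z => chi z.2) u c2 u0.
  have k4 := g0' (fun z => chi z.2) v c2 v0.
  have l1 := mm' (fun z => chi z.1) u mchi1 mu'.
  have l2 := mm' (fun z => chi z.1) v mchi1 mv.
  have l3 := mm' (fun z => chi z.2) u mchi2 mu'.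
  have l4 := mm' (fun z => chi z.2) v mchi2 mv.
  rewrite !ge0_integralZl_EFin//.
  rewrite /M (_ : (2 * _)%R = (q * (H * \int[mu]_x chi x) + (C * o + (C * o +
      q * (H * \int[mu]_x chi x))))%R); last by ring.
  rewrite !EFinD !EFinM; apply: leeD.
    by apply: lee_wpmul2l; rewrite ?lee_fin// -EFinM -weight_mass1.
  apply: leeD; first by apply: lee_wpmul2l; rewrite ?lee_fin//; exact: le_trans b2 weight_mass2.
  apply: leeD; first by apply: lee_wpmul2l; rewrite ?lee_fin//; exact: le_trans b3 weight_mass4.
  by apply: lee_wpmul2l; rewrite ?lee_fin// -EFinM -weight_mass3.
have S0 z : G z -> 0 <= S z.
  move=> Gz; apply: mule_ge0; last by rewrite lee_fin (Gset_kernelE Gz) ker0.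
  rewrite /div0; case: ifPn => _; first by case: ifPn.
  by rewrite lee_fin; apply: divr_ge0; [exact: sqr_ge0|exact: (itp_ge0 itheta)].
have mLc : measurable_fun G (fun z => (A ^+ 2 / (2 * alpha) * L z)%R).
  by apply/measurable_funTS; exact: measurable_funM.
have c0 : (0 <= A ^+ 2 / (2 * alpha))%R by rewrite divr_ge0 ?sqr_ge0// mulr_ge0// ltW.
have intX : \int[l]_(z in G) (X z)%:E <=
    alpha%:E * (2^-1%:E * \int[l]_(z in G) S z) + (A ^+ 2 * M / (2 * alpha))%:E.
  apply: (@le_trans _ _ ((alpha / 2)%:E * \int[l]_(z in G) S z +
     \int[l]_(z in G) (A ^+ 2 / (2 * alpha) * L z)%:E)).
    apply: le_integral_affine_nonmeas => //.
    - by rewrite divr_gt0.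
    - by move=> z _; rewrite mulr_ge0.
    - by move=> z _; rewrite lee_fin mulr_ge0.
  rewrite EFinM -muleA leeD2l//.
  under eq_integral do rewrite EFinM.
  rewrite ge0_integralZl_EFin//; last 2 first.
  - by move=> z _; rewrite lee_fin.
  - exact/measurable_EFinP/measurable_funTS.
  rewrite (_ : (A ^+ 2 * M / (2 * alpha))%:E = (A ^+ 2 / (2 * alpha))%:E * M%:E).
    by apply: lee_wpmul2l => //; rewrite lee_fin.
  by rewrite -EFinM mulrAC.
apply: le_trans intX.
apply: le_trans (lee_abs_sub _ _) _.
have mNE : measurable_fun G (EFin \o N) by exact/measurable_EFinP.
apply: (@le_trans _ _ (\int[mpos j]_(z in G) `|(N z)%:E| +
                      \int[mneg j]_(z in G) `|(N z)%:E|)).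
  by apply: leeD; exact: le_abse_integral.
have [mfp fp0 fpE] := fp; have [mfn fn0 fnE] := fm.
have mNa : measurable_fun G (fun z => `|(N z)%:E|) by exact: measurableT_comp.
rewrite (ge0_integral_density mG _ fp0 fpE)//; last exact: measurable_funTS.
rewrite (ge0_integral_density mG _ fn0 fnE)//; last exact: measurable_funTS.
rewrite -ge0_integralD//.
- apply: ge0_le_integral_nonmeas => z Gz.
    by rewrite adde_ge0// mule_ge0// lee_fin.
  rewrite -!EFinM -EFinD lee_fin -mulrDr /X.
  by rewrite -[(f^\+ z + f^\- z)%R]/((f^\+ + f^\-)%R z) funrposDneg.
- by move=> z Gz; rewrite mule_ge0// lee_fin.
- by apply: emeasurable_funM => //; exact/measurable_EFinP/measurable_funTS.
- by move=> z Gz; rewrite mule_ge0// lee_fin.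
- by apply: emeasurable_funM => //; exact/measurable_EFinP/measurable_funTS.
Qed.

End action_bound.


(** * The flux bound integrated in time *)

Section flux_time.
Context {R : realType} {d : nat} (eta : R -> R) (theta : R -> R -> R).
Local Notation RR := (Rd R d * Rd R d)%type.
Local Notation P := (probability (Rd R d) R).
Local Notation G := (@Gset R d eta).
Local Notation leb1 := (@lebesgue_measure R).
Hypotheses (keta : weight_kernel d eta) (itheta : interpolation theta).
Local Open Scope ereal_scope.

Lemma action_ge0 (mu : P) (j : Mloc G) : 0 <= action theta mu j.
Proof.
apply: le_ereal_inf_tmp => a [l [f [u [v [_ _ [_ u0 _] [_ v0 _] ->]]]]].
apply: mule_ge0; first by rewrite lee_fin invr_ge0.
apply: integral_ge0 => z Gz; apply: mule_ge0; last first.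
  by rewrite lee_fin (Gset_kernelE Gz) (profile_ge0 keta).
rewrite /div0; case: ifPn => _; first by case: ifPn.
by rewrite lee_fin; apply: divr_ge0; [exact: sqr_ge0|exact: (itp_ge0 itheta)].
Qed.

(** The integrals of the positive and of the negative part both lie between 0 and the right-hand
    side, hence so does the absolute value of their difference. *)
Lemma le_abse_integral_nonmeas dT (T : measurableType dT)
    (m : {measure set T -> \bar R}) (D : set T) (f : T -> \bar R) :
  `|\int[m]_(x in D) f x| <= \int[m]_(x in D) `|f x|.
Proof.
have fp : \int[m]_(x in D) f^\+ x <= \int[m]_(x in D) `|f x|.
  apply: ge0_le_integral_nonmeas => x _; first exact: funepos_ge0.
  by rewrite funeposE ge_max lee_abs abse_ge0.
have fn : \int[m]_(x in D) f^\- x <= \int[m]_(x in D) `|f x|.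
  apply: ge0_le_integral_nonmeas => x _; first exact: funeneg_ge0.
  by rewrite funenegE ge_max -abseN lee_abs abse_ge0.
have p0 : 0 <= \int[m]_(x in D) f^\+ x by apply: integral_ge0 => x _; exact: funepos_ge0.
have n0 : 0 <= \int[m]_(x in D) f^\- x by apply: integral_ge0 => x _; exact: funeneg_ge0.
rewrite integralE; move: p0 n0 fp fn; set x := integral _ _ _; set y := integral _ _ _.
set z := integral _ _ _.
case: x => [x||]//; case: y => [y||]//; case: z => [z||]//=; rewrite ?leey ?lee_fin//.
by move=> x0 y0 xz yz; rewrite ler_norml; apply/andP; split; lra.
Qed.

Variables (nu0 nu1 : P) (mu : R -> P) (j : R -> Mloc G).
Hypothesis ce : CE nu0 nu1 mu j.
Variables (r q C o H : R).
Hypotheses (r0 : (0 < r)%R) (q0 : (0 <= q)%R) (C0 : (0 <= C)%R).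
Hypothesis theta_le : forall s t, (0 <= s)%R -> (0 <= t)%R ->
  (theta s t <= q * s + C * t)%R.
Hypothesis HE : \int[leb d]_y (profile eta (enorm y))%:E = H%:E.
Hypothesis chio : forall y, \int[leb d]_(x in cube 0%R r)
  (profile eta (enorm (x - y)%R))%:E <= o%:E.

Let chi : Rd R d -> R := @cutoff R d r.
Let chi01 x : (0 <= chi x <= 1)%R.
Proof. by rewrite cutoff_ge0 cutoff_le1. Qed.
Let mchi : measurable_fun setT chi.
Proof. by apply: continuous_measurable_Rd; exact: cutoff_continuous. Qed.

Definition near_mass (t : R) : R := (\int[mu t]_x chi x)%R.

Lemma near_mass_continuous : {within `[0%R, 1%R], continuous near_mass}.
Proof.
have [nc _ _ _ _] := ce; apply: nc; first exact: cutoff_continuous.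
by exists 1%R => x; rewrite ger0_norm ?cutoff_ge0 ?cutoff_le1.
Qed.

Let chi_int (m : P) : m.-integrable setT (EFin \o chi).
Proof.
apply: measurable_bounded_integrable => //.
  by apply: (le_lt_trans _ (ltry 1%R)); exact: probability_le1.
exists 1%R; split; first exact: num_real.
by move=> x x1 y _ /=; rewrite ger0_norm ?cutoff_ge0// (le_trans (cutoff_le1 _ _)) ?ltW.
Qed.

Let chio' y : \int[leb d]_x (chi x * profile eta (enorm (x - y)%R))%:E <= o%:E.
Proof.
apply: le_trans (chio y); rewrite [leRHS]integral_mkcond.
apply: ge0_le_integral_nonmeas => x _.
  by rewrite lee_fin mulr_ge0 ?cutoff_ge0 ?(profile_ge0 keta).
rewrite /patch; have [->|cx] := eqVneq (chi x) 0%R.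
  by rewrite mul0r; case: ifPn => // _; rewrite lee_fin (profile_ge0 keta).
rewrite mem_set; last exact: cutoff_neq0.
by rewrite lee_fin ler_piMl ?(profile_ge0 keta)// cutoff_le1.
Qed.

(** Cauchy-Schwarz in additive form: it passes through the lower integral of the action, and [alpha]
    stays free to be optimized. *)
Lemma flux_time_bound (a : R -> R) tau alpha Q : smooth1 a -> (0 < tau)%R ->
  (forall t, a t != 0 -> tau <= t <= 1 - tau)%R -> (forall t, 0 <= a t)%R ->
  (0 < alpha)%R -> (forall t, 0 <= t <= 1 ->
    a t ^+ 2 * (2 * (q * H * near_mass t + C * o)) <= Q)%R ->
  `|\int[leb1]_(t in `[0, 1]) (a^`()%classic t * near_mass t)|%R%:E <=
  2^-1%:E * (alpha%:E * \int[leb1]_(t in `[0%R, 1%R]) action theta (mu t) (j t)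
             + (Q / (2 * alpha))%:E).
Proof.
move=> sa tau0 asupp a0 al0 aQ; have [_ _ _ _ cont] := ce.
have tf := test_function_tensor d sa tau0 r0 asupp.
have [_ eqn] := cont _ tf.
pose phi (p : R * Rd R d) : R := (a p.1 * cutoff r p.2)%R.
pose D t := \int[mpos (j t)]_(z in G) (nlgrad eta phi t z)%:E -
            \int[mneg (j t)]_(z in G) (nlgrad eta phi t z)%:E.
pose I := (\int[leb1]_(t in `[0, 1]) (a^`()%classic t * near_mass t))%R.
have cag : {within `[0%R, 1%R], continuous (fun t => (a^`()%classic t * near_mass t)%R)}.
  move=> t; apply: cvgM; last exact: near_mass_continuous.
  by apply: continuous_subspaceT => s; exact: smooth1_derive_continuous sa s.
have iag := within_continuous_integrable cag.
have T1 : \int[leb1]_(t in `[0%R, 1%R])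
    \int[mu t]_x ((fun s => phi (s, x))^`()%classic t)%:E = I%:E.
  rewrite /I /Rintegral fineK; last exact: integrable_fin_num.
  apply: eq_integral => t _.
  under eq_integral => x _.
    rewrite (_ : _^`()%classic t = (a^`()%classic t * chi x)%R); last first.
      rewrite !derive1E (_ : (fun s => phi (s, x)) = a * cst (chi x))%R//.
      have da : derivable a t 1%R := smooth1_derivable sa.
      have dc : derivable (cst (chi x) : R -> R) t 1%R by exact: derivable_cst.
      by rewrite (deriveM da dc) derive_cst scaler0 add0r [_ *: _]mulrC.
    rewrite EFinM; over.
  rewrite integralZl//; last exact: chi_int.
  by rewrite -[X in _ * X]fineK//; apply: integrable_fin_num => //; exact: chi_int.
have T2 : `|\int[leb1]_(t in `[0%R, 1%R]) D t| <=
    alpha%:E * \int[leb1]_(t in `[0%R, 1%R]) action theta (mu t) (j t) +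
    (Q / (2 * alpha))%:E.
  apply: le_trans (le_abse_integral_nonmeas _ _ _) _.
  apply: (@le_trans _ _ (alpha%:E * \int[leb1]_(t in `[0%R, 1%R]) action theta (mu t) (j t) +
     \int[leb1]_(t in `[0%R, 1%R]) (Q / (2 * alpha))%:E)); last first.
    rewrite integral_cst// leeD2l//.
    by rewrite [X in _ * X](_ : _ = 1%E) ?mule1// [LHS]lebesgue_measure_itv/= lte01 sube0.
  (* [a] vanishes at 0, so the hypothesis on [Q] at time 0 reads 0 <= Q. *)
  have Q0 : (0 <= Q)%R.
    apply: le_trans (aQ 0%R _); last by rewrite lexx ler01.
    rewrite (_ : a 0%R = 0%R) ?expr0n/= ?mul0r//.
    by apply/eqP; apply/negP => /negP /asupp /andP[t0 _]; lra.
  have Q1 : (0 <= Q / (2 * alpha))%R by rewrite divr_ge0// mulr_ge0// ltW.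
  apply: le_integral_affine_nonmeas => //.
    by move=> t _; exact: action_ge0.
  move=> t; rewrite /= in_itv/= => t01.
  have := @action_flux_bound R d eta theta keta itheta (mu t) (j t) chi q C o H
    mchi chi01 q0 C0 theta_le HE chio' (a t) alpha (a0 t) al0.
  have nE : (fun z : RR => (nlgrad eta phi t z)%:E) =
    (fun z => (a t * (chi z.2 - chi z.1) * kernel eta z)%:E).
    by apply/funext => z; rewrite /nlgrad /phi/= -mulrBr.
  rewrite /D nE => /le_trans; apply; rewrite leeD2l// lee_fin ler_wpM2r//.
    by rewrite invr_ge0 mulr_ge0// ltW.
  exact: aQ.
have := eqn; rewrite -/phi T1 -/(D _) => eqn'.
(* The time integral of the flux cannot be infinite, its sum with the finite [I] being 0. *)
have -> : `|I|%:E = 2^-1%:E * `|\int[leb1]_(t in `[0%R, 1%R]) D t|.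
  move: eqn'; set X := integral _ _ _.
  case: X => [x||] /=.
  - rewrite -EFinM -EFinD => -[] /eqP; rewrite addr_eq0 => /eqP ->.
    by rewrite normrN normrM ger0_norm ?invr_ge0.
  - by rewrite gt0_muley ?lte_fin ?invr_gt0.
  - by rewrite gt0_muleNy ?lte_fin ?invr_gt0.
by rewrite lee_wpmul2l ?lee_fin ?invr_ge0.
Qed.

End flux_time.


(** Substitute for the inverse of [g], which need not be monotone: the last time at which [g] is at
    least [c]. *)
Lemma last_level (R : realType) (g : R -> R) c :
  {within `[0, 1], continuous g} -> c <= g 0 -> g 1 < c ->
  exists2 T, 0 <= T < 1 & g T = c /\ forall t, T < t <= 1 -> g t < c.
Proof.
move=> cg g0 g1; pose S := [set t | 0 <= t <= 1 /\ c <= g t].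
have S0 : S 0 by rewrite /S/= lexx ler01.
have hS : has_sup S by split; [exists 0|exists 1 => t [/andP[]]].
pose T := sup S.
have T0 : 0 <= T by apply: ub_le_sup => //; case: hS.
have T1 : T <= 1 by apply: ge_sup; [exists 0|move=> t [/andP[]]].
have gT t : T < t <= 1 -> g t < c.
  move=> /andP[Tt t1]; rewrite ltNge; apply/negP => ct.
  have : t <= T by apply: ub_le_sup; [case: hS|split => //; lra].
  by rewrite leNgt Tt.
have gTc : c <= g T.
  rewrite leNgt; apply/negP => gTc.
  have e0 : 0 < (c - g T) / 2 by rewrite divr_gt0// subr_gt0.
  have [] := @within_continuous_eps _ g T _ cg _ e0; first by rewrite T0.
  move=> del del0 H.
  have [t [t01 ct] tT] := sup_adherent del0 hS.
  have tT' : t <= T by apply: ub_le_sup; [case: hS|split].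
  have : `|g t - g T| <= (c - g T) / 2.
    by apply: H => //; rewrite ler0_norm ?subr_le0//; rewrite -/T in tT; lra.
  by rewrite ler_norml => /andP[_]; lra.
have T1' : T < 1.
  by rewrite lt_neqAle T1 andbT; apply: contraTneq gTc => ->; rewrite -ltNge.
exists T; first by rewrite T0.
split => //; apply/le_anti; rewrite gTc andbT leNgt; apply/negP => cgT.
have e0 : 0 < (g T - c) / 2 by rewrite divr_gt0// subr_gt0.
have [] := @within_continuous_eps _ g T _ cg _ e0; first by rewrite T0.
move=> del del0 H; pose t := Num.min 1 (T + del).
have Tt : T < t by rewrite lt_min T1' ltrDl.
have t1 : t <= 1 by rewrite ge_min lexx.
have tdel : t <= T + del by rewrite ge_min lexx orbT.
have := gT t; rewrite Tt t1 => /(_ isT) gtc.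
have : `|g t - g T| <= (g T - c) / 2.
  by apply: H; [lra|rewrite gtr0_norm ?subr_gt0//; lra].
by rewrite ler_norml => /andP[+ _]; lra.
Qed.

(** * Lower bounds for the action *)

Section lower_bound.
Context {R : realType} {d : nat} (eta : R -> R) (theta : R -> R -> R).
Local Notation P := (probability (Rd R d) R).
Local Notation G := (@Gset R d eta).
Local Notation leb1 := (@lebesgue_measure R).
Hypotheses (d_gt0 : (0 < d)%N).
Hypotheses (keta : weight_kernel d eta) (itheta : interpolation theta).
Variables (nu : P) (mu : R -> P) (j : R -> Mloc G) (H : R).
Hypothesis nu0 : nu [set 0] = 0%E.
Hypothesis ce : CE (\d_(0 : Rd R d)) nu mu j.
Hypothesis HE : (\int[leb d]_y (profile eta (enorm y))%:E)%E = H%:E.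
Local Open Scope ereal_scope.
Local Notation E := (\int[leb1]_(t in `[0%R, 1%R]) action theta (mu t) (j t)).

(** Continuity from above along the cubes shrinking to the origin, which [nu] does not charge. *)
Lemma cube_small (e : R) : (0 < e)%R -> exists2 r, (0 < r)%R & nu (cube 0%R r) <= e%:E.
Proof.
move=> e0; have mc n := @measurable_cube R d 0%R n.+1%:R^-1.
have capE : \bigcap_n (cube (0%R : Rd R d) n.+1%:R^-1) = [set 0%R].
  apply/seteqP; split => [x h|x -> n _ i]; last by rewrite mxE subrr normr0 invr_ge0.
  apply/rowP => i; apply/eqP; rewrite mxE -normr_le0 leNgt; apply/negP => xi.
  have [n _ nx] := near_infty_natSinv_lt (PosNum xi).
  by have := h n I i; rewrite mxE subr0 leNgt nx/=.
have lim : nu (cube (0%R : Rd R d) n.+1%:R^-1) @[n --> \oo] --> 0.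
  rewrite -nu0 -capE; apply: (@nonincreasing_cvg_mu _ _ _ nu) => //.
  - by apply: (le_lt_trans _ (ltry 1%R)); exact: probability_le1.
  - by rewrite capE; exact: measurable_point_Rd.
  - move=> m n mn; apply/subsetPset => x h i; apply: le_trans (h i) _.
    by rewrite lef_pV2 ?posrE// ler_nat.
move: lim => /fine_cvgP[finn /cvgrPdist_lt/(_ _ e0) ltn].
have [n [nfin nlt]] : exists n, nu (cube (0%R : Rd R d) n.+1%:R^-1) \is a fin_num /\
    (`|0 - fine (nu (cube (0%R : Rd R d) n.+1%:R^-1))| < e)%R.
  by near \oo => n; exists n; split; near: n.
exists (n.+1%:R^-1)%R; first by rewrite invr_gt0.
rewrite -(fineK nfin) lee_fin ltW//; apply: le_lt_trans nlt.
by rewrite sub0r normrN ler_norm.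
Unshelve. all: end_near. Qed.

(* A radius at which both the mass of nu and the interaction mass are small. *)
Lemma small_radius (e e' : R) : (0 < e)%R -> (0 < e')%R -> exists2 r, (0 < r)%R &
  (near_mass mu r 1 <= e)%R /\
  forall y, \int[leb d]_(x in cube 0%R r) (profile eta (enorm (x - y)%R))%:E <= e'%:E.
Proof.
move=> e0 e0'; have [r1 r10 h1] := cube_small e0.
have Hoo : \int[leb d]_y (profile eta (enorm y))%:E < +oo by rewrite HE ltry.
have [r2 r20 h2] := integral_profile_cube_small keta d_gt0 Hoo e0'.
pose r := (Num.min r1 r2)%R; have r0 : (0 < r)%R by rewrite lt_min r10.
have sub r' : (r <= r')%R -> cube (0%R : Rd R d) r `<=` cube 0%R r'.
  by move=> rr' x h i; exact: le_trans (h i) rr'.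
exists r => //; split.
  have [_ _ _ m1 _] := ce.
  rewrite -lee_fin /near_mass /Rintegral fineK; last first.
    apply: integrable_fin_num => //; apply: measurable_bounded_integrable => //.
    - by apply: (le_lt_trans _ (ltry 1%R)); exact: probability_le1.
    - by apply: continuous_measurable_Rd; exact: cutoff_continuous.
    - exists 1%R; split; first exact: num_real.
      move=> x x1 y _ /=.
      by rewrite ger0_norm ?cutoff_ge0// (le_trans (cutoff_le1 _ _)) ?ltW.
  apply: le_trans h1; rewrite (@eq_measure_integral _ _ _ _ nu); last first.
    by move=> A mA _; exact: m1.
  rewrite -[leRHS]mul1e -integral_cst; last exact: measurable_cube.
  rewrite [leRHS]integral_mkcond; apply: ge0_le_integral_nonmeas => x _.
    by rewrite lee_fin cutoff_ge0.
  rewrite /patch; have [->|cx] := eqVneq (cutoff r x) 0%R.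
    by case: ifPn => // _; rewrite lee_fin ler01.
  rewrite mem_set ?lee_fin ?cutoff_le1//.
  by apply: (sub r1); [rewrite ge_min lexx|exact: cutoff_neq0].
move=> y; apply: le_trans (h2 y).
rewrite integral_mkcond [leRHS]integral_mkcond.
apply: ge0_le_integral_nonmeas => x _.
  by apply: erestrict_ge0 => z _; rewrite lee_fin (profile_ge0 keta).
rewrite /patch; case: ifPn => [|_].
  rewrite inE => xr; rewrite mem_set//.
  by apply: (sub r2) xr; rewrite ge_min lexx orbT.
by case: ifPn => // _; rewrite lee_fin (profile_ge0 keta).
Qed.

Lemma near_mass0 r : near_mass mu r 0 = 1%R.
Proof.
have [_ _ m0 _ _] := ce; rewrite /near_mass /Rintegral.
rewrite (@eq_measure_integral _ _ _ _ (\d_(0%R : Rd R d))); last first.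
  by move=> A mA _; exact: m0.
rewrite integral_dirac//; last first.
  apply/measurable_EFinP; apply: continuous_measurable_Rd.
  exact: cutoff_continuous.
by rewrite diracT mul1e cutoff0.
Qed.

Lemma near_mass_le1 r t : (near_mass mu r t <= 1)%R.
Proof.
have -> : (1 = \int[mu t]_x (cst 1 : Rd R d -> R) x :> R)%R.
  by rewrite Rintegral_cst// [fine _](_ : _ = 1%R) ?mulr1// [X in fine X]probability_setT.
apply: le_Rintegral => //.
- apply: measurable_bounded_integrable => //.
  + by apply: (le_lt_trans _ (ltry 1%R)); exact: probability_le1.
  + by apply: continuous_measurable_Rd; exact: cutoff_continuous.
  + exists 1%R; split; first exact: num_real.
    move=> x x1 y _ /=.
    by rewrite ger0_norm ?cutoff_ge0// (le_trans (cutoff_le1 _ _)) ?ltW.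
- exact: finite_measure_integrable_cst.
- by move=> x _; exact: cutoff_le1.
Qed.

Let H0 : (0 < H)%R.
Proof. by rewrite -lte_fin -HE (integral_profile_gt0 keta). Qed.

(** If [E] were finite, [alpha] could be chosen with alpha E <= 1/2, and then [kappa] and [o] with Q
    / (2 alpha) <= 1/4, so that the flux integral is at most 3/8. A single step in time, along which
    the mass near 0 falls from 1 to at most 1/4, makes it at least 1/2 after a smoothing error of
    1/4. *)
Lemma action_infinite : theta 1%R 0%R = 0%R -> E = +oo.
Proof.
move=> th0; apply/eqP; rewrite -leye_eq leNgt; apply/negP => Eoo.
have E0 : 0 <= E by apply: integral_ge0 => t _; exact: action_ge0.
have Efin : E \is a fin_num by rewrite ge0_fin_numE.
pose Er := fine E; have Er0 : (0 <= Er)%R by exact: fine_ge0.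
pose alpha : R := ((2 * (Er + 1))^-1)%R.
have al0 : (0 < alpha)%R by rewrite invr_gt0 mulr_gt0// ltr_wpDl.
pose kappa : R := (alpha / (8 * (H + 1)))%R.
have H1 : (0 < H + 1)%R by rewrite addr_gt0.
have k0 : (0 < kappa)%R by rewrite divr_gt0// mulr_gt0.
have [C C0 thC] := itp_le_linear itheta k0.
pose o : R := (alpha / (8 * (C + 1)))%R.
have C1 : (0 < C + 1)%R by rewrite addr_gt0.
have o0 : (0 < o)%R by rewrite divr_gt0// mulr_gt0.
have e0 : (0 < 4^-1 :> R)%R by rewrite invr_gt0.
have [r r0 [g1 ro]] := small_radius e0 o0.
pose g := near_mass mu r.
have cg : {within `[0%R, 1%R], continuous g} by exact: near_mass_continuous ce _.
pose T (i : nat) : R := i%:R; pose c (i : nat) : R := 1%R.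
have TS i : (i < 1)%N -> (T i < T i.+1)%R by move=> _; rewrite ltr_nat.
have [a [tau [tau0 sa asupp aP aI]]] := @smooth_staircase R 1 T c g 4^-1%R cg erefl erefl
  TS (fun=> ler01) e0.
have a01 t : (0 <= a t <= 1)%R.
  have [->|/aP[i _ [_]]//] := eqVneq (a t) 0%R; by rewrite lexx ler01.
pose Q : R := (2 * (kappa * H + C * o))%R.
have kH0 : (0 <= kappa * H)%R by apply: mulr_ge0; exact: ltW.
have Co0 : (0 <= C * o)%R by apply: mulr_ge0; exact: ltW.
have q0 : (0 <= theta 1 0 + kappa)%R by rewrite th0 add0r ltW.
have aQ t : (0 <= t <= 1)%R ->
    (a t ^+ 2 * (2 * ((theta 1 0 + kappa) * H * near_mass mu r t + C * o)) <= Q)%R.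
  move=> _; have /andP[a0 a1] := a01 t; rewrite th0 add0r /Q.
  have m1 := near_mass_le1 r t.
  have m0 : (0 <= near_mass mu r t)%R.
    by apply: Rintegral_ge0 => x _; exact: cutoff_ge0.
  apply: (@le_trans _ _ (1 * (2 * (kappa * H * near_mass mu r t + C * o)))%R).
    apply: ler_wpM2r; last by rewrite exprn_ile1.
    by rewrite mulr_ge0// addr_ge0// mulr_ge0.
  by rewrite mul1r ler_pM2l// lerD2r ler_piMr.
have a_ge0 t : (0 <= a t)%R by case/andP : (a01 t).
have := flux_time_bound keta itheta ce r0 q0 (ltW C0) thC HE ro sa tau0 asupp a_ge0 al0 aQ.
rewrite -/g -(fineK Efin) -/Er -EFinM lee_fin.
move: aI; rewrite big_ord_recl big_ord0 addr0 /c mul1r.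
rewrite [g (T _)](_ : _ = 1%R); last exact: near_mass0.
rewrite [g (T _)](_ : _ = near_mass mu r 1)//.
move: (\int[_]_(_ in _) _)%R => I.
rewrite ler_norml => /andP[I1 _] I2.
have I3 := le_trans (ler_norm I) I2.
have aE : (alpha * Er <= 2^-1)%R.
  rewrite /alpha mulrC ler_pdivrMr ?mulr_gt0// ?ltr_wpDl//.
  by rewrite mulrA mulVf// mul1r lerDl.
have kH : (kappa * H <= alpha / 8)%R.
  rewrite /kappa -mulrA ler_pM2l// invfM -mulrA ler_piMr ?invr_ge0//.
  by rewrite mulrC ler_pdivrMr// mul1r lerDl.
have Co : (C * o <= alpha / 8)%R.
  rewrite /o mulrC -mulrA ler_pM2l// invfM -mulrA ler_piMr ?invr_ge0//.
  by rewrite mulrC ler_pdivrMr// mul1r lerDl.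
have QE : (Q / (2 * alpha) <= 4^-1)%R.
  rewrite ler_pdivrMr ?mulr_gt0// /Q; move: kH Co; lra.
by move: I1 I3 g1 aE QE; lra.
Qed.

(* With levels 4^-i the weight 2^i on {g < 4^-i} balances the factor g in the
   flux bound; the telescoping sum then gives 3/4+3/8+3/16+1/8 = 23/16 > sqrt 2. *)
Lemma action_lower_bound : (4 / H)%:E <= E.
Proof.
rewrite leNgt; apply/negP => Elt.
have E0 : 0 <= E by apply: integral_ge0 => t _; exact: action_ge0.
have Efin : E \is a fin_num by rewrite ge0_fin_numE// (lt_trans Elt)// ltry.
pose Er := fine E; have Er0 : (0 <= Er)%R by exact: fine_ge0.
have ErH : (Er * H < 4)%R.
  by rewrite -ltr_pdivlMr// -lte_fin /Er fineK.
(* Close to H / sqrt 8, the optimal value when E = 4 / H. *)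
pose alpha : R := (H * (35 / 100))%R.
have al0 : (0 < alpha)%R by rewrite mulr_gt0// divr_gt0.
(* With e = 1/1000 the flux integral is at least 23/16 - 9 e and at most (14/10 + 10/7 (1 + 3 e)) /
   2, which is smaller. *)
have [e [e0 eE]] : exists e : R, (0 < e /\ 10 * (10 * (10 * e)) = 1)%R.
  exists ((10 * (10 * 10))^-1)%R; split; last by field.
  by rewrite invr_gt0 !mulr_gt0.
have [C C0 thC] := itp_le_linear itheta e0.
(* The largest value of a^2 is 64 = 8^2, and 64 C o = H e / 2. *)
pose o : R := (H * e / (128 * C))%R.
have o0 : (0 < o)%R by apply: divr_gt0; apply: mulr_gt0.
have [r r0 [g1 ro]] := small_radius e0 o0.
pose g := near_mass mu r.
have g0 : g 0%R = 1%R by exact: near_mass0.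
have cg : {within `[0%R, 1%R], continuous g} by exact: near_mass_continuous ce _.
have lev (c : R) : (e < c)%R -> (c <= 1)%R -> exists2 T, (0 <= T < 1)%R &
    g T = c /\ forall t, (T < t <= 1)%R -> (g t < c)%R.
  by move=> c1 c2; apply: last_level => //; rewrite ?g0//; exact: le_lt_trans g1 c1.
have [] := lev (4^-1)%R; [by lra|by lra|move=> T1 T1I [gT1 T1P]].
have [] := lev (16^-1)%R; [by lra|by lra|move=> T2 T2I [gT2 T2P]].
have [] := lev (64^-1)%R; [by lra|by lra|move=> T3 T3I [gT3 T3P]].
have T1_gt0 : (0 < T1)%R.
  by rewrite lt_neqAle; case/andP: T1I => -> _; rewrite andbT;
    apply/eqP => T10; move: gT1; rewrite -T10 g0; lra.
have T12 : (T1 < T2)%R.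
  rewrite ltNge le_eqVlt; apply/negP => /predU1P[T12|T12].
    by move: gT1; rewrite -T12 gT2; lra.
  by have := T2P T1; rewrite T12 gT1 /=; case/andP: T1I => _ /ltW -> /(_ isT); lra.
have T23 : (T2 < T3)%R.
  rewrite ltNge le_eqVlt; apply/negP => /predU1P[T23|T23].
    by move: gT2; rewrite -T23 gT3; lra.
  by have := T3P T2; rewrite T23 gT2 /=; case/andP: T2I => _ /ltW -> /(_ isT); lra.
pose T (i : nat) : R := nth 1%R [:: 0%R; T1; T2; T3] i.
pose c (i : nat) : R := (2 ^+ i)%R.
have TS i : (i < 4)%N -> (T i < T i.+1)%R.
  by case: i => [|[|[|[|//]]]] _ //=; case/andP: T3I.
have c0 i : (0 <= c i)%R by rewrite exprn_ge0.
have [a [tau [tau0 sa asupp aP aI]]] := @smooth_staircase R 4 T c g _ cg erefl erefl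
  TS c0 e0.
have a_ge0 t : (0 <= a t)%R.
  by have [->//|/aP[i _ [_ /andP[]]]//] := eqVneq (a t) 0%R.
have q0 : (0 <= theta 1 0 + e)%R by apply: addr_ge0; [exact: itp10_ge0|exact: ltW].
have th2 := itp10_le_half itheta.
pose Q : R := (2 * ((theta 1 0 + e) * H + 64 * (C * o)))%R.
have Co0 : (0 <= C * o)%R by apply: mulr_ge0; exact: ltW.
have qH0 : (0 <= (theta 1 0 + e) * H)%R by apply: mulr_ge0 => //; exact: ltW.
have aQ t : (0 <= t <= 1)%R ->
    (a t ^+ 2 * (2 * ((theta 1 0 + e) * H * near_mass mu r t + C * o)) <= Q)%R.
  move=> /andP[t0 t1]; have [at0|at0] := eqVneq (a t) 0%R.
    by rewrite at0 expr0n/= mul0r /Q mulr_ge0// addr_ge0// mulr_ge0.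
  have [i i4 [/andP[Tit tTi] /andP[_ ac]]] := aP t at0.
  have m0 : (0 <= g t)%R by apply: Rintegral_ge0 => x _; exact: cutoff_ge0.
  have gc : (c i ^+ 2 * g t <= 1)%R.
    have gt1 := near_mass_le1 r t : (g t <= 1)%R.
    move: i4 Tit tTi {ac}; rewrite /c; case: i => [|[|[|[|//]]]] _ Tit tTi /=.
    - by rewrite expr0 expr1n mul1r.
    - by have := T1P t; rewrite Tit t1 => /(_ isT); rewrite expr1; lra.
    - by have := T2P t; rewrite Tit t1 => /(_ isT); rewrite -exprM; lra.
    - by have := T3P t; rewrite Tit t1 => /(_ isT); rewrite -exprM; lra.
  have c64 : (c i ^+ 2 <= 64)%R.
    by move: i4; rewrite /c; case: i {gc Tit tTi ac} => [|[|[|[|//]]]] _;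
      rewrite -exprM; lra.
  have a2 : (a t ^+ 2 <= c i ^+ 2)%R by rewrite ler_pXn2r ?nnegrE.
  apply: (@le_trans _ _ (c i ^+ 2 * (2 * ((theta 1 0 + e) * H * g t + C * o)))%R).
    by rewrite ler_wpM2r// mulr_ge0// addr_ge0// mulr_ge0.
  rewrite (_ : (c i ^+ 2 * _ = 2 * ((theta 1 0 + e) * H * (c i ^+ 2 * g t) + c i ^+ 2 * (C * o)))%R); last by ring.
  rewrite /Q ler_pM2l// lerD//; last by rewrite ler_wpM2r.
  by rewrite ler_piMr.
have := flux_time_bound keta itheta ce r0 q0 (ltW C0) thC HE ro sa tau0 asupp a_ge0 al0 aQ.
rewrite -/g -(fineK Efin) -/Er -EFinM lee_fin.
move: aI; rewrite !big_ord_recl big_ord0 /c /T /= g0 gT1 gT2 gT3.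
move: (\int[_]_(_ in _) _)%R => I.
rewrite ler_norml => /andP[I1 _] I2.
have I3 := le_trans (ler_norm I) I2.
have aE : (alpha * Er <= 14 / 10)%R by rewrite /alpha; move: ErH; lra.
have CoE : (C * o = H * e / 128)%R by rewrite /o; field; rewrite gt_eqF.
have QE : (Q / (2 * alpha) <= 10 / 7 * (1 + 3 * e))%R.
  rewrite ler_pdivrMr ?mulr_gt0// /Q CoE /alpha.
  have : (theta 1 0 * H <= 2^-1 * H)%R by rewrite ler_wpM2r// ltW.
  have : (0 < H * e)%R by rewrite mulr_gt0.
  by lra.
have g1' : (g 1 <= e)%R := g1.
by move: I1; rewrite !exprS !expr0; lra.
Qed.

End lower_bound.


(** * Weights of the levels in time *)

Section weights.
Context {R : realType}.
Implicit Types (t z : R) (k n : nat).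

Definition pospart (y : R) : R := Num.max 0 y.

(** Squaring makes the positive part differentiable at 0: the difference quotient there is the
    positive part itself, which tends to 0. *)
Lemma pospart_sqr_derive (y : R) :
  is_derive y (1 : R) (fun x => pospart x ^+ 2) (2 * pospart y).
Proof.
have pE x : 0 <= x -> pospart x = x by move=> x0; rewrite /pospart max_r.
have p0 x : x <= 0 -> pospart x = 0 by move=> x0; rewrite /pospart max_l.
have [y0|y0|->] := ltgtP y 0.
- rewrite p0 ?ltW// mulr0.
  have H : \forall x \near y, cst 0 x = pospart x ^+ 2.
    near=> x; rewrite p0 ?expr0n//= ltW//; near: x; exact: lt_nbhsl.
  exact: near_eq_is_derive H (is_derive_cst _ _ _).
- rewrite pE ?ltW//.
  have H : \forall x \near y, (fun x => x ^+ 2) x = pospart x ^+ 2.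
    near=> x; rewrite pE// ltW//; near: x; exact: lt_nbhsr.
  apply: (near_eq_is_derive H).
  have := @is_deriveX R R id 2 y 1 1 (is_derive_id _ _).
  rewrite (_ : _ *: 1 = 2 * y)//.
  by rewrite /GRing.scale/= mulr1.
- rewrite p0// mulr0.
  have E : (fun h : R => h^-1 *: (pospart (h *: (1 : R) + 0) ^+ 2 - pospart 0 ^+ 2)) =
           pospart.
    apply/funext => h; rewrite addr0 [h *: _]mulr1 (p0 0)// expr0n/= subr0.
    have [h0|h0] := leP h 0; first by rewrite p0// expr0n/= scaler0.
    by rewrite pE ?ltW// /GRing.scale/= mulKf// gt_eqF.
  have cE : pospart @ 0^' --> (0 : R).
    have c0 : pospart x @[x --> (0 : R)] --> pospart 0.
      by apply: (@continuous_max _ _ (cst 0) id 0); [exact: cvg_cst|exact: cvg_id].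
    by rewrite p0// in c0; apply: (cvg_trans _ c0); apply: cvg_app; exact: cvg_within.
  apply: DeriveDef; first by apply/cvg_ex; exists 0; rewrite E.
  by rewrite /derive E; apply: cvg_lim.
Unshelve. all: end_near. Qed.

(* Quartic contact with 1 at z = 1 and quadratic contact with 0 at z = 0 make
   [dpsi]^2 comparable with the differences of [psi] at ratio 2. *)
Definition psi z : R := (1 - pospart (1 - z) ^+ 2) ^+ 2.

Definition dpsi z : R := 4 * (1 - pospart (1 - z) ^+ 2) * pospart (1 - z).

Lemma is_derive_psi z : is_derive z (1 : R) psi (dpsi z).
Proof.
have d1 : is_derive z (1 : R) (fun y : R => 1 - y) (-1).
  rewrite -[X in is_derive _ _ _ X]sub0r.
  exact: is_deriveB.
have d2 : is_derive z (1 : R) ((fun x => pospart x ^+ 2) \o (fun y : R => 1 - y))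
    (2 * pospart (1 - z) * -1).
  by apply: is_derive1_comp; exact: pospart_sqr_derive.
have d3 : is_derive z (1 : R) (cst 1 - ((fun x => pospart x ^+ 2) \o (fun y : R => 1 - y)))
    (2 * pospart (1 - z)).
  rewrite (_ : 2 * _ = 0 - (2 * pospart (1 - z) * -1)); last by rewrite mulrN1 sub0r opprK.
  exact: is_deriveB.
have d4 := @is_deriveX R R _ 2 z 1 _ d3.
refine (@is_derive_eq _ _ _ _ _ _ _ _ d4 _).
by rewrite /dpsi /GRing.scale/= expr1 !fctE/=; ring.
Qed.

Lemma pospart_continuous : continuous pospart.
Proof.
by move=> x; apply: (@continuous_max _ _ (cst 0) id); [exact: cvg_cst|exact: cvg_id].
Qed.

Lemma dpsi_continuous : continuous dpsi.
Proof.
have c1 : continuous (fun z => pospart (1 - z)).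
  move=> z; apply: (@continuous_comp _ _ _ (fun z => 1 - z) pospart).
    by apply: cvgB; [exact: cvg_cst|exact: cvg_id].
  exact: pospart_continuous.
move=> z; apply: cvgM; last exact: c1.
apply: cvgM; first exact: cvg_cst.
apply: cvgB; first exact: cvg_cst.
by under eq_fun do rewrite expr2; rewrite expr2; apply: cvgM; exact: c1.
Qed.

(** Total weight of the levels 0, ..., k; it reaches 1 at time 2^-k. *)
Definition Wt k t : R := psi (2 ^+ k * t).

(** The derivative of [Wt k], that is, the rate at which mass passes from level k + 1 to level k. *)
Definition flow k t : R := 2 ^+ k * dpsi (2 ^+ k * t).

Definition weight k t : R := if k is k'.+1 then Wt k t - Wt k' t else Wt 0 t.

Lemma is_derive_Wt k t : is_derive t (1 : R) (Wt k) (flow k t).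
Proof.
have d1 : is_derive t (1 : R) (fun t => 2 ^+ k * t) (2 ^+ k).
  have := @is_deriveZ _ _ _ id (2 ^+ k) t 1 1 (is_derive_id _ _).
  by rewrite [_ *: 1]mulr1.
rewrite /flow mulrC; apply: (@is_derive1_comp _ psi (fun t => 2 ^+ k * t)) => //.
exact: is_derive_psi.
Qed.

Definition dweight k t : R := if k is k'.+1 then flow k t - flow k' t else flow 0 t.

Lemma is_derive_weight k t : is_derive t (1 : R) (weight k) (dweight k t).
Proof.
case: k => [|k]; first exact: is_derive_Wt.
by apply: (@is_deriveB _ _ _ (Wt k.+1) (Wt k)); exact: is_derive_Wt.
Qed.

Lemma flow_continuous k : continuous (flow k).
Proof.
move=> t; apply: cvgM; first exact: cvg_cst.
apply: (@continuous_comp _ _ _ (fun t => 2 ^+ k * t) dpsi); last exact: dpsi_continuous.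
by apply: cvgM; [exact: cvg_cst|exact: cvg_id].
Qed.

Lemma weight_continuous k : continuous (weight k).
Proof.
move=> t; apply: differentiable_continuous; apply/derivable1_diffP.
by have [] := is_derive_weight k t.
Qed.

Lemma psi_ge1 z : 1 <= z -> psi z = 1.
Proof.
by move=> z1; rewrite /psi /pospart max_l ?subr_le0// expr0n/= subr0 expr1n.
Qed.

Lemma dpsi_ge1 z : 1 <= z -> dpsi z = 0.
Proof. by move=> z1; rewrite /dpsi /pospart max_l ?subr_le0// mulr0. Qed.

Lemma psi_le1 z : z <= 1 -> psi z = (z * (2 - z)) ^+ 2.
Proof. by move=> z1; rewrite /psi /pospart max_r ?subr_ge0//; ring. Qed.

Lemma dpsi_le1 z : z <= 1 -> dpsi z = 4 * (z * (2 - z)) * (1 - z).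
Proof. by move=> z1; rewrite /dpsi /pospart max_r ?subr_ge0//; ring. Qed.

Lemma dpsi_ge0 z : 0 <= z -> 0 <= dpsi z.
Proof.
move=> z0; have [z1|z1] := leP z 1; last by rewrite dpsi_ge1// ltW.
by rewrite dpsi_le1// !mulr_ge0 ?subr_ge0//; lra.
Qed.

(* [flow k]^2 is controlled by both adjacent weights, which keeps the action
   density finite where a level is created and where it is exhausted. *)
Lemma dpsi_sqr_le_prev z : 0 <= z -> dpsi z ^+ 2 <= 150 * (psi z - psi (z / 2)).
Proof.
move=> z0; have [z1|z1] := leP z 1; last first.
  rewrite dpsi_ge1 ?(ltW z1)// expr0n/= psi_ge1 ?(ltW z1)//.
  have [z2|z2] := leP (z / 2) 1; last by rewrite psi_ge1 ?(ltW z2)// subrr mulr0.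
  rewrite psi_le1// mulr_ge0// subr_ge0 exprn_ile1//; last by nra.
  by rewrite mulr_ge0//; lra.
rewrite dpsi_le1// !psi_le1//; last by lra.
set u := z / 2; have zE : z = 2 * u by rewrite /u; field.
rewrite zE -subr_ge0; have u0 : 0 <= u by lra. have u1 : u <= 1 / 2 by lra.
have -> : 150 * ((2 * u * (2 - 2 * u)) ^+ 2 - (u * (2 - u)) ^+ 2) -
   (4 * (2 * u * (2 - 2 * u)) * (1 - 2 * u)) ^+ 2 =
   u ^+ 2 * (150 * ((2 - 3 * u) * (6 - 5 * u)) - (16 * (1 - u) * (1 - 2 * u)) ^+ 2) by ring.
apply: mulr_ge0; first exact: sqr_ge0.
(* Origin of the constant 150: the bound needs 150 (7/4) >= 256. *)
have h1 : 7 / 4 <= (2 - 3 * u) * (6 - 5 * u) by nra.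
have h2 : 0 <= (1 - u) * (1 - 2 * u) <= 1 by apply/andP; split; nra.
have h3 : ((1 - u) * (1 - 2 * u)) ^+ 2 <= 1 by rewrite exprn_ile1; case/andP: h2.
rewrite (_ : (16 * (1 - u) * (1 - 2 * u)) ^+ 2 = 256 * ((1 - u) * (1 - 2 * u)) ^+ 2); last by ring.
by lra.
Qed.

Lemma dpsi_sqr_le_next z : 0 <= z -> dpsi z ^+ 2 <= 150 * (psi (2 * z) - psi z).
Proof.
move=> z0; have [z1|z1] := leP z 1; last first.
  rewrite dpsi_ge1 ?(ltW z1)// expr0n/= !psi_ge1 ?(ltW z1)// ?subrr ?mulr0//; lra.
have [z2|z2] := leP (2 * z) 1.
  rewrite dpsi_le1// !psi_le1// -subr_ge0.
  have -> : 150 * ((2 * z * (2 - 2 * z)) ^+ 2 - (z * (2 - z)) ^+ 2) -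
     (4 * (z * (2 - z)) * (1 - z)) ^+ 2 =
     z ^+ 2 * (150 * ((2 - 3 * z) * (6 - 5 * z)) - 16 * ((2 - z) * (1 - z)) ^+ 2) by ring.
  apply: mulr_ge0; first exact: sqr_ge0.
  have h1 : 7 / 4 <= (2 - 3 * z) * (6 - 5 * z) by nra.
  have h2 : 0 <= (2 - z) * (1 - z) <= 2 by apply/andP; split; nra.
  have h3 : ((2 - z) * (1 - z)) ^+ 2 <= 4 by rewrite expr2; nra.
  by lra.
rewrite dpsi_le1// (@psi_ge1 (2 * z)) ?(ltW z2)// psi_le1//.
have h1 : 0 <= z * (2 - z) <= 1 by apply/andP; split; nra.
have -> : 1 - (z * (2 - z)) ^+ 2 = (1 - z) ^+ 2 * (1 + z * (2 - z)) by ring.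
have -> : (4 * (z * (2 - z)) * (1 - z)) ^+ 2 = (1 - z) ^+ 2 * (16 * (z * (2 - z)) ^+ 2) by ring.
rewrite [leRHS]mulrCA ler_wpM2l ?sqr_ge0//.
have h3 : (z * (2 - z)) ^+ 2 <= 1 by rewrite exprn_ile1; case/andP: h1.
by case/andP: h1 => h1 _; lra.
Qed.

Lemma flow_ge0 k t : 0 <= t -> 0 <= flow k t.
Proof. by move=> t0; rewrite mulr_ge0 ?exprn_ge0 ?dpsi_ge0// mulr_ge0 ?exprn_ge0. Qed.

Lemma flow_sqr_le_next k t : 0 <= t ->
  flow k t ^+ 2 <= 150 * 4 ^+ k * weight k.+1 t.
Proof.
move=> t0; rewrite /flow /weight /Wt [2 ^+ k.+1]exprS -[2 * _ * t]mulrA exprMn.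
have -> : (2 ^+ k) ^+ 2 = 4 ^+ k :> R by rewrite -exprM mulnC exprM -natrX.
rewrite [150 * _]mulrC -[leRHS]mulrA ler_wpM2l ?exprn_ge0//.
by apply: dpsi_sqr_le_next; rewrite mulr_ge0 ?exprn_ge0.
Qed.

Lemma flow_sqr_le_prev k t : 0 <= t -> flow k t ^+ 2 <= 150 * 4 ^+ k * weight k t.
Proof.
move=> t0; rewrite /flow exprMn.
have -> : (2 ^+ k) ^+ 2 = 4 ^+ k :> R by rewrite -exprM mulnC exprM -natrX.
rewrite [150 * _]mulrC -[leRHS]mulrA ler_wpM2l ?exprn_ge0//.
have k0 : 0 <= 2 ^+ k * t by rewrite mulr_ge0 ?exprn_ge0.
apply: (le_trans (dpsi_sqr_le_prev k0)); rewrite ler_wpM2l//.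
case: k k0 => [|k] k0; rewrite /weight /Wt; first by rewrite lerBlDr lerDl sqr_ge0.
rewrite (_ : 2 ^+ k.+1 * t / 2 = 2 ^+ k * t)//.
by rewrite exprS; field.
Qed.

Lemma weight_ge0 k t : 0 <= t -> 0 <= weight k t.
Proof.
move=> t0; have := flow_sqr_le_prev k t0 => /(le_trans (sqr_ge0 _)).
by rewrite pmulr_rge0// mulr_gt0// exprn_gt0.
Qed.

Lemma weight_sum n t : \sum_(k < n.+1) weight k t = Wt n t.
Proof.
elim: n => [|n ih]; first by rewrite big_ord_recl big_ord0 addr0.
by rewrite big_ord_recr/= ih addrC subrK.
Qed.

Lemma flow_eq0 k t : 1 <= 2 ^+ k * t -> flow k t = 0.
Proof. by move=> kt; rewrite /flow dpsi_ge1// mulr0. Qed.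

Lemma pow2_mono k n t : 0 <= t -> (k <= n)%N -> 2 ^+ k * t <= 2 ^+ n * t.
Proof. by move=> t0 kn; rewrite ler_wpM2r// ler_weXn2l// ler1n. Qed.

Lemma weight_eq0 k t : 0 <= t -> 1 <= 2 ^+ k * t -> weight k.+1 t = 0.
Proof.
move=> t0 kt; rewrite /weight /Wt !psi_ge1 ?subrr//.
by apply: le_trans kt _; exact: pow2_mono.
Qed.

Lemma weight_sum1 n t : 1 <= 2 ^+ n * t -> \sum_(k < n.+1) weight k t = 1.
Proof. by move=> nt; rewrite weight_sum /Wt psi_ge1. Qed.

Lemma psi0 : psi 0 = 0.
Proof. by rewrite psi_le1// mul0r expr0n. Qed.

Lemma weight0 k : weight k 0 = 0.
Proof. by case: k => [|k]; rewrite /weight /Wt !mulr0 psi0// subrr. Qed.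

Lemma flow0 k : flow k 0 = 0.
Proof. by rewrite /flow mulr0 dpsi_le1// !mul0r mulr0 mul0r mulr0. Qed.

Lemma weight1 k : weight k 1 = (k == 0%N)%:R.
Proof.
have p1 n : psi (2 ^+ n * 1) = 1.
  by rewrite psi_ge1// mulr1 exprn_ege1// ler1n.
by case: k => [|k]; rewrite /weight /Wt !p1// subrr.
Qed.

(** An integer n > 1/t satisfies 2^n t >= 1, so that the levels above n are empty at time [t]. *)
Definition levels t : nat := Num.bound t^-1.

Lemma levelsP t : 0 < t -> 1 <= 2 ^+ levels t * t.
Proof.
move=> t0; rewrite -ler_pdivrMr// mul1r.
have tV : 0 <= t^-1 by rewrite invr_ge0 ltW.
apply: le_trans (ltW (archi_boundP tV)) _.
by rewrite -natrX ler_nat ltnW// ltn_expl.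
Qed.

End weights.


(** * Mixtures of densities *)

Section with_density.
Local Open Scope ereal_scope.
Context disp (T : measurableType disp) (R : realType).
Variables (m : {measure set T -> \bar R}) (f : T -> R).

(* The two proofs are arguments so that the measure structure can be inferred. *)
Definition with_density of measurable_fun setT f & (forall x, 0 <= f x)%R :=
  fun A : set T => \int[m]_(x in A) (f x)%:E.

Hypotheses (mf : measurable_fun setT f) (f0 : forall x, (0 <= f x)%R).

Let with_density0 : with_density mf f0 set0 = 0.
Proof. exact: integral_set0. Qed.

Let with_density_ge0 A : 0 <= with_density mf f0 A.
Proof. by apply: integral_ge0 => x _; rewrite lee_fin. Qed.

Let with_density_sigma_additive : semi_sigma_additive (with_density mf f0).
Proof.
apply: semi_sigma_additive_nng_induced; first exact/measurable_EFinP.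
by move=> x; rewrite lee_fin.
Qed.

HB.instance Definition _ := isMeasure.Build _ _ _ (with_density mf f0)
  with_density0 with_density_ge0 with_density_sigma_additive.

End with_density.

Section integrable_bounded_mul.
Context disp (T : measurableType disp) (R : realType).
Variables (m : {measure set T -> \bar R}) (g : T -> R).
Hypothesis mg : m.-integrable setT (EFin \o g).

Lemma integrable_bounded_mul (f : T -> R) (M : R) :
  measurable_fun setT f -> (forall x, `|f x| <= M) ->
  m.-integrable setT (EFin \o (fun x => f x * g x)).
Proof.
move=> mf fM.
have M0 (x : T) : 0 <= M := le_trans (normr_ge0 _) (fM x).
have mg' : measurable_fun setT g by apply/measurable_EFinP; exact: measurable_int mg.
apply: (@le_integrable _ _ _ m setT measurableT _ (fun x => (M%:E * (g x)%:E)%E)).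
- by apply/measurable_EFinP; exact: measurable_funM.
- move=> x _ /=; rewrite lee_fin !normrM ler_wpM2r//.
  by rewrite (ger0_norm (M0 x)).
- by apply: integrableZl.
Qed.

End integrable_bounded_mul.

Arguments weight : simpl never.

Section stable.
Context {R : realType}.

Lemma sum_weight_stable n m (t : R) (F : nat -> R) : 0 <= t -> (n <= m)%N ->
  1 <= 2 ^+ n * t ->
  \sum_(k < m.+1) weight k t * F k = \sum_(k < n.+1) weight k t * F k.
Proof.
move=> t0 nm nt; rewrite -(subnKC nm); elim: (m - n)%N => [|i ih]; first by rewrite addn0.
rewrite addnS big_ord_recr/= ih weight_eq0//; first by rewrite mul0r addr0.
by apply: le_trans nt _; apply: pow2_mono => //; exact: leq_addr.
Qed.

Lemma sum_flow_stable n m (t : R) (F : nat -> R) : 0 <= t -> (n <= m)%N ->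
  1 <= 2 ^+ n * t ->
  \sum_(k < m) flow k t * F k = \sum_(k < n) flow k t * F k.
Proof.
move=> t0 nm nt; rewrite -(subnKC nm); elim: (m - n)%N => [|i ih]; first by rewrite addn0.
rewrite addnS big_ord_recr/= ih flow_eq0//; first by rewrite mul0r addr0.
by apply: le_trans nt _; apply: pow2_mono => //; exact: leq_addr.
Qed.

Lemma sum_weight_levels n (t : R) (F : nat -> R) : 0 < t -> 1 <= 2 ^+ n * t ->
  \sum_(k < (levels t).+1) weight k t * F k = \sum_(k < n.+1) weight k t * F k.
Proof.
move=> t0 nt; have [nl|ln] := leqP n (levels t).
  by apply: sum_weight_stable => //; exact: ltW.
by apply/esym; apply: sum_weight_stable; [exact: ltW|exact: ltnW|exact: levelsP].
Qed.

Lemma sum_flow_levels n (t : R) (F : nat -> R) : 0 < t -> 1 <= 2 ^+ n * t ->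
  \sum_(k < levels t) flow k t * F k = \sum_(k < n) flow k t * F k.
Proof.
move=> t0 nt; have [nl|ln] := leqP n (levels t).
  by apply: sum_flow_stable => //; exact: ltW.
by apply/esym; apply: sum_flow_stable; [exact: ltW|exact: ltnW|exact: levelsP].
Qed.

End stable.

Section mixture.
Local Open Scope ereal_scope.
Context {R : realType} {d : nat} (beta : {measure set (Rd R d) -> \bar R}).
Variable g : nat -> Rd R d -> R.
Hypotheses (mg : forall k, measurable_fun setT (g k)) (g0 : forall k x, (0 <= g k x)%R).
Hypothesis g1 : forall k, \int[beta]_x (g k x)%:E = 1.

(* At time t > 0 only finitely many weights are nonzero; the mass of level k is
   released at times of order 2^-k. For t <= 0 the density is 0, so that
   normalization returns the Dirac mass. *)
Definition mixture (t : R) (x : Rd R d) : R :=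
  (\sum_(k < (levels (pospart t)).+1) weight k (pospart t) * g k x)%R.

Lemma pospart_ge0 (t : R) : (0 <= pospart t)%R.
Proof. by rewrite /pospart le_max lexx. Qed.

Lemma pospart_id (t : R) : (0 <= t)%R -> pospart t = t.
Proof. by move=> t0; rewrite /pospart max_r. Qed.

Lemma measurable_mixture t : measurable_fun setT (mixture t).
Proof. by apply: measurable_sum => k; apply: measurable_funM. Qed.

Lemma mixture_ge0 t x : (0 <= mixture t x)%R.
Proof.
by apply: sumr_ge0 => k _; rewrite mulr_ge0// weight_ge0// pospart_ge0.
Qed.

Lemma mixtureE n t x : (0 < t)%R -> (1 <= 2 ^+ n * t)%R ->
  mixture t x = (\sum_(k < n.+1) weight k t * g k x)%R.
Proof.
move=> t0 nt; rewrite /mixture pospart_id ?(ltW t0)//.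
exact: (sum_weight_levels (fun k => g k x)).
Qed.

Definition curve (t : R) : probability (Rd R d) R :=
  mnormalize (with_density beta (measurable_mixture t) (mixture_ge0 t)) (\d_(0%R : Rd R d)).

Lemma integrable_g k : beta.-integrable setT (EFin \o g k).
Proof.
apply/integrableP; split; first exact/measurable_EFinP.
under eq_integral do rewrite /= ger0_norm//.
by rewrite g1 ltry.
Qed.

Lemma mixture_mass t : (0 < t)%R -> \int[beta]_x (mixture t x)%:E = 1.
Proof.
move=> t0; have nt := levelsP t0.
under eq_integral do rewrite (mixtureE _ t0 nt) -sumEFin.
rewrite ge0_integral_sum//; last 2 first.
- by move=> k; apply/measurable_EFinP; apply: measurable_funM.
- by move=> k x _; rewrite lee_fin mulr_ge0// weight_ge0// ltW.
under eq_bigr => k _.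
  under eq_integral do rewrite EFinM.
  rewrite ge0_integralZl_EFin//; last 3 first.
  - by move=> x _; rewrite lee_fin.
  - exact/measurable_EFinP.
  - by rewrite weight_ge0// ltW.
  rewrite g1 mule1; over.
by rewrite sumEFin weight_sum1.
Qed.

Lemma curveE t A : (0 < t)%R -> curve t A = \int[beta]_(x in A) (mixture t x)%:E.
Proof.
move=> t0; rewrite /curve/= /mnormalize/= /with_density mixture_mass//.
by rewrite onee_eq0/= invr1 mule1.
Qed.

Lemma integral_curve t (N : Rd R d -> \bar R) : (0 < t)%R -> measurable_fun setT N ->
  \int[curve t]_x N x = \int[beta]_x (N x * (mixture t x)%:E).
Proof.
move=> t0 mN; apply: integral_density => //.
- exact: measurable_mixture.
- exact: mixture_ge0.
- by move=> A mA _; exact: curveE.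
Qed.

Lemma curve0 A : curve 0 A = \d_(0%R : Rd R d) A.
Proof.
rewrite /curve/= /mnormalize/= /with_density.
rewrite (_ : \int[beta]_x _ = 0) ?eqxx//.
apply: integral0_eq => x _; rewrite /mixture pospart_id// big1// => k _.
by rewrite weight0 mul0r.
Qed.

Definition level_mean k (f : Rd R d -> R) : R := (\int[beta]_x (f x * g k x))%R.

Section bounded.
Variables (f : Rd R d -> R) (M : R).
Hypotheses (mf : measurable_fun setT f) (fM : forall x, (`|f x| <= M)%R).

Lemma integrable_level_mean k : beta.-integrable setT (EFin \o (fun x => f x * g k x)%R).
Proof. by apply: (integrable_bounded_mul (integrable_g k) mf fM). Qed.

Lemma level_meanE k : \int[beta]_x (f x * g k x)%:E = (level_mean k f)%:E.
Proof.
rewrite /level_mean /Rintegral fineK//.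
by apply: integrable_fin_num => //; exact: integrable_level_mean.
Qed.

Lemma integral_curve_sum n t : (0 < t)%R -> (1 <= 2 ^+ n * t)%R ->
  \int[curve t]_x (f x)%:E = (\sum_(k < n.+1) weight k t * level_mean k f)%:E.
Proof.
move=> t0 nt; rewrite integral_curve//; last exact/measurable_EFinP.
have -> : (fun x => (f x)%:E * (mixture t x)%:E) =
    (fun x => \sum_(k < n.+1) (weight k t)%:E * (f x * g k x)%:E).
  apply/funext => x; rewrite (mixtureE _ t0 nt) -EFinM mulr_sumr -sumEFin.
  by apply: eq_bigr => k _; rewrite -EFinM mulrCA.
rewrite integral_sum//; last first.
  by move=> k; apply: integrableZl => //; exact: integrable_level_mean.
rewrite -sumEFin; apply: eq_bigr => k _.
rewrite integralZl//; last exact: integrable_level_mean.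
by rewrite level_meanE -EFinM.
Qed.

End bounded.

Lemma level_mean_le k (f : Rd R d -> R) (M : R) : measurable_fun setT f -> (forall x, (`|f x| <= M)%R) ->
  (`|level_mean k f| <= M)%R.
Proof.
move=> mf fM; rewrite -lee_fin -abse_EFin -(level_meanE mf fM).
apply: (le_trans (le_abse_integral _ _ _)) => //.
  by apply/measurable_EFinP; exact: measurable_funM.
apply: (@le_trans _ _ (\int[beta]_x (M%:E * (g k x)%:E))).
  apply: ge0_le_integral_nonmeas => x _; first exact: abse_ge0.
  by rewrite /= -EFinM lee_fin normrM (ger0_norm (g0 k x)) ler_wpM2r.
have M0 : (0 <= M)%R := le_trans (normr_ge0 _) (fM 0%R).
rewrite ge0_integralZl_EFin//; last exact/measurable_EFinP.
  by rewrite g1 mule1.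
by move=> x _; rewrite lee_fin.
Qed.

End mixture.


(** * Narrow continuity of the mixtures *)

Section weighted.
Context {R : realType}.

(** Near a positive time the sum has a fixed number of terms. As t tends to 0 the first N levels
    together lose their weight [Wt N], and the later [L k] are close to [l]. *)
Lemma weighted_continuous (L : nat -> R) (l M : R) (F : R -> R) :
  (forall t, t <= 0 -> F t = l) ->
  (forall t n, 0 < t -> 1 <= 2 ^+ n * t -> F t = \sum_(k < n.+1) weight k t * L k) ->
  (forall k, `|L k - l| <= M) -> L @ \oo --> l -> continuous F.
Proof.
move=> F0 FE LM Ll t; have [t0|t0|t0] := ltgtP t 0.
- have H : \forall s \near t, cst l s = F s.
    by near=> s; rewrite F0// ltW//; near: s; exact: lt_nbhsl.
  by apply: cvg_trans (near_eq_cvg H) _; rewrite F0 ?ltW//; exact: cvg_cst.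
- pose n := levels (t / 2).
  have t20 : 0 < t / 2 by rewrite divr_gt0.
  have nt : 1 <= 2 ^+ n * (t / 2) := levelsP t20.
  have nE s : t / 2 < s -> F s = \sum_(k < n.+1) weight k s * L k.
    move=> ts; apply: FE; first exact: lt_trans ts.
    by apply: (le_trans nt); rewrite ler_wpM2l ?exprn_ge0// ltW.
  have t2t : t / 2 < t by rewrite ltr_pdivrMr// ltr_pMr// ltr1n.
  have H : \forall s \near t, (fun s => \sum_(k < n.+1) weight k s * L k) s = F s.
    by near=> s; rewrite nE//; near: s; exact: lt_nbhsr.
  apply: cvg_trans (near_eq_cvg H) _; rewrite nE//.
  have := @continuous_sum R R _ (index_enum 'I_n.+1) (fun k s => weight k s * L k).
  apply => k s; apply: cvgM; [exact: weight_continuous|exact: cvg_cst].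
- rewrite t0; apply/cvgrPdist_le => e e0; rewrite F0//.
  have M0 : 0 <= M := le_trans (normr_ge0 _) (LM 0%N).
  have e2 : 0 < e / 2 by rewrite divr_gt0.
  have /cvgrPdist_le /(_ _ e2) [N _ HN] := Ll.
  have Wc : M * Wt N s @[s --> (0 : R)] --> M * Wt N 0.
    apply: cvgM; first exact: cvg_cst.
    rewrite (_ : Wt N = fun s => \sum_(k < N.+1) weight k s); last first.
      by apply/funext => s; rewrite weight_sum.
    have := @continuous_sum R R _ (index_enum 'I_N.+1) (fun k s => weight k s).
    by apply => k s; exact: weight_continuous.
  rewrite [Wt N 0](_ : _ = 0) ?mulr0 in Wc; last by rewrite /Wt mulr0 psi0.
  move/cvgrPdist_le : Wc => /(_ _ e2) HW.
  near=> s; have [s0|s0] := leP s 0; first by rewrite F0// subrr normr0 ltW.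
  pose n := (N + levels s)%N.
  have ns : 1 <= 2 ^+ n * s.
    by apply: le_trans (levelsP s0) _; apply: pow2_mono; [exact: ltW|exact: leq_addl].
  have HWs : M * Wt N s <= e / 2.
    apply: (le_trans (ler_norm _)); rewrite -normrN -[X in `|X|]add0r.
    by near: s; exact: HW.
  rewrite (FE _ _ s0 ns) -[X in `|X - _|]mul1r -(weight_sum1 ns) mulr_suml -sumrB.
  apply: (le_trans (ler_norm_sum _ _ _)).
  apply: (@le_trans _ _ (\sum_(k < n.+1) (weight k s * (e / 2) +
      (if (k < N.+1)%N then M * weight k s else 0)))).
    apply: ler_sum => k _; have w0 := weight_ge0 k (ltW s0).
    rewrite -mulrBr normrM (ger0_norm w0); case: ifPn => kN.
      rewrite [M * _]mulrC -mulrDr ler_wpM2l// distrC.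
      by apply: (le_trans (LM k)); rewrite lerDr ltW.
    by rewrite addr0 ler_wpM2l//; apply: HN; rewrite /= leqNgt; move: kN; apply: contra => /ltnW.
  rewrite big_split/= -mulr_suml (weight_sum1 ns) mul1r -big_mkcond/=.
  rewrite -(big_ord_widen n.+1 (fun k => M * weight k s)); last by rewrite ltnS leq_addr.
  by rewrite -mulr_sumr weight_sum [leRHS](splitr e) lerD2l.
Unshelve. all: end_near. Qed.

End weighted.

Section narrow.
Context {R : realType} {d : nat} (beta : {measure set (Rd R d) -> \bar R}).
Variable g : nat -> Rd R d -> R.
Hypotheses (mg : forall k, measurable_fun setT (g k)) (g0 : forall k x, (0 <= g k x)%R).
Hypothesis g1 : forall k, (\int[beta]_x (g k x)%:E = 1)%E.
Hypothesis g_cvg : forall f : Rd R d -> R, continuous f -> (exists M, forall x, `|f x| <= M) ->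
  level_mean beta g k f @[k --> \oo] --> f 0.

Lemma curve_le0 t A : t <= 0 -> curve beta mg g0 t A = \d_(0 : Rd R d) A.
Proof.
move=> t0; rewrite /curve/= /mnormalize/= /with_density.
rewrite (_ : (\int[beta]_x _)%E = 0%E) ?eqxx//.
apply: integral0_eq => x _; rewrite /mixture (_ : pospart t = 0) ?big1// => [k _|].
  by rewrite weight0 mul0r.
by rewrite /pospart max_l.
Qed.

Lemma curve_narrowly_continuous : narrowly_continuous (curve beta mg g0).
Proof.
move=> f cf [M fM]; apply: continuous_subspaceT.
have mf := continuous_measurable_Rd cf.
apply: (@weighted_continuous R (fun k => level_mean beta g k f) (f 0) (M + M)).
- move=> t t0; rewrite /Rintegral (eq_measure_integral (\d_(0 : Rd R d))).
    rewrite integral_dirac//; last exact/measurable_EFinP.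
    by rewrite diracT mul1e.
  by move=> A mA _; exact: curve_le0.
- move=> t n t0 nt; rewrite /Rintegral.
  by rewrite (integral_curve_sum mg g0 g1 mf fM t0 nt).
- move=> k; apply: (le_trans (ler_normB _ _)); apply: lerD => //.
  exact: (level_mean_le mg g0 g1 k mf fM).
- by apply: g_cvg => //; exists M.
Qed.

End narrow.


Lemma continuous_ptws (R : realType) (T : topologicalType) (I : Type) (f : T -> {ptws I -> R}) :
  (forall i, continuous (fun t => f t i)) -> continuous f.
Proof.
move=> cf t; apply/cvg_sup => i U [? /= [[W oW <-]]] /= Wft /filterS; apply.
by apply: cf; exact: open_nbhs_nbhs.
Qed.

(** * Curves of fluxes and their measurability *)

Section fluxes.
Context {R : realType} {d : nat} (eta : R -> R).
Local Notation RR := (Rd R d * Rd R d)%type.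
Local Notation G := (@Gset R d eta).
Hypothesis keta : weight_kernel d eta.
Variables (b2 : {measure set RR -> \bar R}) (p : nat -> RR -> R).
Hypotheses (mp : forall k, measurable_fun setT (p k)) (p0 : forall k z, 0 <= p k z).
Hypothesis p_fin : forall k, (\int[b2]_z (p k z)%:E < +oo)%E.
Hypothesis p_G : forall k z, ~ G z -> p k z = 0.
Hypothesis p_K : forall K, compact K -> K `<=` G ->
  exists N, forall k z, (N <= k)%N -> K z -> p k z = 0.

Definition pair_profile (z : RR) : R := profile eta (enorm (z.1 - z.2)).
Local Notation pf := pair_profile.

Lemma pair_profile_ge0 z : 0 <= pf z.
Proof. exact: profile_ge0 keta _. Qed.

Lemma pair_profile_gt0 z : G z -> 0 < pf z.
Proof. by rewrite (GsetE eta). Qed.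

(** By monotonicity the profile is smallest where the distance is largest, and the distance, being
    continuous, attains its maximum on [K]. *)
Lemma pair_profile_lower_bound K : compact K -> K `<=` G ->
  exists2 c, 0 < c & forall z, K z -> c <= pf z.
Proof.
move=> cK KG; have [->|/set0P K0] := eqVneq K set0; first by exists 1.
have [|z0 /set_mem Kz0 z0P] := @compact_EVT_max _ R (fun z => enorm (z.1 - z.2)) K K0 cK.
  by apply: continuous_subspaceT; exact: enorm_sub_continuous.
exists (pf z0); first exact: pair_profile_gt0 (KG _ Kz0).
move=> z Kz; have z0z : enorm (z.1 - z.2) <= enorm (z0.1 - z0.2) by apply: z0P; exact: mem_set.
have e0 : 0 < enorm (z.1 - z.2) by rewrite enorm_gt0 subr_eq0; case: (KG _ Kz).
rewrite /pf /profile e0 (lt_le_trans e0 z0z).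
exact: (wk_nonincreasing keta).
Qed.

(* The factor 2 / eta undoes the factor eta / 2 of the continuity equation. *)
Definition flux_density (t : R) (z : RR) : R :=
  \sum_(k < levels (pospart t)) flow k (pospart t) * (2 * p k z / pf z).

Lemma measurable_level_flux k : measurable_fun setT (fun z => 2 * p k z / pf z).
Proof.
apply: measurable_funM; first exact: measurable_funM.
rewrite (_ : (fun z => (pf z)^-1) = (@powR R ^~ (-1)) \o pf); last first.
  by apply/funext => z /=; rewrite powR_inv1// pair_profile_ge0.
apply: measurableT_comp; first exact: measurable_powR.
exact: measurable_profile_sub keta.
Qed.

Lemma level_flux_ge0 k z : 0 <= 2 * p k z / pf z.
Proof. by rewrite divr_ge0 ?mulr_ge0 ?pair_profile_ge0. Qed.

Lemma measurable_flux_density t : measurable_fun setT (flux_density t).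
Proof.
by apply: measurable_sum => k; apply: measurable_funM => //; exact: measurable_level_flux.
Qed.

Lemma flux_density_ge0 t z : 0 <= flux_density t z.
Proof.
by apply: sumr_ge0 => k _; rewrite mulr_ge0 ?flow_ge0 ?pospart_ge0 ?level_flux_ge0.
Qed.

Lemma flux_densityG t z : ~ G z -> flux_density t z = 0.
Proof. by move=> Gz; apply: big1 => k _; rewrite p_G// mulr0 mul0r mulr0. Qed.

(** Replaces the number of terms of [flux_density], which grows as t tends to 0, by one independent
    of time. *)
Lemma flux_density_sum N t z : (forall k, (N <= k)%N -> p k z = 0) ->
  flux_density t z = \sum_(k < N) flow k (pospart t) * (2 * p k z / pf z).
Proof.
move=> pN; rewrite /flux_density; have := pospart_ge0 t.
rewrite le_eqVlt => /predU1P[<-|t0].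
  by rewrite !big1// => k _; rewrite flow0 mul0r.
set T := pospart t in t0 *; set F := fun k => 2 * p k z / pf z.
have NF k : (N <= k)%N -> F k = 0 by move=> Nk; rewrite /F pN// mulr0 mul0r.
have -> : \sum_(k < N) flow k T * F k = \sum_(k < maxn N (levels T)) flow k T * F k.
  rewrite (big_ord_widen (maxn N (levels T)) (fun k => flow k T * F k)) ?leq_maxl//.
  rewrite big_mkcond/=; apply: eq_bigr => k _; case: ifPn => //.
  by rewrite -leqNgt => /NF ->; rewrite mulr0.
apply/esym; apply: sum_flow_stable; [exact: ltW|exact: leq_maxr|exact: levelsP].
Qed.

Definition flux_measure (t : R) : {measure set RR -> \bar R} :=
  with_density b2 (measurable_flux_density t) (flux_density_ge0 t).

Lemma integrable_p k : b2.-integrable setT (EFin \o p k).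
Proof.
apply/integrableP; split; first exact/measurable_EFinP.
by under eq_integral do rewrite /= ger0_norm//.
Qed.

Lemma integrable_level_flux K k : compact K -> K `<=` G -> measurable K ->
  b2.-integrable K (EFin \o (fun z => 2 * p k z / pf z)).
Proof.
move=> cK KG mK; have [c c0 cP] := pair_profile_lower_bound cK KG.
apply: (@le_integrable _ _ _ b2 K mK _ (fun z => ((2 / c)%:E * (p k z)%:E)%E)).
- by apply/measurable_EFinP/measurable_funTS; exact: measurable_level_flux.
- move=> z Kz /=; rewrite lee_fin ger0_norm ?level_flux_ge0//.
  rewrite ger0_norm ?mulr_ge0 ?invr_ge0 ?(ltW c0)//.
  rewrite mulrAC ler_wpM2r// ler_wpM2l// lef_pV2 ?posrE//; first exact: cP.
  exact: pair_profile_gt0 (KG _ Kz).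
- apply: integrableZl => //; apply: (integrableS measurableT) => //.
  exact: integrable_p.
Qed.

Lemma compact_measurable_RR (K : set RR) : compact K -> measurable K.
Proof.
move=> cK; rewrite -[K]setCK; apply: measurableC; apply: open_measurable_RR.
by apply: closed_openC; apply: compact_closed => //; exact: norm_hausdorff.
Qed.

Lemma flux_measure_locally_finite t : locally_finite_on G (flux_measure t).
Proof.
split.
  by apply: integral0_eq => z Gz; rewrite flux_densityG.
move=> K cK KG; have mK := compact_measurable_RR cK.
rewrite /flux_measure/= /with_density.
have : b2.-integrable K (EFin \o flux_density t).
  rewrite (_ : EFin \o _ = fun z => \sum_(k < levels (pospart t))
     ((flow k (pospart t))%:E * (2 * p k z / pf z)%:E)%E).
    apply: integrable_sum => // k _; apply: integrableZl => //.
    exact: integrable_level_flux.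
  by apply/funext => z; rewrite /= -sumEFin.
move=> /integrableP[_]; apply: le_lt_trans.
by apply: ge0_le_integral_nonmeas => z _; rewrite ?lee_fin ?flux_density_ge0//= ler_norm.
Qed.

Lemma mzero_locally_finite : locally_finite_on G (@mzero _ RR R).
Proof. by split => // K _ _; exact: (ltry (0 : R)). Qed.

Lemma flux_measure_mzero_singular t : mutually_singular (flux_measure t) (@mzero _ RR R).
Proof. by exists set0; split. Qed.

Definition flux_curve (t : R) : Mloc G :=
  Build_Mloc (flux_measure_locally_finite t) mzero_locally_finite
    (flux_measure_mzero_singular t).

Lemma integral_flux_curve t (N : RR -> \bar R) : measurable_fun G N ->
  (\int[mpos (flux_curve t)]_(z in G) N z = \int[b2]_(z in G) (N z * (flux_density t z)%:E))%E.
Proof.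
move=> mN; apply: integral_density => //.
- exact: measurable_Gset keta.
- by apply: measurable_funTS; exact: measurable_flux_density.
- exact: flux_density_ge0.
Qed.

(** By [p_K] the support of a test function meets finitely many levels only, so time enters through
    finitely many [flow k]. In particular every pairing is continuous in time. *)
Lemma pairing_flux_curve (phi : Cc G) : exists N, exists c : nat -> R, forall t,
  pairing (flux_curve t) phi = \sum_(k < N) flow k (pospart t) * c k.
Proof.
have mG := measurable_Gset keta.
have [cphi [K [cK KG phiK]]] : Cc G (val phi) := set_mem (valP phi).
set ph := val phi in cphi phiK.
have mphi : measurable_fun G ph := within_continuous_measurable_RR mG cphi.
have [N NP] := p_K cK KG; exists N.
exists (fun k => fine (\int[b2]_(z in G) (ph z * (2 * p k z / pf z))%:E)) => t.
have mK := compact_measurable_RR cK.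
have [M MP] : exists M, forall z, K z -> `|ph z| <= M.
  have [->|/set0P K0] := eqVneq K set0; first by exists 0.
  have [|z0 _ z0P] := @compact_EVT_max _ R (fun z => `|ph z|) K K0 cK.
    have cK' := continuous_subspaceW KG cphi.
    move=> z; apply: (@continuous_comp (subspace K) _ _ ph (fun y => `|y|)).
      exact: cK'.
    exact: norm_continuous.
  by exists `|ph z0| => z Kz; apply: z0P; exact: mem_set.
have iphi k : b2.-integrable G (EFin \o (fun z => ph z * (2 * p k z / pf z))).
  have [c c0 cP] := pair_profile_lower_bound cK KG.
  have M0 : 0 <= `|M| by [].
  apply: (@le_integrable _ _ _ b2 G mG _ (fun z => ((`|M| * (2 / c))%:E * (p k z)%:E)%E)).
  - apply/measurable_EFinP; apply: measurable_funM => //.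
    by apply: measurable_funTS; exact: measurable_level_flux.
  - move=> z Gz /=; rewrite lee_fin normrM (ger0_norm (level_flux_ge0 _ _)).
    rewrite [leRHS]ger0_norm ?mulr_ge0 ?invr_ge0 ?(ltW c0)//.
    have [->|phiz] := eqVneq (ph z) 0.
      by rewrite normr0 mul0r ?mulr_ge0 ?invr_ge0 ?(ltW c0).
    have Kz := phiK _ Gz phiz.
    rewrite -[leRHS]mulrA ler_pM ?level_flux_ge0//.
      by apply: (le_trans (MP _ Kz)); exact: ler_norm.
    rewrite mulrAC ler_wpM2r// ler_wpM2l// lef_pV2 ?posrE//; first exact: cP.
    exact: pair_profile_gt0.
  - apply: integrableZl => //; apply: (integrableS measurableT) => //.
    exact: integrable_p.
rewrite /pairing -/ph /Rintegral/= integral_measure_zero/= subr0.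
rewrite integral_flux_curve; last exact/measurable_EFinP.
have -> : (\int[b2]_(z in G) ((ph z)%:E * (flux_density t z)%:E) =
  \int[b2]_(z in G) \sum_(k < N) ((flow k (pospart t))%:E *
     (ph z * (2 * p k z / pf z))%:E))%E.
  apply: eq_integral => z /set_mem Gz.
  rewrite -EFinM; under eq_bigr do rewrite -EFinM.
  rewrite sumEFin; congr EFin.
  have [->|phiz] := eqVneq (ph z) 0.
    by rewrite mul0r big1// => k _; rewrite mul0r mulr0.
  rewrite (@flux_density_sum N); last by move=> k Nk; apply: NP => //; exact: phiK.
  by rewrite mulr_sumr; apply: eq_bigr => k _; rewrite mulrCA.
have ik k : b2.-integrable G (fun z => (flow k (pospart t))%:E * (ph z * (2 * p k z / pf z))%:E)%E.
  by apply: integrableZl => //; exact: iphi.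
rewrite integral_sum//.
have E k : (\int[b2]_(z in G) ((flow k (pospart t))%:E * (ph z * (2 * p k z / pf z))%:E) =
    (flow k (pospart t) * fine (\int[b2]_(z in G) (ph z * (2 * p k z / pf z))%:E))%:E)%E.
  rewrite integralZl//; last exact: iphi.
  by rewrite [RHS]EFinM fineK//; exact: integrable_fin_num (iphi k).
by rewrite -[RHS]/(fine (_%:E)) -sumEFin; congr fine; apply: eq_bigr => k _; exact: E.
Qed.

(** The curve is even weak* continuous, so preimages of the generating open sets are open. *)
Lemma flux_curve_borel : weakstar_borel flux_curve.
Proof.
have cj : continuous ((fun t => pairing (flux_curve t)) : R -> {ptws (Cc G) -> R}).
  apply: continuous_ptws => phi t.
  have [N [c E]] := pairing_flux_curve phi.
  rewrite (_ : (fun t => _) = fun t => \sum_(k < N) flow k (pospart t) * c k); last first.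
    by apply/funext => s; exact: E.
  have := @continuous_sum R R _ (index_enum 'I_N) (fun k s => flow k (pospart s) * c k).
  apply => k s; apply: cvgM; last exact: cvg_cst.
  by apply: continuous_comp; [exact: pospart_continuous|exact: flow_continuous].
pose S := [set B : set (Mloc G) | measurable (flux_curve @^-1` B)].
have SS : sigma_algebra setT S.
  split; rewrite /S/=.
  - by rewrite preimage_set0.
  - by move=> A mA; rewrite setTD preimage_setC; exact: measurableC.
  - by move=> F mF; rewrite preimage_bigcup; exact: bigcup_measurable.
move=> B BS; apply: measurableI; first exact: measurable_itv.
apply: (smallest_sub SS _ BS).
move=> _ [V oV <-]; rewrite /S/=.
rewrite (_ : _ @^-1` _ = (fun t => pairing (flux_curve t)) @^-1` V)//.
apply: open_measurable; apply: (@open_comp _ _ (fun t => pairing (flux_curve t) : {ptws (Cc G) -> R})).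
  by move=> t _; exact: cj.
exact: oV.
Qed.

End fluxes.


(** * Test functions and their means over a level *)

Lemma continuous_pair_fst (T U : topologicalType) (t : T) : continuous (fun x : U => (t, x)).
Proof. by move=> x; exact: (cvg_pair (cvg_cst t) cvg_id). Qed.

Lemma continuous_pair_snd (T U : topologicalType) (x : U) : continuous (fun t : T => (t, x)).
Proof. by move=> t; exact: (cvg_pair cvg_id (cvg_cst x)). Qed.

Section test_functions.
Context {R : realType} {d : nat} (phi : R * Rd R d -> R).
Hypothesis tphi : test_function phi.
Local Notation D := ('D_((1 : R), (0 : Rd R d)) phi).
Local Notation supp := (closure [set p | phi p != 0]).

Lemma test_continuous : continuous phi.
Proof. by have [Ck _ _] := tphi; exact: Ck_on_continuous (Ck 0%N). Qed.

Lemma test_derive_continuous : continuous D.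
Proof.
have [Ck _ _] := tphi.
exact: Ck_on_continuous (Ck_on_derive _ (Ck 1%N)).
Qed.

Lemma slice_continuous (f : R * Rd R d -> R) t : continuous f -> continuous (fun x => f (t, x)).
Proof.
move=> cf x; apply: (@continuous_comp _ _ _ (fun x : Rd R d => (t, x)) f); last exact: cf.
exact: (@continuous_pair_fst R (Rd R d) t x).
Qed.

Lemma slice_continuous_time (f : R * Rd R d -> R) x : continuous f -> continuous (fun t => f (t, x)).
Proof.
move=> cf t; apply: (@continuous_comp _ _ _ (fun t : R => (t, x)) f); last exact: cf.
exact: (@continuous_pair_snd R (Rd R d) x t).
Qed.

Lemma test_is_derive t x : is_derive t (1 : R) (fun s => phi (s, x)) (D (t, x)).
Proof.
have [Ck _ _] := tphi.
have dp : derivable phi (t, x) ((1 : R), (0 : Rd R d)) := Ck_on_derivable (Ck 1%N).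
have E : (fun h : R => h^-1 *: (phi (h *: (1 : R) + t, x) - phi (t, x))) =
    (fun h => h^-1 *: (phi (h *: ((1 : R), (0 : Rd R d)) + (t, x)) - phi (t, x))).
  apply/funext => h; congr (_ *: (phi _ - _)).
  by rewrite [RHS]surjective_pairing/= scaler0 add0r.
by apply: DeriveDef; [rewrite /derivable E|rewrite /derive E].
Qed.

Lemma test_support p : phi p != 0 -> supp p.
Proof. by move=> p0; exact: subset_closure. Qed.

Lemma test_derive_support p : D p != 0 -> supp p.
Proof.
apply: contraNP => np; apply/eqP; case: p np => t x np.
have H : \forall s \near t, cst (0 : R) s = phi (s, x).
  have oS : open ((fun s : R => (s, x)) @^-1` (~` supp)).
    apply: open_comp => [s _|]; first exact: (@continuous_pair_snd R (Rd R d) x s).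
    by apply: closed_openC; exact: closed_closure.
  have Hn : nbhs t ((fun s : R => (s, x)) @^-1` (~` supp)) by apply: open_nbhs_nbhs; split.
  apply: filterS Hn => s ns; apply/esym/eqP.
  by apply: contra_notT ns; exact: test_support.
have := near_eq_is_derive H (is_derive_cst (0 : R) t (1 : R)) => d0.
by rewrite -(@derive_val _ _ _ _ _ _ _ (test_is_derive t x)) derive_val.
Qed.

Lemma compact_support_bounded (f : R * Rd R d -> R) : continuous f ->
  (forall p, f p != 0 -> supp p) -> exists M, forall p, `|f p| <= M.
Proof.
move=> cf fs; have [_ cS _] := tphi.
have [S0|/set0P S0] := eqVneq supp set0.
  exists 0 => p; have [->|/fs] := eqVneq (f p) 0; first by rewrite normr0.
  by rewrite S0.
have [|q _ qP] := @compact_EVT_max _ R (fun p => `|f p|) _ S0 cS.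
  apply: continuous_subspaceT => p.
  by apply: (@continuous_comp _ _ _ f (fun y => `|y|)); [exact: cf|exact: norm_continuous].
exists `|f q| => p; have [->|/fs Sp] := eqVneq (f p) 0; first by rewrite normr0.
by apply: qP; exact: mem_set.
Qed.

Lemma test_bounded : exists M, forall p, `|phi p| <= M.
Proof. exact: compact_support_bounded test_continuous test_support. Qed.

Lemma test_derive_bounded : exists M, forall p, `|D p| <= M.
Proof. exact: compact_support_bounded test_derive_continuous test_derive_support. Qed.

(** The reason why each test function sees finitely many levels: it vanishes for times near 0. *)
Lemma support_time_lower_bound : exists2 e, 0 < e & forall p, supp p -> e <= p.1.
Proof.
have [_ cS S01] := tphi.
have [S0|/set0P S0] := eqVneq supp set0; first by exists 1 => // p; rewrite S0.
have [|q /set_mem Sq qP] := @compact_EVT_min _ R (fun p => p.1) _ S0 cS.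
  by apply: continuous_subspaceT => p; exact: cvg_fst.
exists q.1; first by have /andP[] := S01 _ Sq.
by move=> p Sp; apply: qP; exact: mem_set.
Qed.

Lemma test_ge1 t x : 1 <= t -> phi (t, x) = 0.
Proof.
move=> t1; apply/eqP; apply/negPn/negP => /test_support; have [_ _ S01] := tphi.
by move=> /S01 /= /andP[_]; rewrite ltNge t1.
Qed.

Lemma test_le0 t x : t <= 0 -> phi (t, x) = 0.
Proof.
move=> t1; apply/eqP; apply/negPn/negP => /test_support; have [_ _ S01] := tphi.
by move=> /S01 /= /andP[+ _]; rewrite ltNge t1.
Qed.

End test_functions.

Section level_mean_derive.
Context {R : realType} {d : nat} (phi : R * Rd R d -> R).
Hypothesis tphi : test_function phi.
Variables (beta : {measure set (Rd R d) -> \bar R}) (g : nat -> Rd R d -> R).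
Hypotheses (mg : forall k, measurable_fun setT (g k)) (g0 : forall k x, (0 <= g k x)%R).
Hypothesis g1 : forall k, (\int[beta]_x (g k x)%:E = 1)%E.
Local Notation D := ('D_((1 : R), (0 : Rd R d)) phi).

Lemma level_mean_continuous k (f : R * Rd R d -> R) M : continuous f ->
  (forall p, `|f p| <= M) -> continuous (fun t => level_mean beta g k (fun x => f (t, x))).
Proof.
move=> cf fM t; have mf s := continuous_measurable_Rd (slice_continuous (t := s) cf).
apply: (@continuity_under_integral R _ _ beta (fun t x => f (t, x) * g k x) setT measurableT
  (t - 1) (t + 1) _ _ (fun x => M * g k x)).
- by move=> s _; exact: (integrable_level_mean mg g0 g1 (mf s) (fun x => fM (s, x)) k).
- apply: nearW => x _ s _; apply: cvgM; last exact: cvg_cst.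
  exact: slice_continuous_time.
- rewrite (_ : EFin \o _ = fun x => (M%:E * (g k x)%:E)%E)//.
  by apply: integrableZl => //; exact: integrable_g.
- by move=> s _; apply: nearW => x _; rewrite normrM (ger0_norm (g0 k x)) ler_wpM2r.
- by rewrite inE/= in_itv/= ltrBlDr !ltrDl ltr01.
Qed.

(** Differentiation under the integral sign, dominated by a bound of the time derivative times
    [g k]. *)
Lemma level_mean_is_derive k t :
  is_derive t (1 : R) (fun t => level_mean beta g k (fun x => phi (t, x)))
    (level_mean beta g k (fun x => D (t, x))).
Proof.
have [M phiM] := test_bounded tphi; have [M' DM] := test_derive_bounded tphi.
have mf s := continuous_measurable_Rd (slice_continuous (t := s) (test_continuous tphi)).
have dE s x : is_derive s (1 : R) (fun s => phi (s, x) * g k x) (D (s, x) * g k x).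
  rewrite (_ : D (s, x) * g k x = phi (s, x) *: 0 + cst (g k x) s *: D (s, x)); last first.
    by rewrite scaler0 add0r mulrC.
  exact: (is_deriveM (test_is_derive tphi s x) (is_derive_cst (g k x) s (1 : R))).
pose F := fun t x => phi (t, x) * g k x.
have F1 s x : partial1of2 F s x = D (s, x) * g k x.
  by rewrite partial1of2E; apply: derive_val.
have tt : `]t - 1, t + 1[%classic t by rewrite /= in_itv/= ltrBlDr !ltrDl ltr01.
have iF s : `]t - 1, t + 1[%classic s -> beta.-integrable setT (EFin \o F s).
  by move=> _; exact: (integrable_level_mean mg g0 g1 (mf s) (fun x => phiM (s, x)) k).
have dF s x : `]t - 1, t + 1[%classic s -> setT x -> derivable (F ^~ x) s 1.
  by move=> _ _; have [] := dE s x.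
have M0 : 0 <= M' := le_trans (normr_ge0 _) (DM (0, 0)).
have iG : beta.-integrable setT (EFin \o (fun x => M' * g k x)).
  rewrite (_ : EFin \o _ = fun x => (M'%:E * (g k x)%:E)%E)//.
  by apply: integrableZl => //; exact: integrable_g.
have FG s x : `]t - 1, t + 1[%classic s -> setT x -> `|partial1of2 F s x| <= M' * g k x.
  by move=> _ _; rewrite F1 normrM (ger0_norm (g0 k x)) ler_wpM2r.
have G0 x : 0 <= M' * g k x by rewrite mulr_ge0.
have dI := derivable_under_integral measurableT tt iF dF G0 iG FG.
have DI := differentiation_under_integral measurableT tt iF dF G0 iG FG.
apply: DeriveDef; first exact: dI.
rewrite -derive1E DI; apply: eq_Rintegral => x _; exact: F1.
Qed.

End level_mean_derive.


Local Opaque flow.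

(** * The continuity equation for mixtures *)

Section chain_continuity.
Context {R : realType} {d : nat} (eta : R -> R).
Local Notation RR := (Rd R d * Rd R d)%type.
Local Notation G := (@Gset R d eta).
Hypothesis keta : weight_kernel d eta.
Variables (beta : {measure set (Rd R d) -> \bar R}) (g : nat -> Rd R d -> R).
Hypotheses (mg : forall k, measurable_fun setT (g k)) (g0 : forall k x, (0 <= g k x)%R).
Hypothesis g1 : forall k, (\int[beta]_x (g k x)%:E = 1)%E.
Variables (b2 : {measure set RR -> \bar R}) (p : nat -> RR -> R).
Hypotheses (mp : forall k, measurable_fun setT (p k)) (p0 : forall k z, 0 <= p k z).
Hypothesis p_fin : forall k, (\int[b2]_z (p k z)%:E < +oo)%E.
Hypothesis p_G : forall k z, ~ G z -> p k z = 0.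
(** Satisfied by any coupling of level k + 1, in the first variable, with level k, in the second;
    the diagonal does not contribute. *)
Hypothesis balance : forall k (f : Rd R d -> R) (M : R), continuous f -> (forall x, `|f x| <= M) ->
  (\int[b2]_z ((f z.2 - f z.1) * p k z)%:E =
   (level_mean beta g k f - level_mean beta g k.+1 f)%:E)%E.
Variable phi : R * Rd R d -> R.
Hypothesis tphi : test_function phi.
Local Notation D := ('D_((1 : R), (0 : Rd R d)) phi).
Local Notation pf := (pair_profile eta).
Local Notation mu := (curve beta mg g0).
Local Notation fluxes := (flux_curve keta mp p0 p_fin p_G).
Local Notation lambda := (@lebesgue_measure R).

Lemma level_mean0 k (f : Rd R d -> R) : (forall x, f x = 0) -> level_mean beta g k f = 0.
Proof.
move=> f0; rewrite /level_mean /Rintegral integral0_eq// => x _.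
by rewrite f0 mul0r.
Qed.

Lemma test_levels : exists N, forall t,
  (forall x, phi (t, x) = 0 /\ D (t, x) = 0) \/ (0 < t /\ 1 <= 2 ^+ N * t).
Proof.
have [e e0 eP] := support_time_lower_bound tphi; exists (levels e) => t.
have [te|et] := ltP t e; [left => x|right].
  split; apply/eqP; apply/negPn/negP.
    by move=> /test_support /eP /=; rewrite leNgt te.
  by move=> /(test_derive_support tphi) /eP /=; rewrite leNgt te.
split; first exact: lt_le_trans et.
by apply: le_trans (levelsP e0) _; rewrite ler_wpM2l ?exprn_ge0.
Qed.

Lemma integrable_diff_flux (f : Rd R d -> R) M k : measurable_fun setT f ->
  (forall x, `|f x| <= M) -> b2.-integrable setT (EFin \o (fun z : RR => (f z.2 - f z.1) * p k z)).
Proof.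
move=> mf fM; apply: (@integrable_bounded_mul _ _ _ b2 (p k) _ (fun z => f z.2 - f z.1) (M + M)).
- exact: integrable_p.
- apply: measurable_funB; [exact: measurableT_comp mf measurable_snd|].
  exact: measurableT_comp mf measurable_fst.
- by move=> z; apply: (le_trans (ler_normB _ _)); apply: lerD.
Qed.

Lemma nlgrad_flux N t z : (0 < t /\ 1 <= 2 ^+ N * t) -> G z ->
  nlgrad eta phi t z * flux_density eta p t z =
  \sum_(k < N) flow k t * (2 * ((phi (t, z.2) - phi (t, z.1)) * p k z)).
Proof.
move=> [t0 Nt] Gz; rewrite /flux_density pospart_id ?(ltW t0)//.
rewrite (sum_flow_levels (fun k => 2 * p k z / pf z) t0 Nt) mulr_sumr.
apply: eq_bigr => k _; rewrite /nlgrad Gset_kernelE// -/(pf z).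
have : pf z != 0 by rewrite gt_eqF// pair_profile_gt0.
by move: (pf z) => y y0; field.
Qed.

Lemma integral_G (F : RR -> \bar R) : (forall z, ~ G z -> F z = 0%E) ->
  (\int[b2]_(z in G) F z = \int[b2]_z F z)%E.
Proof.
move=> FG; rewrite integral_mkcond; apply: eq_integral => z _.
by rewrite patchE; case: ifPn => // /negP Gz; rewrite FG// => Gz'; apply: Gz; rewrite inE.
Qed.

Lemma measurable_nlgrad t : measurable_fun G (nlgrad eta phi t).
Proof.
have mf := continuous_measurable_Rd (slice_continuous (t := t) (test_continuous tphi)).
apply: measurable_funM; last exact: measurable_weight keta.
apply: measurable_funTS; apply: measurable_funB.
  exact: measurableT_comp mf measurable_snd.
exact: measurableT_comp mf measurable_fst.
Qed.

Lemma integral_nlgrad_flux N t : 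
  (forall x, phi (t, x) = 0 /\ D (t, x) = 0) \/ (0 < t /\ 1 <= 2 ^+ N * t) ->
  (\int[mpos (fluxes t)]_(z in G) (nlgrad eta phi t z)%:E =
   (2 * \sum_(k < N) flow k t * (level_mean beta g k (fun x => phi (t, x)) -
      level_mean beta g k.+1 (fun x => phi (t, x))))%:E)%E.
Proof.
have [M phiM] := test_bounded tphi.
have cf := slice_continuous (t := t) (test_continuous tphi).
have mf := continuous_measurable_Rd cf.
move=> [phi0|tN].
  rewrite integral0_eq; last first.
    move=> z _; have [z1 _] := phi0 z.1; have [z2 _] := phi0 z.2.
    by rewrite /nlgrad z1 z2 subrr mul0r.
  have f0 x : phi (t, x) = 0 by have [] := phi0 x.
  by rewrite big1 ?mulr0// => k _; rewrite !(level_mean0 _ f0) subrr mulr0.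
rewrite integral_flux_curve//; last by apply/measurable_EFinP; exact: measurable_nlgrad.
under eq_integral.
  move=> z /set_mem Gz; rewrite -EFinM (nlgrad_flux tN Gz) -sumEFin.
  under eq_bigr do rewrite mulrA EFinM.
  over.
rewrite integral_G; last first.
  by move=> z Gz; apply: big1 => k _; rewrite p_G// mulr0 mule0.
have ik k := integrable_diff_flux k mf (fun x => phiM (t, x)).
rewrite integral_sum//; last by move=> k; apply: integrableZl => //; exact: ik.
rewrite mulr_sumr -sumEFin; apply: eq_bigr => k _.
rewrite integralZl//; last exact: ik.
by rewrite (balance k cf (fun x => phiM (t, x))) -EFinM mulrCA mulrA.
Qed.

Lemma integral_abs_nlgrad_flux N M t : (forall p, `|phi p| <= M) -> 0 <= t ->
  (forall x, phi (t, x) = 0 /\ D (t, x) = 0) \/ (0 < t /\ 1 <= 2 ^+ N * t) ->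
  (\int[mpos (fluxes t)]_(z in G) `|nlgrad eta phi t z|%:E <=
   (\sum_(k < N) flow k t * (2 * (M + M) * fine (\int[b2]_z (p k z)%:E)))%:E)%E.
Proof.
move=> phiM t0; have M0 : 0 <= M := le_trans (normr_ge0 _) (phiM (0, 0)).
have ip k : (\int[b2]_z (p k z)%:E = (fine (\int[b2]_z (p k z)%:E))%:E)%E.
  by rewrite fineK// ge0_fin_numE// integral_ge0// => z _; rewrite lee_fin.
have ip0 k : 0 <= fine (\int[b2]_z (p k z)%:E).
  by rewrite -lee_fin -ip integral_ge0// => z _; rewrite lee_fin.
move=> [phi0|tN].
  rewrite integral0_eq; last first.
    move=> z _; have [z1 _] := phi0 z.1; have [z2 _] := phi0 z.2.
    by rewrite /nlgrad z1 z2 subrr mul0r normr0.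
  rewrite lee_fin; apply: sumr_ge0 => k _.
  by rewrite mulr_ge0 ?flow_ge0 ?mulr_ge0 ?addr_ge0.
have cc k : 0 <= flow k t * (2 * (M + M)).
  by apply: mulr_ge0; [exact: flow_ge0|rewrite mulr_ge0// addr_ge0].
rewrite integral_flux_curve//; last first.
  by apply/measurable_EFinP; apply: measurableT_comp => //; exact: measurable_nlgrad.
apply: (@le_trans _ _ (\int[b2]_z (\sum_(k < N) ((flow k t * (2 * (M + M)))%:E * (p k z)%:E))))%E.
  rewrite -[leRHS]integral_G; last first.
    by move=> z Gz; apply: big1 => k _; rewrite p_G// mule0.
  apply: ge0_le_integral_nonmeas => z Gz.
    by rewrite mule_ge0// lee_fin// flux_density_ge0.
  rewrite -EFinM -[X in _ * X]ger0_norm ?flux_density_ge0// -normrM (nlgrad_flux tN Gz).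
  under [leRHS]eq_bigr do rewrite -EFinM.
  rewrite sumEFin lee_fin; apply: (le_trans (ler_norm_sum _ _ _)); apply: ler_sum => k _.
  rewrite normrM (ger0_norm (flow_ge0 _ t0)) normrM (ger0_norm (ler0n _ 2)) normrM.
  rewrite (ger0_norm (p0 _ _)) !mulrA.
  have F0 : 0 <= flow k t * 2 by apply: mulr_ge0 => //; exact: flow_ge0.
  apply: ler_wpM2r => //; apply: ler_wpM2l => //.
  by apply: (le_trans (ler_normB _ _)); apply: lerD.
rewrite ge0_integral_sum//; last 2 first.
- by move=> k; apply: measurable_funeM; exact/measurable_EFinP.
- by move=> k z _; rewrite mule_ge0// lee_fin.
rewrite -sumEFin; apply: lee_sum => k _.
rewrite ge0_integralZl_EFin//; last 2 first.
- by move=> z _; rewrite lee_fin.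
- exact/measurable_EFinP.
by rewrite [X in (_ * X <= _)%E]ip -EFinM lee_fin -[leLHS]mulrA.
Qed.

Lemma chain_flux_converges : flux_converges fluxes phi.
Proof.
have [M phiM] := test_bounded tphi; have [N NP] := test_levels.
rewrite /flux_converges.
pose c := fun t => \sum_(k < N) flow k t * (2 * (M + M) * fine (\int[b2]_z (p k z)%:E)).
apply: (@le_lt_trans _ _ (\int[lambda]_(t in `[0%R, 1%R]) (c t)%:E)%E).
  apply: ge0_le_integral_nonmeas => t /=; rewrite in_itv/= => /andP[t0 _].
    by apply: adde_ge0; apply: integral_ge0 => z _; rewrite lee_fin.
  rewrite integral_measure_zero adde0.
  exact: integral_abs_nlgrad_flux (NP t).
have : lambda.-integrable `[0, 1] (EFin \o c).
  apply: within_continuous_integrable; apply: continuous_subspaceT.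
  have := @continuous_sum R R _ (index_enum 'I_N)
    (fun k t => flow k t * (2 * (M + M) * fine (\int[b2]_z (p k z)%:E))).
  by apply => k t; apply: cvgM; [exact: flow_continuous|exact: cvg_cst].
move=> ic; rewrite ltey_eq; apply/orP; left.
by apply: integrable_fin_num; [exact: measurable_itv|exact: ic].
Qed.

(** [S] is the integral of [phi] against the curve. Summation by parts turns its derivative into A +
    B, the two integrands of the equation, and it vanishes at both ends. *)
Lemma chain_continuity_identity :
  (\int[lambda]_(t in `[0%R, 1%R])
     \int[mu t]_x ((fun s => phi (s, x))^`()%classic t)%:E +
   2^-1%:E * \int[lambda]_(t in `[0%R, 1%R])
     (\int[mpos (fluxes t)]_(z in G) (nlgrad eta phi t z)%:E -
      \int[mneg (fluxes t)]_(z in G) (nlgrad eta phi t z)%:E) = 0)%E.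
Proof.
have [M phiM] := test_bounded tphi; have [M' DM] := test_derive_bounded tphi.
have [N NP] := test_levels.
pose L k t := level_mean beta g k (fun x => phi (t, x)).
pose DL k t := level_mean beta g k (fun x => D (t, x)).
have dL k t : is_derive t (1 : R) (L k) (DL k t) := level_mean_is_derive tphi mg g0 g1 k t.
have cL k : continuous (L k)  by exact: (level_mean_continuous mg g0 g1 (test_continuous tphi) phiM).
have cDL k : continuous (DL k).
  exact: (level_mean_continuous mg g0 g1 (test_derive_continuous tphi) DM).
pose A t := \sum_(k < N.+1) weight k t * DL k t.
pose B t := \sum_(k < N) flow k t * (L k t - L k.+1 t).
pose S t := \sum_(k < N.+1) weight k t * L k t.
have mD t := continuous_measurable_Rd (slice_continuous (t := t) (test_derive_continuous tphi)).
have cA : continuous A.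
  have := @continuous_sum R R _ (index_enum 'I_N.+1) (fun k t => weight k t * DL k t).
  by apply => k t; apply: cvgM; [exact: weight_continuous|exact: cDL].
have cB : continuous B.
  have := @continuous_sum R R _ (index_enum 'I_N) (fun k t => flow k t * (L k t - L k.+1 t)).
  apply => k t; apply: cvgM; first exact: flow_continuous.
  by apply: cvgB; exact: cL.
have EA t : `[0%R, 1%R]%classic t ->
    (\int[mu t]_x ((fun s => phi (s, x))^`()%classic t)%:E = (A t)%:E)%E.
  move=> _; have -> : (fun x => ((fun s => phi (s, x))^`()%classic t)%:E) = fun x => (D (t, x))%:E.
    by apply/funext => x; rewrite derive1E (@derive_val _ _ _ _ _ _ _ (test_is_derive tphi t x)).
  have [phi0|[t0 tN]] := NP t; last by rewrite (integral_curve_sum mg g0 g1 (mD t) (fun x => DM (t, x)) t0 tN).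
  rewrite integral0_eq; last by move=> x _; have [_ ->] := phi0 x.
  have f0 x : D (t, x) = 0 by have [] := phi0 x.
  by rewrite /A big1// => k _; rewrite /DL (level_mean0 _ f0) mulr0.
have EB t : `[0%R, 1%R]%classic t ->
    (\int[mpos (fluxes t)]_(z in G) (nlgrad eta phi t z)%:E -
      \int[mneg (fluxes t)]_(z in G) (nlgrad eta phi t z)%:E = (2 * B t)%:E)%E.
  by move=> _; rewrite integral_measure_zero sube0; exact: integral_nlgrad_flux (NP t).
have iA : lambda.-integrable `[0, 1] (EFin \o A).
  by apply: within_continuous_integrable; exact: continuous_subspaceT.
have iB : lambda.-integrable `[0, 1] (EFin \o B).
  by apply: within_continuous_integrable; exact: continuous_subspaceT.
have EA' : (\int[lambda]_(t in `[0%R, 1%R])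
    \int[mu t]_x ((fun s => phi (s, x))^`()%classic t)%:E =
    \int[lambda]_(t in `[0%R, 1%R]) (A t)%:E)%E.
  by apply: eq_integral => t /set_mem; exact: EA.
have EB' : (\int[lambda]_(t in `[0%R, 1%R])
     (\int[mpos (fluxes t)]_(z in G) (nlgrad eta phi t z)%:E -
      \int[mneg (fluxes t)]_(z in G) (nlgrad eta phi t z)%:E) =
    \int[lambda]_(t in `[0%R, 1%R]) (2%:E * (B t)%:E))%E.
  by apply: eq_integral => t /set_mem t01; rewrite EB// EFinM.
rewrite EA' EB' {EA' EB'}.
rewrite integralZl// muleA -EFinM mulVf ?pnatr_eq0// mul1e -integralD//.
have dS t : is_derive t (1 : R) S (\sum_(k < N.+1) (weight k t * DL k t + dweight k t * L k t)).
  rewrite /S; have -> : (fun t => \sum_(k < N.+1) weight k t * L k t) =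
    \sum_(k < N.+1) (fun t => weight k t * L k t) by apply/funext => s; rewrite fct_sumE.
  apply: is_derive_sum => k; rewrite [dweight k t * _]mulrC.
  exact: (is_deriveM (is_derive_weight k t) (dL k t)).
have DS t : 0 <= t -> S^`()%classic t = A t + B t.
  move=> t0; rewrite derive1E (@derive_val _ _ _ _ _ _ _ (dS t)) big_split/=; congr (_ + _).
  (* The boundary term of the summation by parts: either level [N] has stopped flowing or the test
     function vanishes. *)
  have e0 : flow N t * L N t = 0.
    have [phi0|[t0' tN]] := NP t; last by rewrite flow_eq0// mul0r.
    have f0 x : phi (t, x) = 0 by have [] := phi0 x.
    by rewrite /L (level_mean0 _ f0) mulr0.
  rewrite big_ord_recl/= /B; under [RHS]eq_bigr do rewrite mulrBr.
  rewrite sumrB; under eq_bigr do rewrite /bump/= ?add1n mulrBl.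
  rewrite sumrB addrA; congr (_ - _).
  rewrite -[RHS]addr0 -[X in _ = _ + X]e0.
  by rewrite -(big_ord_recr N (fun k => flow k t * L k t)) big_ord_recl.
have cS : continuous S.
  have := @continuous_sum R R _ (index_enum 'I_N.+1) (fun k t => weight k t * L k t).
  by apply => k t; apply: cvgM; [exact: weight_continuous|exact: cL].
have L0 k t : (forall x, phi (t, x) = 0) -> L k t = 0 by exact: level_mean0.
rewrite (_ : (\int[lambda]_(t in _) _)%E =
    (\int[lambda]_(t in `[0%R, 1%R]) (A t + B t)%:E)%E); last first.
  by apply: eq_integral => t _; rewrite EFinD.
rewrite (@continuous_FTC2 _ _ S)//.
- rewrite /S !big1 ?sube0// => k _; rewrite L0 ?mulr0// => x.
    exact: test_le0.
  exact: test_ge1.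
- by apply: continuous_subspaceT => t; apply: cvgD; [exact: cA|exact: cB].
- split; [|exact: cvg_at_right_filter (cS _)|exact: cvg_at_left_filter (cS _)].
  by move=> t _; have [] := dS t.
- by move=> t; rewrite in_itv/= => /andP[t0 _]; rewrite DS// ltW.
Qed.

End chain_continuity.


Section product_density.
Local Open Scope ereal_scope.
Context d1 d2 (T1 : measurableType d1) (T2 : measurableType d2) (R : realType).
Variables (b1 : {sigma_finite_measure set T1 -> \bar R})
  (b2 : {sigma_finite_measure set T2 -> \bar R}).
Variables (m1 : {measure set T1 -> \bar R}) (m2 : {sigma_finite_measure set T2 -> \bar R}).
Variables (f1 : T1 -> R) (f2 : T2 -> R).
Hypotheses (mf1 : measurable_fun setT f1) (mf2 : measurable_fun setT f2).
Hypotheses (f10 : forall x, (0 <= f1 x)%R) (f20 : forall x, (0 <= f2 x)%R).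
Hypothesis m1E : forall A, measurable A -> m1 A = \int[b1]_(x in A) (f1 x)%:E.
Hypothesis m2E : forall A, measurable A -> m2 A = \int[b2]_(x in A) (f2 x)%:E.

Lemma product_density A : measurable A ->
  (m1 \x m2) A = \int[b1 \x b2]_(z in A) (f1 z.1 * f2 z.2)%:E.
Proof.
move=> mA; rewrite [LHS]/product_measure1.
rewrite [LHS](@ge0_integral_density _ _ _ m1 b1 setT measurableT f1)//; last 2 first.
- by move=> B mB _; exact: m1E.
- exact: measurable_fun_xsection.
have mF : measurable_fun setT ((fun z : T1 * T2 => (f1 z.1 * f2 z.2)%:E) \_ A).
  apply/(measurable_restrictT _ mA)/measurable_EFinP.
  apply: measurable_funTS; apply: measurable_funM.
    exact: measurableT_comp mf1 measurable_fst.
  exact: measurableT_comp mf2 measurable_snd.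
have F0 z : 0 <= ((fun z : T1 * T2 => (f1 z.1 * f2 z.2)%:E) \_ A) z.
  by rewrite patchE; case: ifPn => // _; rewrite lee_fin mulr_ge0.
rewrite [RHS]integral_mkcond; apply: etrans (esym (fubini_tonelli1 _ mF F0)).
apply: eq_integral => x _; rewrite /fubini_F.
rewrite /= m2E; last exact: measurable_xsection.
rewrite muleC -ge0_integralZl_EFin//; last 3 first.
- exact: measurable_xsection.
- by move=> y _; rewrite lee_fin.
- by apply/measurable_EFinP; exact: measurable_funTS.
rewrite integral_mkcond; apply: eq_integral => y _.
by rewrite !patchE/= mem_xsection; case: ifPn.
Qed.

End product_density.

Lemma integral_weighted_sum_le disp (T : measurableType disp) (R : realType)
    (m : {measure set T -> \bar R}) (G : set T) (F : nat -> T -> R) (c S : nat -> R) n :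
  measurable G -> (forall k, measurable_fun G (F k)) ->
  (forall k z, G z -> 0 <= F k z) -> (forall k, 0 <= c k) ->
  (forall k, \int[m]_(z in G) (F k z)%:E <= (S k)%:E)%E ->
  (\int[m]_(z in G) (\sum_(k < n) (c k)%:E * (F k z)%:E) <= (\sum_(k < n) c k * S k)%:E)%E.
Proof.
move=> mG mF F0 c0 FS; rewrite ge0_integral_sum//; last 2 first.
- by move=> k; apply: measurable_funeM; exact/measurable_EFinP.
- by move=> k z Gz; rewrite mule_ge0 ?lee_fin ?F0.
rewrite -sumEFin; apply: lee_sum => k _.
rewrite ge0_integralZl_EFin//; last 2 first.
- by move=> z Gz; rewrite lee_fin F0.
- exact/measurable_EFinP.
by rewrite [leRHS]EFinM lee_wpmul2l ?lee_fin.
Qed.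

Lemma div0_ge0 (R : realType) (a b : R) : 0 <= a -> 0 <= b -> (0 <= div0 a b)%E.
Proof.
move=> a0 b0; rewrite /div0; case: ifPn => _; first by case: ifPn.
by rewrite lee_fin divr_ge0.
Qed.

(** * The action of mixtures *)

Section chain_action.
Local Open Scope ereal_scope.
Context {R : realType} {d : nat} (eta : R -> R) (theta : R -> R -> R).
Local Notation RR := (Rd R d * Rd R d)%type.
Local Notation G := (@Gset R d eta).
Hypotheses (keta : weight_kernel d eta) (itheta : interpolation theta).
Variables (beta : {sigma_finite_measure set (Rd R d) -> \bar R}) (g : nat -> Rd R d -> R).
Hypothesis beta_fin : forall r, beta (cube 0%R r) < +oo.
Hypotheses (mg : forall k, measurable_fun setT (g k)) (g0 : forall k x, (0 <= g k x)%R).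
Hypothesis g1 : forall k, \int[beta]_x (g k x)%:E = 1.
Local Notation b2 := (beta \x beta).
Variable gL : Rd R d -> R.
Hypotheses (mgL : measurable_fun setT gL) (gL0 : forall x, (0 <= gL x)%R).
Hypothesis lebE : forall A, measurable A -> leb d A = \int[beta]_(x in A) (gL x)%:E.
Variables (p : nat -> RR -> R).
Hypotheses (mp : forall k, measurable_fun setT (p k)) (p0 : forall k z, (0 <= p k z)%R).
Hypothesis p_fin : forall k, \int[b2]_z (p k z)%:E < +oo.
Hypothesis p_G : forall k z, ~ G z -> p k z = 0%R.
Variables (s : nat -> RR -> R) (S : nat -> R).
Hypotheses (ms : forall k, measurable_fun setT (s k)) (s0 : forall k z, (0 <= s k z)%R).
(** [s k] is the cost density of the k-th transfer, measured with the mobility of the two adjacent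
    levels alone; homogeneity and monotonicity of [theta] bring in their weights. *)
Hypothesis p_sqr : forall k z, G z -> (p k z ^+ 2 <= s k z *
  theta ((g k z.1 + g k.+1 z.1) * gL z.2) (gL z.1 * (g k z.2 + g k.+1 z.2)))%R.
Local Notation pf := (pair_profile eta).
Hypothesis s_le : forall k, \int[b2]_(z in G) (s k z / pf z)%:E <= (S k)%:E.
Local Notation mu := (curve beta mg g0).
Local Notation fluxes := (flux_curve keta mp p0 p_fin p_G).

(* Cauchy-Schwarz with the weights 2^-(k+1), whose sum is at most 1. *)
Lemma sum_sqr_le (n : nat) (a : nat -> R) :
  ((\sum_(k < n) a k) ^+ 2 <= \sum_(k < n) 2 ^+ k.+1 * a k ^+ 2)%R.
Proof.
have recl (F : nat -> R) m : (\sum_(k < m.+1) F k = F 0%N + \sum_(k < m) F k.+1)%R.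
  by rewrite big_ord_recl.
elim: n a => [|n ih] a; first by rewrite !big_ord0 expr0n.
rewrite (recl a) (recl (fun k => 2 ^+ k.+1 * a k ^+ 2)%R) expr1.
apply: (@le_trans _ _ (2 * a 0%N ^+ 2 + 2 * (\sum_(i < n) a i.+1) ^+ 2)%R).
  set x := a 0%N; set y := (\sum_(i < n) _)%R; rewrite -subr_ge0.
  by rewrite (_ : _ - _ = (x - y) ^+ 2)%R ?sqr_ge0//; ring.
rewrite lerD2l; apply: (@le_trans _ _ (2 * \sum_(k < n) 2 ^+ k.+1 * a k.+1 ^+ 2)%R).
  by rewrite ler_wpM2l//; exact: (ih (fun k => a k.+1)).
by rewrite mulr_sumr; apply: ler_sum => k _; rewrite mulrA -exprS.
Qed.

(** With [m] the smaller of the two adjacent weights, the mixture dominates [m] times the sum of the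
    two levels, and 150 4^k m dominates the square of the flow. Homogeneity extracts [m] from
    [theta]. *)
Let pos_flux_sqr t k z : (0 < t)%R -> G z ->
  ((flow k t * p k z) ^+ 2 <= 150 * 4 ^+ k * s k z *
    theta (mixture g t z.1 * gL z.2) (gL z.1 * mixture g t z.2))%R.
Proof.
move=> t0 Gz; set m := Num.min (weight k t) (weight k.+1 t).
have t0' := ltW t0.
have w0 := weight_ge0 k t0'; have w1 := weight_ge0 k.+1 t0'.
have m0 : (0 <= m)%R by rewrite /m le_min w0 w1.
have F2 : (flow k t ^+ 2 <= 150 * 4 ^+ k * m)%R.
  by rewrite /m /Num.min; case: ifPn => _; [exact: flow_sqr_le_prev|exact: flow_sqr_le_next].
have hm x : (m * (g k x + g k.+1 x) <= mixture g t x)%R.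
  (* Enough terms for the mixture to be exact and for level k + 1 to appear among them. *)
  pose n := (k.+1 + levels t)%N.
  have nt : (1 <= 2 ^+ n * t)%R.
    by apply: le_trans (levelsP t0) _; apply: pow2_mono => //; exact: leq_addl.
  rewrite (mixtureE _ _ t0 nt).
  have kn : (k < n.+1)%N by rewrite /n ltnS (leq_trans (leqnSn k))// leq_addr.
  have k1n : (k.+1 < n.+1)%N by rewrite ltnS leq_addr.
  rewrite (bigD1 (Ordinal kn))//= (bigD1 (Ordinal k1n))/=; last first.
    by rewrite -val_eqE/= gtn_eqF.
  rewrite mulrDr addrA; apply: (@le_trans _ _ (weight k t * g k x + weight k.+1 t * g k.+1 x)%R).
    by apply: lerD; apply: ler_wpM2r => //; rewrite /m ge_min lexx ?orbT.
  rewrite lerDl sumr_ge0// => i _.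
  by apply: mulr_ge0 => //; exact: weight_ge0.
have [m_eq0|m_neq0] := eqVneq m 0%R.
  have -> : flow k t = 0%R.
    by apply/eqP; rewrite -sqrf_eq0 eq_le sqr_ge0 andbT; apply: (le_trans F2); rewrite m_eq0 mulr0.
  rewrite mul0r expr0n/= !mulr_ge0 ?exprn_ge0//.
  by apply: (itp_ge0 itheta); rewrite mulr_ge0// mixture_ge0.
have mp0 : (0 < m)%R by rewrite lt_neqAle eq_sym m_neq0.
rewrite exprMn; apply: (@le_trans _ _ (150 * 4 ^+ k * m * (s k z *
  theta ((g k z.1 + g k.+1 z.1) * gL z.2) (gL z.1 * (g k z.2 + g k.+1 z.2))))%R).
  by apply: ler_pM; [exact: sqr_ge0|exact: sqr_ge0| |exact: p_sqr].
rewrite -!mulrA ler_wpM2l// ler_wpM2l ?exprn_ge0// mulrCA ler_wpM2l//.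
have gg x : (0 <= g k x + g k.+1 x)%R by rewrite addr_ge0.
rewrite -(itp_homogeneous itheta) ?mulr_ge0//.
apply: itp_mono2 => //; rewrite ?mulr_ge0//.
- by rewrite mulrA ler_wpM2r.
- by rewrite mulrCA ler_wpM2l.
Qed.

(** The constant is 1200 = 4 (2) (150): the square of the 2 in the flux, the 2 in the weights
    2^(k+1) of Cauchy-Schwarz, and the bound on the flow. *)
Lemma flux_density_sqr_le t z : (0 < t)%R -> G z ->
  (flux_density eta p t z ^+ 2 <= (\sum_(k < levels t) 1200 * 8 ^+ k * s k z) / pf z ^+ 2 *
    theta (mixture g t z.1 * gL z.2) (gL z.1 * mixture g t z.2))%R.
Proof.
move=> t0 Gz; have pz : (0 < pf z)%R := pair_profile_gt0 Gz.
have -> : flux_density eta p t z = (2 / pf z * \sum_(k < levels t) flow k t * p k z)%R.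
  rewrite /flux_density pospart_id ?(ltW t0)// mulr_sumr; apply: eq_bigr => k _.
  by rewrite [RHS]mulrCA; congr (_ * _)%R; rewrite mulrAC.
rewrite exprMn; set th := theta _ _.
apply: (@le_trans _ _ ((2 / pf z) ^+ 2 * \sum_(k < levels t) 2 ^+ k.+1 * (150 * 4 ^+ k * s k z * th))%R).
  apply: ler_wpM2l; first exact: sqr_ge0.
  apply: (le_trans (sum_sqr_le _ (fun k => flow k t * p k z)%R)).
  by apply: ler_sum => k _; apply: ler_wpM2l; [exact: exprn_ge0|exact: pos_flux_sqr].
rewrite expr_div_n mulr_sumr -[leRHS]mulrA mulr_suml; apply: ler_sum => k _.
have -> : (8 ^+ k = 2 ^+ k * 4 ^+ k :> R)%R by rewrite -exprMn -natrM.
rewrite [(2 ^+ k.+1)%R]exprS; set c := (pf z ^+ 2)^-1%R.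
by rewrite le_eqVlt; apply/orP; left; apply/eqP; ring.
Qed.

(** The reference measure used to bound the infimum in [action]: the densities of the flux and of
    both product measures are explicit with respect to it. *)
Let l : {measure set RR -> \bar R} := mrestr b2 (measurable_Gset keta).

Let l_int A (F : RR -> \bar R) : A `<=` G -> measurable A ->
  \int[l]_(z in A) F z = \int[b2]_(z in A) F z.
Proof.
move=> AG mA; apply: eq_measure_integral => B mB BA.
by rewrite /l /= /mrestr setIidl//; exact: subset_trans AG.
Qed.

Let l_locally_finite : locally_finite_on G l.
Proof.
split; first by rewrite /l/= /mrestr setICl measure0.
move=> K cK KG; rewrite /l/= /mrestr setIidl//.
have mK := compact_measurable_RR cK.
have [K0|/set0P K0] := eqVneq K set0; first by rewrite K0 measure0.
have [|z0 _ z0P] := @compact_EVT_max _ R (fun z : RR => enorm z.1 + enorm z.2)%R K K0 cK.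
  apply: continuous_subspaceT => z; apply: cvgD.
    by apply: (@continuous_comp _ _ _ fst (@enorm R d)); [exact: cvg_fst|exact: enorm_continuous].
  by apply: (@continuous_comp _ _ _ snd (@enorm R d)); [exact: cvg_snd|exact: enorm_continuous].
set r := (enorm z0.1 + enorm z0.2)%R in z0P.
have Kr : K `<=` cube 0%R r `*` cube 0%R r.
  move=> z /mem_set /z0P zr.
  split => i; rewrite mxE subr0; apply: (le_trans (ler_coord_enorm _ _)); apply: le_trans zr.
    by rewrite lerDl enorm_ge0.
  by rewrite lerDr enorm_ge0.
apply: (@le_lt_trans _ _ (b2 (cube 0%R r `*` cube 0%R r))).
  by apply: le_measure => //; rewrite inE//; apply: measurableX; exact: measurable_cube.
rewrite product_measure1E//; try exact: measurable_cube.
by rewrite lte_mul_pinfty ?measure_ge0 ?ge0_fin_numE ?beta_fin.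
Qed.

Lemma action_curve_le (t : R) : (0 < t)%R ->
  action theta (mu t) (fluxes t) <= (600 * \sum_(k < levels t) 8 ^+ k * S k)%:E.
Proof.
move=> t0; have mG := measurable_Gset keta.
pose f := flux_density eta p t.
pose u z := (mixture g t z.1 * gL z.2)%R; pose v z := (gL z.1 * mixture g t z.2)%R.
have f0 z : (0 <= f z)%R := flux_density_ge0 keta p0 t z.
have mf : measurable_fun setT f := measurable_flux_density keta mp t.
have mh : measurable_fun setT (mixture g t) := measurable_mixture mg t.
have h0 x : (0 <= mixture g t x)%R := mixture_ge0 g0 t x.
have mu_ : measurable_fun setT u.
  apply: measurable_funM; [exact: measurableT_comp mh measurable_fst|].
  exact: measurableT_comp mgL measurable_snd.
have mv : measurable_fun setT v.
  apply: measurable_funM; [exact: measurableT_comp mgL measurable_fst|].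
  exact: measurableT_comp mh measurable_snd.
have u0 z : (0 <= u z)%R by apply: mulr_ge0.
have v0 z : (0 <= v z)%R by apply: mulr_ge0.
have fp : f^\+%R = f by apply/funext => z; rewrite /funrpos max_l.
have fn : f^\-%R = cst 0%R by apply/funext => z; rewrite /funrneg max_r// oppr_le0.
have Dp : is_density G l (mpos (fluxes t)) f.
  split; [exact: mf|exact: f0|move=> A mA AG].
  by apply: esym; exact: l_int.
have Dn : is_density G l (mneg (fluxes t)) (cst 0%R).
  split; [exact: measurable_cst|by move=> z; exact: lexx|move=> A mA AG].
  by apply: esym; exact: integral0.
have curveB B : measurable B -> mu t B = \int[beta]_(x in B) (mixture g t x)%:E.
  by move=> _; exact: (curveE mg g0 g1 B t0).
have Du : is_density G l (mu t \x leb d)%E u.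
  split; [exact: mu_|exact: u0|move=> A mA AG].
  apply: etrans (esym (l_int _ AG mA)).
  exact: (product_density mh mgL h0 gL0 curveB lebE mA).
have Dv : is_density G l (leb d \x mu t)%E v.
  split; [exact: mv|exact: v0|move=> A mA AG].
  apply: etrans (esym (l_int _ AG mA)).
  exact: (product_density mgL mh gL0 h0 lebE curveB mA).
have Df : is_signed_density l (fluxes t) f by split; [rewrite fp; exact: Dp|rewrite fn; exact: Dn].
apply: (@le_trans _ _ (2^-1%:E * \int[l]_(z in G)
    (div0 (f z ^+ 2) (theta (u z) (v z)) * (kernel eta z)%:E))).
  apply: ereal_inf_lbound; exists l, f, u, v.
  by split; [exact: l_locally_finite|exact: Df|exact: Du|exact: Dv|].
rewrite l_int//.
have S1 : \int[b2]_(z in G) (\sum_(k < levels t) ((1200 * 8 ^+ k)%:E * (s k z / pf z)%:E)) <=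
    (\sum_(k < levels t) 1200 * 8 ^+ k * S k)%:E.
  apply: (@integral_weighted_sum_le _ _ _ _ _ (fun k z => s k z / pf z)%R (fun k => 1200 * 8 ^+ k)%R S).
  - exact: mG.
  - move=> k; apply: measurable_funTS.
    rewrite (_ : (fun z => s k z / pf z)%R = (fun z => 2 * (s k z / 2) / pf z)%R).
      apply: (measurable_level_flux keta (p := fun k z => s k z / 2)%R).
      by move=> i; apply: measurable_funM.
    by apply/funext => z; rewrite [X in (_ = X / _)%R]mulrC divfK.
  - by move=> k z Gz; rewrite divr_ge0// ltW// pair_profile_gt0.
  - by move=> k; apply: mulr_ge0; [exact: ler0n|apply: exprn_ge0; exact: ler0n].
  - exact: s_le.
apply: (@le_trans _ _ (2^-1%:E * (\sum_(k < levels t) 1200 * 8 ^+ k * S k)%:E)); last first.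
  rewrite -EFinM lee_fin le_eqVlt; apply/orP; left; apply/eqP.
  by rewrite !mulr_sumr; apply: eq_bigr => k _; field.
apply: lee_wpmul2l; first by rewrite lee_fin.
apply: le_trans S1; apply: ge0_le_integral_nonmeas => z Gz.
  rewrite mule_ge0 ?lee_fin//; last by rewrite Gset_kernelE//; exact: pair_profile_ge0 keta z.
  by apply: div0_ge0; [exact: sqr_ge0|apply: (itp_ge0 itheta); rewrite mulr_ge0].
have -> : \sum_(k < levels t) ((1200 * 8 ^+ k)%:E * (s k z / pf z)%:E) =
    ((\sum_(k < levels t) 1200 * 8 ^+ k * s k z) / pf z)%:E.
  by rewrite mulr_suml -sumEFin; apply: eq_bigr => k _; rewrite -EFinM mulrA.
have := flux_density_sqr_le t0 Gz; rewrite -/f -/(u z) -/(v z) Gset_kernelE// -/(pf z).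
have th0 : (0 <= theta (u z) (v z))%R by apply: (itp_ge0 itheta); rewrite mulr_ge0.
have pz : (0 < pf z)%R := pair_profile_gt0 Gz.
set C := (\sum_(k < levels t) _)%R; move: th0 pz.
move: (theta _ _) (pf z) => th y th0 y0 fle; rewrite /div0.
have [th_eq0|th_neq0] := eqVneq th 0%R.
  have -> : (f z ^+ 2 == 0)%R by rewrite eq_le sqr_ge0 andbT (le_trans fle)// th_eq0 mulr0.
  rewrite mul0e lee_fin; apply: divr_ge0; last exact: ltW.
  apply: sumr_ge0 => k _.
  apply: mulr_ge0; last exact: s0.
  by apply: mulr_ge0; [exact: ler0n|apply: exprn_ge0; exact: ler0n].
have thp : (0 < th)%R by rewrite lt_neqAle eq_sym th_neq0.
rewrite -EFinM lee_fin ler_pdivlMr// -mulrA mulrAC ler_pdivrMr//.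
apply: (@le_trans _ _ (C / y ^+ 2 * th * (y * y))%R).
  by apply: ler_wpM2r; [rewrite mulr_ge0 ?ltW|exact: fle].
rewrite le_eqVlt; apply/orP; left; apply/eqP; field.
by rewrite gt_eqF.
Qed.

End chain_action.


Import HBNNSimple.

Section integral_away_from_zero.
Local Open Scope ereal_scope.

Lemma ge0_integral_le_measurable disp (T : measurableType disp) (R : realType)
    (mu : {measure set T -> \bar R}) (D : set T) (f : T -> \bar R) (B : \bar R) :
  measurable D -> (forall x, D x -> 0 <= f x) ->
  (forall h : T -> R, measurable_fun setT h -> (forall x, (0 <= h x)%R) ->
    (forall x, D x -> (h x)%:E <= f x) -> \int[mu]_(x in D) (h x)%:E <= B) ->
  \int[mu]_(x in D) f x <= B.
Proof.
move=> mD f0 H; apply: ge0_integral_le_nnsfun => // h hf.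
by apply: H => //; move=> x; exact: fun_ge0.
Qed.

(* [f] need not be measurable: the integral is then a lower integral. *)
Lemma integral_01_le (R : realType) (f : R -> \bar R) (c : R) : (0 <= c)%R ->
  (forall t, 0 <= f t) -> (forall t, (0 < t)%R -> f t <= c%:E) ->
  \int[@lebesgue_measure R]_(t in `[0%R, 1%R]) f t <= c%:E.
Proof.
move=> c0 f0 fc; apply: ge0_integral_le_measurable => // h mh h0 hf.
(* At time 0 nothing bounds [f]; a measurable function below it allows that single point to be
   dropped. *)
rewrite -integral_itv_obnd_cbnd; last by apply/measurable_EFinP; apply: measurable_funTS.
apply: (@le_trans _ _ (\int[@lebesgue_measure R]_(t in `]0%R, 1%R]) c%:E)).
  apply: ge0_le_integral_nonmeas => t /=; rewrite in_itv/= => /andP[t0 t1].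
    by rewrite lee_fin.
  by apply: (le_trans (hf t _)); [rewrite /= in_itv/= ltW|exact: fc].
rewrite integral_cst//= lebesgue_measure_itv/= lte_fin ltr01.
by rewrite oppr0 adde0 mule1.
Qed.

End integral_away_from_zero.

Lemma measurable_diagonal (R : realType) (d : nat) :
  measurable [set z : Rd R d * Rd R d | z.1 = z.2].
Proof.
rewrite (_ : [set _ | _] = ~` ((fun z : Rd R d * Rd R d => enorm (z.1 - z.2)) @^-1` `]0, +oo[)).
  apply: measurableC; rewrite -[X in measurable X]setTI.
  exact: measurable_enorm_sub.
apply/seteqP; split => z /=; rewrite in_itv/= andbT enorm_gt0 subr_eq0.
  by move=> ->; rewrite eqxx.
by move=> /negP; rewrite negbK => /eqP.
Qed.

Section level_mean_near.
Local Open Scope ereal_scope.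
Context {R : realType} {d : nat} (beta : {measure set (Rd R d) -> \bar R}).
Variable g : nat -> Rd R d -> R.
Hypotheses (mg : forall k, measurable_fun setT (g k)) (g0 : forall k x, (0 <= g k x)%R).
Hypothesis g1 : forall k, \int[beta]_x (g k x)%:E = 1.

Lemma level_mean_near k (f : Rd R d -> R) (M c e : R) : measurable_fun setT f ->
  (forall x, (`|f x| <= M)%R) -> (forall x, g k x != 0%R -> (`|f x - c| <= e)%R) ->
  (0 <= e)%R -> (`|level_mean beta g k f - c| <= e)%R.
Proof.
move=> mf fM fe e0; rewrite -lee_fin -abse_EFin EFinB -(level_meanE mg g0 g1 mf fM).
have ig := integrable_g mg g0 g1 k.
have -> : c%:E = \int[beta]_x (c%:E * (g k x)%:E).
  by rewrite integralZl// g1 mule1.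
have i1 := integrable_level_mean mg g0 g1 mf fM k.
have i2 : beta.-integrable setT (fun x => c%:E * (g k x)%:E) by exact: integrableZl.
rewrite -(integralB measurableT i1 i2).
apply: (le_trans (le_abse_integral_nonmeas _ _ _)).
apply: (@le_trans _ _ (\int[beta]_x (e%:E * (g k x)%:E))).
  apply: ge0_le_integral_nonmeas => x _; first exact: abse_ge0.
  rewrite -!EFinM -EFinB abse_EFin lee_fin -mulrBl normrM (ger0_norm (g0 k x)).
  by have [->|gx] := eqVneq (g k x) 0%R; [rewrite !mulr0|rewrite ler_wpM2r ?fe].
rewrite ge0_integralZl_EFin; [by rewrite g1 mule1|by []| | |by []].
- by move=> x _; rewrite lee_fin.
- exact/measurable_EFinP.
Qed.

End level_mean_near.

(** * Chains of densities generated by jump kernels *)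

Section kernel_chain.
Local Open Scope ereal_scope.
Context {R : realType} {d : nat} (eta : R -> R) (theta : R -> R -> R).
Local Notation RR := (Rd R d * Rd R d)%type.
Local Notation G := (@Gset R d eta).
Hypotheses (keta : weight_kernel d eta) (itheta : interpolation theta).
Variables (beta : {sigma_finite_measure set (Rd R d) -> \bar R}).
Hypothesis beta_fin : forall r, beta (cube 0%R r) < +oo.
Local Notation b2 := (beta \x beta).
Variable gL : Rd R d -> R.
Hypotheses (mgL : measurable_fun setT gL) (gL0 : forall x, (0 <= gL x)%R).
Hypothesis lebE : forall A, measurable A -> leb d A = \int[beta]_(x in A) (gL x)%:E.
Variables (kap : nat -> RR -> R) (M : nat -> Rd R d -> R) (q : Rd R d -> R).
Hypotheses (mkap : forall k, measurable_fun setT (kap k))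
  (kap0 : forall k z, (0 <= kap k z)%R) (kapM : forall k z, (kap k z <= M k z.1)%R)
  (kap1 : forall k y, \int[beta]_x (kap k (x, y))%:E = 1).
Hypotheses (mq : measurable_fun setT q) (q0 : forall x, (0 <= q x)%R)
  (q1 : \int[beta]_x (q x)%:E = 1).

(* [kap k (x, y)] is the density at x of the jump from y. *)
Fixpoint chain (k : nat) : Rd R d -> R :=
  if k is k'.+1 then fun x => fine (\int[beta]_y (kap k' (x, y) * chain k' y)%:E)
  else q.

Local Notation g := chain.

Definition is_density1 (h : Rd R d -> R) :=
  [/\ measurable_fun setT h, (forall x, (0 <= h x)%R) & \int[beta]_x (h x)%:E = 1].

Lemma kernel_mul_measurable k (h : Rd R d -> R) : measurable_fun setT h ->
  measurable_fun setT (fun z : RR => (kap k z * h z.2)%:E).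
Proof.
move=> mh; apply/measurable_EFinP; apply: measurable_funM => //.
exact: measurableT_comp mh measurable_snd.
Qed.

Lemma kernel_mul_integral2 k h : is_density1 h -> \int[b2]_z (kap k z * h z.2)%:E = 1.
Proof.
move=> [mh h0 h1]; have mk := kernel_mul_measurable k mh.
have k0 z : 0 <= (kap k z * h z.2)%:E by rewrite lee_fin mulr_ge0.
apply: etrans (fubini_tonelli2 _ mk k0) _; rewrite /fubini_G /=.
rewrite -h1; apply: eq_integral => y _.
under eq_integral do rewrite EFinM.
rewrite ge0_integralZr//.
- by rewrite kap1 mul1e.
- by apply/measurable_EFinP; exact: measurableT_comp (mkap k) (measurable_pair2 _).
- by move=> x _; rewrite lee_fin.
- by rewrite lee_fin.
Qed.

Lemma kernel_step_fin k h x : is_density1 h ->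
  \int[beta]_y (kap k (x, y) * h y)%:E <= (M k x)%:E.
Proof.
move=> [mh h0 h1]; apply: (@le_trans _ _ (\int[beta]_y ((M k x)%:E * (h y)%:E))).
  apply: ge0_le_integral_nonmeas => y _; first by rewrite lee_fin mulr_ge0.
  by rewrite -EFinM lee_fin ler_wpM2r// (kapM k (x, y)).
rewrite ge0_integralZl_EFin; [by rewrite h1 mule1|by []| | |].
- by move=> y _; rewrite lee_fin.
- exact/measurable_EFinP.
- exact: le_trans (kap0 k (x, x)) (kapM k (x, x)).
Qed.

Lemma kernel_step_fineK k h x : is_density1 h ->
  (fine (\int[beta]_y (kap k (x, y) * h y)%:E))%:E = \int[beta]_y (kap k (x, y) * h y)%:E.
Proof.
move=> hd; rewrite fineK// ge0_fin_numE; first exact: le_lt_trans (kernel_step_fin k x hd) (ltry _).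
by have [_ h0 _] := hd; apply: integral_ge0 => y _; rewrite lee_fin mulr_ge0.
Qed.

Lemma chain_density k : is_density1 (g k).
Proof.
elim: k => [|k hd]; first by split.
have [mh h0 h1] := hd.
have mk := kernel_mul_measurable k mh.
have k0 z : 0 <= (kap k z * g k z.2)%:E by rewrite lee_fin mulr_ge0.
split => /=.
- apply: (@measurableT_comp _ _ _ _ _ _ (@fine R)); first exact: fine_measurable.
  exact: (@measurable_fun_fubini_tonelli_F _ _ _ _ _ beta (fun z : RR => (kap k z * g k z.2)%:E) mk k0).
- by move=> x; apply: fine_ge0; apply: integral_ge0 => y _; rewrite lee_fin mulr_ge0.
- under eq_integral do rewrite kernel_step_fineK//.
  apply: etrans (esym (fubini_tonelli1 _ mk k0)) _.
  exact: kernel_mul_integral2.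
Qed.

Let mg k : measurable_fun setT (g k). Proof. by have [] := chain_density k. Qed.
Let g0 k x : (0 <= g k x)%R. Proof. by have [] := chain_density k. Qed.
Let g1 k : \int[beta]_x (g k x)%:E = 1. Proof. by have [] := chain_density k. Qed.

Lemma chainSE k x : (g k.+1 x)%:E = \int[beta]_y (kap k (x, y) * g k y)%:E.
Proof. by rewrite /= kernel_step_fineK//; exact: chain_density. Qed.

(** The diagonal lies off [Gset] but has positive measure when [beta] has atoms; trivial jumps carry
    no flux and are removed. *)
Definition jump k (z : RR) : R :=
  (if z.1 == z.2 then 0 else kap k z * g k z.2)%R.

Lemma measurable_jump k : measurable_fun setT (jump k).
Proof.
rewrite (_ : jump k = fun z => (\1_(~` [set z : RR | z.1 = z.2]) z * (kap k z * g k z.2))%R).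
  apply: measurable_funM; first by apply: measurable_indic; apply: measurableC; exact: measurable_diagonal.
  by apply/measurable_EFinP; exact: kernel_mul_measurable.
apply/funext => z; rewrite /jump indicE; case: ifPn => z12.
  by rewrite memNset ?mul0r//= => /(_ (eqP z12)).
by rewrite mem_set ?mul1r//=; exact/eqP.
Qed.

Lemma jump_ge0 k z : (0 <= jump k z)%R.
Proof. by rewrite /jump; case: ifPn => // _; rewrite mulr_ge0. Qed.

Lemma jump_le k z : (jump k z <= kap k z * g k z.2)%R.
Proof. by rewrite /jump; case: ifPn => // _; rewrite mulr_ge0. Qed.

Lemma jump_mass k : \int[b2]_z (jump k z)%:E <= 1.
Proof.
rewrite -(kernel_mul_integral2 k (chain_density k)).
by apply: ge0_le_integral_nonmeas => z _; rewrite lee_fin ?jump_ge0 ?jump_le.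
Qed.

(** The marginals of kap k (x, y) g k y are level k + 1 in x and level k in y, and the removed
    diagonal contributes nothing to a difference of values of [f]. *)
Lemma chain_balance k (f : Rd R d -> R) (m : R) : continuous f ->
  (forall x, (`|f x| <= m)%R) ->
  \int[b2]_z ((f z.2 - f z.1) * jump k z)%:E =
  (level_mean beta g k f - level_mean beta g k.+1 f)%:E.
Proof.
move=> cf fm; have mf := continuous_measurable_Rd cf.
pose h (z : RR) := (kap k z * g k z.2)%R.
have mh := kernel_mul_measurable k (mg k).
have h0 z : (0 <= h z)%R by rewrite mulr_ge0.
have ih : b2.-integrable setT (EFin \o h).
  apply/integrableP; split => //; under eq_integral do rewrite /= ger0_norm//.
  by rewrite (kernel_mul_integral2 k (chain_density k)) ltry.
have i2 : b2.-integrable setT (EFin \o (fun z : RR => f z.2 * h z)%R).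
  apply: (integrable_bounded_mul ih (measurableT_comp mf measurable_snd)) => z.
  exact: fm.
have i1 : b2.-integrable setT (EFin \o (fun z : RR => f z.1 * h z)%R).
  apply: (integrable_bounded_mul ih (measurableT_comp mf measurable_fst)) => z.
  exact: fm.
have E2 : \int[b2]_z (f z.2 * h z)%:E = (level_mean beta g k f)%:E.
  rewrite -(level_meanE mg g0 g1 mf fm); apply: etrans (esym (integral21_prod_meas1 i2)) _.
  apply: eq_integral => y _ /=.
  have mky : measurable_fun setT (fun x => (kap k (x, y))%:E).
    by apply/measurable_EFinP; exact: measurableT_comp (mkap k) (measurable_pair2 y).
  apply: (@etrans _ _ (\int[beta]_x ((kap k (x, y))%:E * (f y * g k y)%:E))).
    by apply: eq_integral => x _; rewrite -EFinM /= /h/= mulrCA.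
  rewrite integralZr//; first by rewrite kap1 mul1e.
  apply/integrableP; split => //; under eq_integral do rewrite /= ger0_norm//.
  by rewrite kap1 ltry.
have E1 : \int[b2]_z (f z.1 * h z)%:E = (level_mean beta g k.+1 f)%:E.
  rewrite -(level_meanE mg g0 g1 mf fm); apply: etrans (esym (integral12_prod_meas1 i1)) _.
  apply: eq_integral => x _ /=.
  have mkx : measurable_fun setT (fun y => (kap k (x, y) * g k y)%:E).
    apply/measurable_EFinP; apply: measurable_funM => //.
    exact: measurableT_comp (mkap k) (measurable_pair1 x).
  apply: (@etrans _ _ (\int[beta]_y ((f x)%:E * (kap k (x, y) * g k y)%:E))).
    by apply: eq_integral => y _; rewrite -EFinM.
  rewrite integralZl//; first by rewrite -chainSE -EFinM.
  apply/integrableP; split => //.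
  under eq_integral do rewrite /= ger0_norm ?mulr_ge0//.
  exact: le_lt_trans (kernel_step_fin k x (chain_density k)) (ltry _).
rewrite EFinB -E1 -E2 -integralB//; apply: eq_integral => z _.
rewrite -EFinB -mulrBl /jump; case: ifPn => [/eqP->|_]; last by [].
by rewrite subrr !mul0r.
Qed.

Hypothesis chain_near : forall e : R, (0 < e)%R -> exists N, forall k, (N <= k)%N ->
  (forall y, g k y != 0%R -> (enorm y < e)%R) /\
  (forall z, kap k z != 0%R -> (enorm z.1 < e)%R).
(** [D k] compares the jump density with the mobility and [e k] bounds 1 / eta along the jumps;
    their product bounds the cost of the k-th kernel. *)
Variables (D e : nat -> R) (B : R).
Hypotheses (D0 : forall k, (0 <= D k)%R) (e0 : forall k, (0 <= e k)%R).
Hypothesis jump_profile : forall k (z : RR), z.1 != z.2 -> (kap k z * g k z.2 != 0)%R ->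
  (1 <= e k * pair_profile eta z)%R.
Hypothesis jump_theta : forall k (z : RR), z.1 != z.2 -> (kap k z * g k z.2 != 0)%R ->
  (kap k z * g k z.2 <= D k *
   theta ((g k z.1 + g k.+1 z.1) * gL z.2) (gL z.1 * (g k z.2 + g k.+1 z.2)))%R.
Hypothesis DeB : forall n, (\sum_(k < n) 8 ^+ k * (D k * e k) <= B)%R.
Variable nu : probability (Rd R d) R.
Hypothesis nuE : forall A, measurable A -> nu A = \int[beta]_(x in A) (q x)%:E.

Lemma jump_neq0 k (z : RR) : jump k z != 0%R ->
  z.1 != z.2 /\ (kap k z * g k z.2 != 0)%R.
Proof. by rewrite /jump; case: ifPn; rewrite ?eqxx. Qed.

Let jump_G k z : ~ G z -> jump k z = 0%R.
Proof.
move=> Gz; apply/eqP; apply: contra_notT Gz => /jump_neq0 [z12 kz].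
rewrite (GsetE eta) /=; have := jump_profile z12 kz.
rewrite lt_neqAle (profile_ge0 keta) andbT eq_sym /pair_profile.
by apply: contraTneq => ->; rewrite mulr0 -ltNge ltr01.
Qed.

Let jump_fin k : \int[b2]_z (jump k z)%:E < +oo.
Proof. exact: le_lt_trans (jump_mass k) (ltry _). Qed.

(** The points of a pair in a compact subset of [Gset] keep a positive distance, whereas late jumps
    begin and end close to 0. *)
Lemma jump_compact K : compact K -> K `<=` G ->
  exists N, forall k z, (N <= k)%N -> K z -> jump k z = 0%R.
Proof.
move=> cK KG; have [->|/set0P K0] := eqVneq K set0; first by exists 0%N.
have [|z0 /set_mem Kz0 z0P] := @compact_EVT_min _ R (fun z : RR => enorm (z.1 - z.2)%R) K K0 cK.
  by apply: continuous_subspaceT; exact: enorm_sub_continuous.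
set r := enorm (z0.1 - z0.2)%R in z0P.
have r0 : (0 < r)%R by rewrite /r enorm_gt0 subr_eq0; case: (KG _ Kz0).
have sd0 : (0 <= Num.sqrt d%:R :> R)%R by exact: sqrtr_ge0.
have s0 : (0 < 2 * (Num.sqrt d%:R + 1) :> R)%R by rewrite mulr_gt0// ltr_wpDl.
have [N NP] := chain_near (divr_gt0 r0 s0); exists N => k z Nk Kz.
have [gN kN] := NP k Nk; apply/eqP; apply/negPn/negP => /jump_neq0 [z12].
rewrite mulf_eq0 negb_or => /andP[/kN z1 /gN z2].
have := z0P z (mem_set Kz); apply/negP; rewrite -ltNge.
set a := (r / _)%R in z1 z2.
have a0 : (0 < a)%R by rewrite divr_gt0.
apply: (@le_lt_trans _ _ (Num.sqrt d%:R * (2 * a))%R).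
  apply: enorm_le_sup => [|i]; first by rewrite mulr_ge0// ltW.
  rewrite !mxE; apply: (le_trans (ler_normB _ _)).
  by rewrite mulr_natl mulr2n lerD//; apply: (le_trans (ler_coord_enorm _ _)); exact: ltW.
have -> : r = (2 * a * (Num.sqrt d%:R + 1))%R.
  by rewrite /a; field; rewrite gt_eqF// ltr_wpDl.
by rewrite mulrC ltr_pM2l ?ltrDl// mulr_gt0.
Qed.

Lemma chain_cvg (f : Rd R d -> R) : continuous f -> (exists M, forall x, (`|f x| <= M)%R) ->
  level_mean beta g k f @[k --> \oo] --> f 0%R.
Proof.
move=> cf [m fm]; apply/cvgrPdist_le => r r0.
have /cvgrPdist_le /(_ _ r0) /nbhs_ballP [a /= a0 aP] := cf 0%R.
have [N NP] := chain_near a0; exists N => // k /= Nk; rewrite distrC.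
apply: (level_mean_near mg g0 g1 (continuous_measurable_Rd cf) fm) => [x gx|]; last exact: ltW.
rewrite distrC; apply: aP; split => // i j; rewrite ord1 /ball/= mxE sub0r normrN.
by apply: le_lt_trans (ler_coord_enorm _ _) _; have [+ _] := NP k Nk; apply.
Qed.

Theorem chain_W_le : W eta theta (\d_(0%R : Rd R d)) nu <= (Num.sqrt (600 * B))%:E.
Proof.
have B0 : (0 <= B)%R by have := DeB 0; rewrite big_ord0.
have mj := measurable_jump; have j0 := jump_ge0.
pose mu := curve beta mg g0.
pose fl := flux_curve keta mj j0 jump_fin jump_G.
(* The quadratic condition on the flux then becomes [jump_theta] multiplied by the jump density. *)
pose s k z := (D k * jump k z)%R.
have ms k : measurable_fun setT (s k) by apply: measurable_funM.
have s0 k z : (0 <= s k z)%R by rewrite mulr_ge0.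
have th0 k z : (0 <= theta ((g k z.1 + g k.+1 z.1) * gL z.2) (gL z.1 * (g k z.2 + g k.+1 z.2)))%R.
  by apply: (itp_ge0 itheta); rewrite mulr_ge0// addr_ge0.
have j_sqr k z : G z -> (jump k z ^+ 2 <= s k z *
    theta ((g k z.1 + g k.+1 z.1) * gL z.2) (gL z.1 * (g k z.2 + g k.+1 z.2)))%R.
  move=> Gz; rewrite expr2 /s mulrAC mulrC [leRHS]mulrC; apply: ler_wpM2l => //.
  have [->|/jump_neq0 [z12 kz]] := eqVneq (jump k z) 0%R; first by rewrite mulr_ge0.
  by apply: (le_trans (jump_le k z)); exact: jump_theta.
have s_le k : \int[b2]_(z in G) (s k z / pair_profile eta z)%:E <= (D k * e k)%:E.
  apply: (@le_trans _ _ (\int[b2]_z ((D k * e k)%:E * (jump k z)%:E))).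
    rewrite integral_mkcond; apply: ge0_le_integral_nonmeas => z _; rewrite patchE.
      case: ifPn => // Gz; rewrite lee_fin divr_ge0//; exact: pair_profile_ge0 keta z.
    case: ifPn => [/set_mem Gz|_]; last first.
      by rewrite -EFinM lee_fin; apply: mulr_ge0; [exact: mulr_ge0|exact: j0].
    have pz : (0 < pair_profile eta z)%R := pair_profile_gt0 Gz.
    rewrite -EFinM lee_fin /s.
    have [->|/jump_neq0 [z12 kz]] := eqVneq (jump k z) 0%R; first by rewrite !mulr0 mul0r.
    rewrite ler_pdivrMr// -!mulrA ler_wpM2l// mulrCA -[leLHS]mulr1 ler_wpM2l//.
    exact: jump_profile.
  rewrite ge0_integralZl_EFin; [|by []| | |by rewrite mulr_ge0].
  - rewrite -[leRHS]mule1; apply: lee_wpmul2l; first by rewrite lee_fin mulr_ge0.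
    exact: jump_mass.
  - by move=> z _; rewrite lee_fin.
  - exact/measurable_EFinP.
have act t : (0 < t)%R -> action theta (mu t) (fl t) <= (600 * B)%:E.
  move=> t0; apply: le_trans (action_curve_le keta itheta beta_fin mg g0 g1 mgL gL0 lebE
    mj j0 jump_fin jump_G ms s0 j_sqr s_le t0) _.
  by rewrite lee_fin; apply: ler_wpM2l; [exact: ler0n|exact: DeB].
have -> : (Num.sqrt (600 * B))%:E = sqrte (600 * B)%:E by [].
have B6 : (0 <= 600 * B)%R by apply: mulr_ge0; [exact: ler0n|exact: B0].
rewrite /W lee_sqrt; last by rewrite lee_fin; exact: B6.
apply: (@le_trans _ _ (\int[@lebesgue_measure R]_(t in `[0%R, 1%R]) action theta (mu t) (fl t))).
  apply: ereal_inf_lbound; exists mu, fl; split => //; split.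
  - exact: curve_narrowly_continuous chain_cvg.
  - exact: flux_curve_borel jump_compact.
  - by move=> A mA; exact: curve0.
  - move=> A mA; rewrite /mu curveE// nuE//; apply: eq_integral => x _.
    rewrite (@mixtureE _ _ _ 0) ?expr0 ?mulr1//.
    by rewrite big_ord_recl big_ord0 addr0 weight1 eqxx mul1r.
  - move=> phi tphi; split.
      exact: chain_flux_converges.
    by apply: chain_continuity_identity; [exact: g1|exact: chain_balance|exact: tphi].
apply: integral_01_le; first exact: B6.
- by move=> t; exact: action_ge0.
- exact: act.
Qed.

End kernel_chain.


Lemma chain_neq0 (R : realType) (d : nat) (beta : {sigma_finite_measure set (Rd R d) -> \bar R})
    (kap : nat -> Rd R d * Rd R d -> R) (q : Rd R d -> R) k x :
  chain beta kap q k.+1 x != 0 -> exists y, kap k (x, y) != 0 /\ chain beta kap q k y != 0.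
Proof.
apply: contra_neqP => /forallNP H; rewrite /= integral0_eq// => y _.
have /not_andP[/negP|/negP] := H y; rewrite negbK => /eqP->; first by rewrite mul0r.
by rewrite mulr0.
Qed.

Lemma measurable_indic_sub (R : realType) (d : nat) (a : R) (A : set (Rd R d)) : measurable A ->
  measurable_fun setT (fun z : Rd R d * Rd R d => \1_A (z.1 - a *: z.2) : R).
Proof.
move=> mA; apply: (@measurableT_comp _ _ _ _ _ _ (\1_A : Rd R d -> R)); first exact: measurable_indic.
apply: measurable_fun_Rd => i.
under eq_fun do rewrite !mxE.
apply: measurable_funB; first exact: measurableT_comp (measurable_coord _) measurable_fst.
apply: measurable_funM => //.
exact: measurableT_comp (measurable_coord _) measurable_snd.
Qed.

Lemma sum_eventually0_le (R : realType) (F : nat -> R) m n : (forall k, 0 <= F k) ->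
  (forall k, (m <= k)%N -> F k = 0) -> \sum_(k < n) F k <= \sum_(k < m) F k.
Proof.
move=> F0 Fm; apply: (@le_trans _ _ (\sum_(k < n + m) F k)).
  by rewrite big_split_ord /= lerDl sumr_ge0.
rewrite addnC big_split_ord /= [X in _ + X]big1 ?addr0// => k _.
by rewrite Fm// leq_addr.
Qed.

(** * Contraction towards the origin when theta(1, 0) > 0 *)

Section contraction.
Local Open Scope ereal_scope.
Context {R : realType} {d : nat} (eta : R -> R) (theta : R -> R -> R).
Local Notation RR := (Rd R d * Rd R d)%type.
Hypotheses (keta : weight_kernel d eta) (itheta : interpolation theta).
Hypothesis theta10 : (0 < theta 1 0)%R.
Variables (beta : {sigma_finite_measure set (Rd R d) -> \bar R}).
Hypothesis beta_fin : forall r, beta (cube 0%R r) < +oo.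
Hypothesis beta0 : beta [set 0%R] = 1.
Variables (gL q : Rd R d -> R).
Hypotheses (mgL : measurable_fun setT gL) (gL0 : forall x, (0 <= gL x)%R).
Hypothesis lebE : forall A, measurable A -> leb d A = \int[beta]_(x in A) (gL x)%:E.
Hypotheses (mq : measurable_fun setT q) (q0 : forall x, (0 <= q x)%R)
  (q1 : \int[beta]_x (q x)%:E = 1).
Variables (m r l : R) (N0 : nat).
Hypotheses (m0 : (0 <= m)%R) (r0 : (0 < r)%R) (l0 : (0 < l)%R) (l1 : (l <= 1)%R).
Hypothesis qm : forall y, q y != 0%R -> forall i, (`|y ord0 i| <= m)%R.
Hypothesis lmr : (l * (m + 2 * r) <= r)%R.
Hypothesis NP : ((1 - l) ^+ N0.+1 * m <= r)%R.
Hypothesis dr : (Num.sqrt d%:R * (2 * r) <= 1 / 2)%R.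
Variable nu : probability (Rd R d) R.
Hypothesis nuE : forall A, measurable A -> nu A = \int[beta]_(x in A) (q x)%:E.

(** Makes [r] the fixed point of t -> (1 - l) t + h, so that one step turns the bound r + (1 - l)^k
    m on the support into the next one. *)
Let h : R := (l * r)%R.
Let c : R := (((2 * h) ^+ d)^-1)%R.
Let N := N0.+1.

Let h0 : (0 < h)%R. Proof. exact: mulr_gt0. Qed.
Let c0 : (0 < c)%R. Proof. by rewrite /c invr_gt0 exprn_gt0// mulr_gt0. Qed.

(** Each of the first [N] steps contracts by 1 - l and spreads the mass uniformly over a cube of
    half-side [h]; all later steps go to 0. The factor [gL] turns a Lebesgue density into one with
    respect to [beta]. *)
Definition contraction_kernel (k : nat) (z : RR) : R :=
  (if (k < N)%N then c * \1_(cube 0 h) (z.1 - (1 - l) *: z.2) * gL z.1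
   else \1_[set 0] z.1)%R.
Local Notation kap := contraction_kernel.
Local Notation g := (chain beta kap q).

Lemma measurable_contraction k : measurable_fun setT (kap k).
Proof.
rewrite /kap; case: (k < N)%N.
  apply: measurable_funM; last exact: measurableT_comp mgL measurable_fst.
  by apply: measurable_funM => //; apply: measurable_indic_sub; exact: measurable_cube.
apply: (@measurableT_comp _ _ _ _ _ _ (\1_[set 0%R] : Rd R d -> R)); last exact: measurable_fst.
by apply: measurable_indic; exact: measurable_point_Rd.
Qed.

Lemma contraction_ge0 k z : (0 <= kap k z)%R.
Proof. by rewrite /kap; case: ifPn => _ //; rewrite !mulr_ge0// ltW. Qed.

Let cM k x : R := (if (k < N)%N then c * gL x else 1)%R.

Lemma contraction_le k z : (kap k z <= cM k z.1)%R.
Proof.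
rewrite /kap /cM; case: ifPn => _; last by rewrite indicE; case: (_ \in _).
by rewrite ler_wpM2r// ler_piMr ?(ltW c0)// indicE; case: (_ \in _).
Qed.

Lemma integral_contraction k y : \int[beta]_x (kap k (x, y))%:E = 1.
Proof.
rewrite /kap /=; case: (k < N)%N; last first.
  by rewrite integral_indic ?setIT//; exact: measurable_point_Rd.
have cE x : \1_(cube 0%R h) (x - (1 - l) *: y)%R = \1_(cube ((1 - l) *: y)%R h) x :> R.
  rewrite !indicE; congr (nat_of_bool _)%:R; apply/idP/idP => /set_mem xy; apply/mem_set => i.
    by have := xy i; rewrite !mxE subr0.
  by have := xy i; rewrite !mxE subr0.
apply: (@etrans _ _ (\int[beta]_(x in cube ((1 - l) *: y)%R h) (c%:E * (gL x)%:E))).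
  rewrite [RHS]integral_mkcond; apply: eq_integral => x _.
  rewrite patchE cE indicE; case: ifPn => _; first by rewrite mulr1 EFinM.
  by rewrite mulr0 mul0r.
have mc : measurable (cube ((1 - l) *: y)%R h) by exact: measurable_cube.
rewrite ge0_integralZl_EFin; [|exact: mc| | |exact: ltW]; last 2 first.
- by move=> x _; rewrite lee_fin.
- by apply/measurable_EFinP; exact: measurable_funTS.
rewrite -lebE// leb_cube ?(ltW h0)// -EFinM mulVf// expf_neq0// mulf_neq0// gt_eqF//.
Qed.

Let gd := chain_density measurable_contraction contraction_ge0 contraction_le
  integral_contraction mq q0 q1.

Lemma contraction_support k y : (k <= N)%N -> g k y != 0%R ->
  forall i, (`|y ord0 i| <= r + (1 - l) ^+ k * m)%R.
Proof.
elim: k y => [|k ih] y kN gy i.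
  by rewrite expr0 mul1r; apply: (le_trans (qm gy i)); rewrite lerDr ltW.
have [x [kx gx]] := chain_neq0 gy.
move: kx; rewrite /kap kN /= mulf_eq0 negb_or => /andP[+ _].
rewrite mulf_eq0 negb_or => /andP[_]; rewrite indicE pnatr_eq0 eqb0 negbK => /set_mem /(_ i).
rewrite !mxE subr0 => yx.
have xi := ih x (ltnW kN) gx i.
rewrite (_ : r + _ = h + (1 - l) * (r + (1 - l) ^+ k * m))%R; last by rewrite /h exprS; ring.
rewrite -[y ord0 i](subrK ((1 - l) * x ord0 i))%R.
apply: (le_trans (ler_normD _ _)); apply: lerD => //.
by rewrite normrM ger0_norm ?subr_ge0// ler_wpM2l ?subr_ge0.
Qed.

Lemma contraction_final k y : (N < k)%N -> g k y != 0%R -> y = 0%R.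
Proof.
case: k => // k Nk gy; have [x [kx _]] := chain_neq0 gy.
move: kx; rewrite /kap ltnNge -ltnS Nk /= indicE pnatr_eq0 eqb0 negbK.
by move=> /set_mem.
Qed.

(** Per coordinate, a contracting step has length at most h + l (r + m) <= r and the jump to 0 at
    most 2 r; [dr] converts this into Euclidean length at most 1/2. Later jumps go from 0 to 0. *)
Lemma contraction_jump k z : z.1 != z.2 -> (kap k z * g k z.2 != 0)%R ->
  (k <= N)%N /\ (enorm (z.1 - z.2) <= 1 / 2)%R.
Proof.
move=> z12; rewrite mulf_eq0 negb_or => /andP[kz gz].
have kN : (k <= N)%N.
  rewrite leqNgt; apply/negP => Nk; move: kz; rewrite /kap ltnNge (ltnW Nk)/=.
  rewrite indicE pnatr_eq0 eqb0 negbK => /set_mem z1.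
  by move: z12; rewrite z1 (contraction_final Nk gz) eqxx.
split=> //; apply: le_trans dr; apply: enorm_le_sup => [|i]; first by rewrite mulr_ge0// ltW.
have zi := contraction_support kN gz i.
have l1' : (0 <= 1 - l)%R by rewrite subr_ge0.
have pl : (0 <= (1 - l) ^+ k <= 1)%R.
  by rewrite exprn_ge0//= exprn_ile1// lerBlDr lerDl ltW.
move: kz; rewrite /kap !mxE; case: ifPn => [kN'|].
  rewrite mulf_eq0 negb_or => /andP[+ _]; rewrite mulf_eq0 negb_or => /andP[_].
  rewrite indicE pnatr_eq0 eqb0 negbK => /set_mem /(_ i); rewrite !mxE subr0 => hi.
  rewrite (_ : z.1 ord0 i - z.2 ord0 i = (z.1 ord0 i - (1 - l) * z.2 ord0 i) - l * z.2 ord0 i)%R; last by ring.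
  apply: (le_trans (ler_normB _ _)); rewrite normrM (gtr0_norm l0).
  apply: (@le_trans _ _ (h + l * (r + m))%R).
    apply: lerD => //; rewrite ler_wpM2l ?(ltW l0)//; apply: (le_trans zi).
    by rewrite lerD2l; case/andP: pl => pl0 pl1; rewrite ler_piMl.
  rewrite (_ : h + l * (r + m) = l * (m + 2 * r))%R; last by rewrite /h; ring.
  by apply: (le_trans lmr); rewrite mulr_natl mulr2n lerDl ltW.
move=> kN'; have {kN'}kE : k = N by apply/eqP; rewrite eqn_leq kN leqNgt.
rewrite indicE pnatr_eq0 eqb0 negbK => /set_mem ->; rewrite mxE sub0r normrN.
by apply: (le_trans zi); rewrite kE mulr2n mulrDl mul1r lerD2l.
Qed.

(** The last spreading step bounds the density with respect to Lebesgue measure by [c], which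
    compares the final jump with the mass already at 0. *)
Lemma chainN_le y : (g N y <= c * gL y)%R.
Proof.
have := kernel_step_fin contraction_ge0 contraction_le N0 y (gd N0).
by rewrite -(chainSE measurable_contraction contraction_ge0 contraction_le
  integral_contraction mq q0 q1) /cM /= ltnSn lee_fin.
Qed.

Lemma chainN1_0 : g N.+1 0%R = 1%R.
Proof.
apply: EFin_inj; rewrite (chainSE measurable_contraction contraction_ge0 contraction_le
  integral_contraction mq q0 q1).
have [_ _ <-] := gd N; apply: eq_integral => y _.
by rewrite /kap ltnn /= indicE mem_set// mul1r.
Qed.

(* For k < N the bound uses theta(u, v) >= v theta(1, 0) with v coming from the
   mass at y; the last jump to 0, of Lebesgue measure 0, needs the mass already
   at 0, hence u. *)
Lemma contraction_theta k z : z.1 != z.2 -> (kap k z * g k z.2 != 0)%R ->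
  (kap k z * g k z.2 <= (if (k <= N)%N then c / theta 1 0 else 0) *
   theta ((g k z.1 + g k.+1 z.1) * gL z.2) (gL z.1 * (g k z.2 + g k.+1 z.2)))%R.
Proof.
move=> z12 kgz; have [kN _] := contraction_jump z12 kgz; rewrite kN.
have g0 j x : (0 <= g j x)%R by have [] := gd j.
set u := ((g k z.1 + _) * _)%R; set v := (gL z.1 * _)%R.
have u0 : (0 <= u)%R by rewrite mulr_ge0// addr_ge0.
have v0 : (0 <= v)%R by rewrite mulr_ge0// addr_ge0.
have tu : (u * theta 1 0 <= theta u v)%R.
  by rewrite -(itp_r0 itheta)//; apply: (itp_mono2 itheta).
have tv : (v * theta 1 0 <= theta u v)%R.
  by rewrite -(itp_0s itheta)//; apply: (itp_mono2 itheta).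
rewrite mulrAC ler_pdivlMr//.
apply: (@le_trans _ _ (c * (Num.max u v) * theta 1 0)%R); last first.
  rewrite -mulrA ler_wpM2l ?(ltW c0)// /Num.max; case: ifPn => _ //.
rewrite ler_wpM2r ?(ltW theta10)//.
have [kN'|kN'] := ltnP k N.
  apply: (@le_trans _ _ (c * v)%R); last by rewrite ler_wpM2l ?(ltW c0)// le_max lexx orbT.
  rewrite /v mulrA; apply: ler_pM => //; first exact: contraction_ge0.
    by have := contraction_le k z; rewrite /cM kN'.
  by rewrite lerDl.
have kE : k = N by apply/eqP; rewrite eqn_leq kN.
have z10 : z.1 = 0%R.
  move: kgz; rewrite mulf_eq0 negb_or /kap ltnNge kN' /= => /andP[+ _].
  by rewrite indicE pnatr_eq0 eqb0 negbK => /set_mem.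
apply: (@le_trans _ _ (c * u)%R); last by rewrite ler_wpM2l ?(ltW c0)// le_max lexx.
have kz1 : (kap k z <= 1)%R by have := contraction_le k z; rewrite /cM ltnNge kN'.
apply: (@le_trans _ _ (g k z.2)); first by rewrite ler_piMl.
rewrite kE; apply: (le_trans (chainN_le _)); rewrite ler_wpM2l ?(ltW c0)//.
by rewrite /u kE z10 chainN1_0 ler_peMl// lerDr.
Qed.

Lemma contraction_W : W eta theta (\d_(0%R : Rd R d)) nu < +oo.
Proof.
have half : (0 < 1 / 2 :> R)%R by [].
have e0 : (0 < profile eta (1 / 2))%R.
  by rewrite profile_gt0 half (eta_gt0 keta)// ltr_pdivrMr// mul1r ltr1n.
have pe : profile eta (1 / 2) = eta (1 / 2)%R by rewrite /profile half.
pose D k : R := (if (k <= N)%N then c / theta 1 0 else 0)%R.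
pose F k : R := (8 ^+ k * (D k * (profile eta (1 / 2))^-1))%R.
have D0 k : (0 <= D k)%R by rewrite /D; case: ifPn => // _; rewrite divr_ge0 ?ltW.
apply: le_lt_trans (ltry (Num.sqrt (600 * \sum_(k < N.+1) F k))%R).
apply: (@chain_W_le R d eta theta keta itheta beta beta_fin gL mgL gL0 lebE kap
  cM q measurable_contraction
  contraction_ge0 contraction_le integral_contraction mq q0 q1 _ D
  (fun=> (profile eta (1 / 2))^-1%R)).
- move=> a a0; exists N.+1 => k Nk; split => [y gy|z kz].
    by rewrite (contraction_final Nk gy) (eqP (_ : enorm 0%R == 0%R)) ?enorm_eq0.
  move: kz; rewrite /kap ltnNge (ltnW Nk)/= indicE pnatr_eq0 eqb0 negbK => /set_mem ->.
  by rewrite (eqP (_ : enorm 0%R == 0%R)) ?enorm_eq0.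
- exact: D0.
- by move=> _; rewrite invr_ge0 ltW.
- move=> k z z12 kgz; have [_ zh] := contraction_jump z12 kgz.
  rewrite mulrC ler_pdivlMr// [leLHS]mul1r /pair_profile.
  have z0 : (0 < enorm (z.1 - z.2))%R by rewrite enorm_gt0 subr_eq0.
  by rewrite pe /profile z0; exact: (wk_nonincreasing keta).
- exact: contraction_theta.
- move=> n; apply: (@sum_eventually0_le R F) => k.
    by rewrite mulr_ge0 ?exprn_ge0// mulr_ge0// invr_ge0 ltW.
  by rewrite /F /D ltnNge => /negbTE ->; rewrite mul0r mulr0.
- exact: nuE.
Qed.

End contraction.


(** * Base measure and finite distance to compactly supported targets *)

Section radon_nikodym_density.
Local Open Scope ereal_scope.

Lemma density_exists disp (T : measurableType disp) (R : realType)
    (beta : {sigma_finite_measure set T -> \bar R}) (m : {finite_measure set T -> \bar R}) :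
  (forall A, measurable A -> m A <= beta A) ->
  exists f : T -> R, [/\ measurable_fun setT f, (forall x, (0 <= f x)%R) &
    forall A, measurable A -> m A = \int[beta]_(x in A) (f x)%:E].
Proof.
move=> mb; have md : m `<< beta.
  apply/null_content_dominatesP => A mA bA.
  by apply/eqP; rewrite -measure_le0 -bA; exact: mb.
pose F := Radon_Nikodym_SigmaFinite.f m beta.
have Ffin x : F x \is a fin_num by exact: Radon_Nikodym_SigmaFinite.f_fin_num.
exists (fine \o F); split.
- apply: (@measurableT_comp _ _ _ _ _ _ (@fine R)); first exact: fine_measurable.
  exact: measurable_int (Radon_Nikodym_SigmaFinite.f_integrable md).
- by move=> x; apply: fine_ge0; exact: Radon_Nikodym_SigmaFinite.f_ge0.
- move=> A mA; rewrite (Radon_Nikodym_SigmaFinite.f_integral md mA).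
  by apply: eq_integral => x _; rewrite /= fineK.
Qed.

(* Radon-Nikodym is available for finite measures only; off Q the density is 1. *)
Lemma leb_density_exists (R : realType) (d : nat)
    (beta : {sigma_finite_measure set (Rd R d) -> \bar R}) (Q : set (Rd R d)) :
  measurable Q -> leb d Q < +oo ->
  (forall A, measurable A -> leb d A <= beta A) ->
  (forall A, measurable A -> A `<=` ~` Q -> beta A = leb d A) ->
  exists f : Rd R d -> R, [/\ measurable_fun setT f, (forall x, (0 <= f x)%R) &
    forall A, measurable A -> leb d A = \int[beta]_(x in A) (f x)%:E].
Proof.
move=> mQ Qoo lb bl.
have [|f [mf f0 fE]] := @density_exists _ _ _ beta (mfrestr mQ Qoo).
  move=> A mA; rewrite /= /mfrestr/= /mrestr; apply: (le_trans (lb _ (measurableI _ _ mA mQ))).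
  by apply: le_measure; rewrite ?inE//; exact: measurableI.
pose h x : R := (f x * \1_Q x + \1_(~` Q) x)%R.
have mh : measurable_fun setT h.
  apply: measurable_funD; last by apply: measurable_indic; exact: measurableC.
  by apply: measurable_funM => //; exact: measurable_indic.
have h0 x : (0 <= h x)%R by rewrite /h addr_ge0// mulr_ge0.
have hQ x : Q x -> h x = f x.
  by move=> Qx; rewrite /h !indicE mem_set// memNset ?mulr1 ?addr0//; exact.
have hQC x : ~ Q x -> h x = 1%R.
  by move=> Qx; rewrite /h !indicE memNset// mem_set ?mulr0 ?add0r.
exists h; split => // A mA.
have mAQ := measurableI _ _ mA mQ; have mAD := measurableD mA mQ.
rewrite -[A in RHS](setUIDK A Q) ge0_integral_setU//; last 3 first.
- by apply/measurable_EFinP; exact: measurable_funTS.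
- by move=> x _; rewrite lee_fin.
- by apply/disj_set2P; rewrite setDE setIACA setICr setI0.
rewrite (measureDI (leb d) mA mQ) addeC; congr (_ + _).
  have blD : beta (A `\` Q) = leb d (A `\` Q) by apply: bl => // x [].
  apply: (@etrans _ _ (beta (A `\` Q))); first exact: esym blD.
  apply: (@etrans _ _ (\int[beta]_(x in A `\` Q) (cst 1 x))).
    by rewrite integral_cst// mul1e.
  by apply: eq_integral => x /set_mem [_ Qx]; rewrite hQC.
have := fE _ mAQ; rewrite /= /mfrestr/= /mrestr -setIA setIid => ->.
by apply: eq_integral => x /set_mem [_ Qx]; rewrite hQ.
Qed.

End radon_nikodym_density.

Section base_measure.
Local Open Scope ereal_scope.
Context {R : realType} {d : nat} (nu : probability (Rd R d) R).

(** Dominates Lebesgue measure, the Dirac mass and the target at once, so that every measure along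
    the chain has a density. *)
Definition base_measure : set (Rd R d) -> \bar R :=
  measure_add (measure_add (leb d) (\d_(0%R : Rd R d))) nu.

HB.instance Definition _ := Measure.copy base_measure
  (measure_add (measure_add (leb d) (\d_(0%R : Rd R d))) nu).

Lemma base_measureE A : base_measure A = leb d A + \d_(0%R : Rd R d) A + nu A.
Proof.
by rewrite /base_measure; apply: etrans (measure_addE _ _ _) _; congr (_ + _); exact: measure_addE.
Qed.

Lemma base_measure_cube r : base_measure (cube 0%R r) < +oo.
Proof.
have mc : measurable (cube (0%R : Rd R d) r) by exact: measurable_cube.
rewrite base_measureE lte_add_pinfty//.
  rewrite lte_add_pinfty//; last by rewrite diracE ltry.
  apply: (@le_lt_trans _ _ (leb d (cube 0%R `|r|%R))).
    apply: le_measure; rewrite ?inE//; first exact: measurable_cube.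
    by move=> x xr i; apply: (le_trans (xr i)); exact: ler_norm.
  by have lc := @leb_cube R d 0%R `|r|%R (normr_ge0 _); rewrite [X in X < _]lc ltry.
by apply: (le_lt_trans _ (ltry 1%R)); exact: probability_le1.
Qed.

Let base_measure_sigma_finite : sigma_finite setT base_measure.
Proof.
exists (fun n => cube 0%R n%:R).
  apply/esym/seteqP; split => // x _.
  exists (Num.bound (enorm x)) => // i; rewrite mxE subr0.
  apply: (le_trans (ler_coord_enorm _ _)); apply: ltW.
  exact: archi_boundP (enorm_ge0 x).
by move=> n; split; [exact: measurable_cube|exact: base_measure_cube].
Qed.

HB.instance Definition _ := Measure_isSigmaFinite.Build _ _ _ base_measure
  base_measure_sigma_finite.

End base_measure.

Section finite_distance.
Local Open Scope ereal_scope.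
Context {R : realType} {d : nat} (eta : R -> R) (theta : R -> R -> R).
Hypotheses (d_gt0 : (0 < d)%N) (keta : weight_kernel d eta) (itheta : interpolation theta).

Lemma compact_cube (K : set (Rd R d)) : compact K -> exists2 m : R, (0 <= m)%R &
  K `<=` cube 0%R m.
Proof.
move=> cK; have [->|/set0P K0] := eqVneq K set0; first by exists 0%R.
have [|z _ zP] := @compact_EVT_max _ R (@enorm R d) K K0 cK.
  by apply: continuous_subspaceT; exact: enorm_continuous.
exists (enorm z); first exact: enorm_ge0.
move=> x /mem_set Kx i; rewrite mxE subr0.
by apply: (le_trans (ler_coord_enorm _ _)); exact: zP.
Qed.

Lemma W_dirac_lty (nu : probability (Rd R d) R) : (0 < theta 1 0)%R ->
  compactly_supported nu -> nu [set 0%R] = 0 ->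
  W eta theta (\d_(0%R : Rd R d)) nu < +oo.
Proof.
move=> th0 [K cK nuK] nu0.
have [m m0 Km] := compact_cube cK.
pose Q := cube (0%R : Rd R d) m.
have mQ : measurable Q by exact: measurable_cube.
have nuQ : nu (~` Q) = 0.
  apply/eqP; rewrite -measure_le0 -nuK; apply: le_measure; rewrite ?inE.
  - exact: measurableC.
  - apply: open_measurable_Rd; apply: closed_openC; exact: compact_closed.
  - exact: subsetC.
pose beta : {sigma_finite_measure set (Rd R d) -> \bar R} := base_measure nu.
have bE A : beta A = leb d A + \d_(0%R : Rd R d) A + nu A := base_measureE nu A.
have [||||gL [mgL gL0 lebE]] := @leb_density_exists R d beta Q.
- exact: mQ.
- by have lc := @leb_cube R d 0%R m m0; rewrite /Q lc ltry.
- by move=> A mA; rewrite bE -addeA leeDl// adde_ge0.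
- move=> A mA AQ; rewrite bE diracE memNset; last first.
    by move=> /AQ; apply => i; rewrite !mxE subr0 normr0.
  rewrite adde0 (_ : nu A = 0) ?adde0//.
  by apply/eqP; rewrite -measure_le0 -nuQ; apply: le_measure; rewrite ?inE//; exact: measurableC.
have [|f [mf f0 fE]] := @density_exists _ _ _ beta nu.
  by move=> A mA; rewrite bE leeDr// adde_ge0.
(* A density is determined up to null sets only; cutting it off makes the bound on its support hold
   at every point. *)
pose q x : R := (f x * \1_Q x)%R.
have mq : measurable_fun setT q by apply: measurable_funM.
have q0 x : (0 <= q x)%R by rewrite mulr_ge0.
have nuE A : measurable A -> nu A = \int[beta]_(x in A) (q x)%:E.
  move=> mA; have -> : nu A = nu (A `&` Q).
    rewrite (measureDI nu mA mQ) [X in X + _](_ : _ = 0) ?add0e//.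
    apply/eqP; rewrite -measure_le0 -nuQ; apply: le_measure; rewrite ?inE//.
    - exact: measurableD.
    - exact: measurableC.
  rewrite fE; last exact: measurableI.
  rewrite integral_mkcondr; apply: eq_integral => x _.
  by rewrite patchE /q indicE; case: ifPn => _; rewrite ?mulr1 ?mulr0.
have q1 : \int[beta]_x (q x)%:E = 1 by rewrite -nuE// probability_setT.
have beta0 : beta [set 0%R] = 1.
  by rewrite bE leb_point// diracE mem_set// nu0 add0e adde0.
have sd : (0 < Num.sqrt d%:R :> R)%R by rewrite sqrtr_gt0 ltr0n.
(* Makes the bound sqrt d (2 r) on the final jump equal to 1/2. *)
pose r : R := (4 * Num.sqrt d%:R)^-1%R.
have r0 : (0 < r)%R by rewrite invr_gt0 mulr_gt0.
have mr : (0 < m + 2 * r)%R by rewrite ltr_wpDl// mulr_gt0.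
pose l : R := (r / (m + 2 * r))%R.
have l0 : (0 < l)%R by rewrite divr_gt0.
have l1 : (l <= 1)%R by rewrite ler_pdivrMr// mul1r; lra.
have [N0 NP] : exists N0, ((1 - l) ^+ N0.+1 * m <= r)%R.
  have c : ((1 - l) ^+ n * m)%R @[n --> \oo] --> (0 * m)%R.
    apply: cvgM; last exact: cvg_cst.
    by apply: cvg_expr; rewrite ger0_norm ?subr_ge0// ltrBlDr ltrDl.
  rewrite mul0r in c; move/cvgrPdist_le : c => /(_ _ r0) [n _ nP].
  exists n; have := nP n.+1 (leqnSn n); rewrite sub0r normrN; apply: le_trans.
  exact: ler_norm.
apply: (@contraction_W R d eta theta keta itheta th0 beta (@base_measure_cube R d nu) beta0
  gL q mgL gL0 lebE mq q0 q1 m r l N0) => //.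
- move=> y; rewrite /q mulf_eq0 negb_or => /andP[_].
  rewrite indicE pnatr_eq0 eqb0 negbK => /set_mem Qy i.
  by have := Qy i; rewrite mxE subr0.
- by rewrite /l divfK// gt_eqF.
- rewrite /r invfM le_eqVlt; apply/orP; left; apply/eqP; field.
  by rewrite gt_eqF.
Qed.

End finite_distance.


(** * The uniform measure on a ball *)

Section ball_measure.
Context {R : realType} {d : nat}.
Hypothesis d_gt0 : (0 < d)%N.
Variable delta : R.
Hypothesis delta0 : 0 < delta.

Lemma sqrt_dim_gt0 : 0 < Num.sqrt d%:R :> R.
Proof. by rewrite sqrtr_gt0 ltr0n. Qed.

Lemma leb_eball_lty : (leb d (@eball R d delta) < +oo)%E.
Proof.
apply: (@le_lt_trans _ _ (leb d (cube (0 : Rd R d) delta))).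
  apply: le_measure; rewrite ?inE; [exact: measurable_eball|exact: measurable_cube|].
  move=> x xd i; rewrite mxE subr0; apply: (le_trans (ler_coord_enorm _ _)).
  exact: ltW.
by have lc := @leb_cube R d 0 delta (ltW delta0); rewrite lc ltry.
Qed.

Lemma leb_eball_gt0 : (0 < leb d (@eball R d delta))%E.
Proof.
have sd := sqrt_dim_gt0.
pose a : R := delta / (2 * Num.sqrt d%:R).
have a0 : 0 < a by rewrite divr_gt0// mulr_gt0.
apply: (@lt_le_trans _ _ (leb d (cube (0 : Rd R d) a))).
  have lc := @leb_cube R d 0 a (ltW a0); rewrite lc lte_fin.
  by rewrite exprn_gt0// mulr_gt0.
apply: le_measure; rewrite ?inE; [exact: measurable_cube|exact: measurable_eball|].
move=> x xa; rewrite /eball/=; apply: (@le_lt_trans _ _ (Num.sqrt d%:R * a)).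
  by apply: enorm_le_sup => [|i]; [exact: ltW|have := xa i; rewrite mxE subr0].
rewrite (_ : _ * a = delta / 2); last by rewrite /a; field; rewrite gt_eqF.
by rewrite ltr_pdivrMr// ltr_pMr// ltr1n.
Qed.

Definition ball_density (x : Rd R d) : R :=
  (fine (leb d (@eball R d delta)))^-1 * \1_(eball delta) x.

Lemma ball_volume_gt0 : 0 < fine (leb d (@eball R d delta)).
Proof. by rewrite fine_gt0// leb_eball_gt0 leb_eball_lty. Qed.

Lemma measurable_ball_density : measurable_fun setT ball_density.
Proof.
by apply: measurable_funM => //; apply: measurable_indic; exact: measurable_eball.
Qed.

Lemma ball_density_ge0 x : 0 <= ball_density x.
Proof. by rewrite mulr_ge0// invr_ge0 ltW// ball_volume_gt0. Qed.

Lemma unif_ballE A : measurable A ->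
  (@unif_ball R d delta A = \int[leb d]_(x in A) (ball_density x)%:E)%E.
Proof.
move=> mA; rewrite /unif_ball /= /mnormalize /= /mrestr setTI.
rewrite gt_eqF ?leb_eball_gt0//= lt_eqF ?leb_eball_lty//=.
rewrite /ball_density; under eq_integral do rewrite EFinM.
have mB := @measurable_eball R d delta.
rewrite ge0_integralZl_EFin; [|exact: mA| | |by rewrite invr_ge0 ltW// ball_volume_gt0]; last 2 first.
- by move=> x _; rewrite lee_fin.
- by apply/measurable_EFinP; apply: measurable_funTS; exact: measurable_indic.
by rewrite integral_indic// muleC setIC.
Qed.

Lemma ball_density_mass : (\int[leb d]_x (ball_density x)%:E = 1)%E.
Proof. by rewrite -unif_ballE//; exact: probability_setT. Qed.

Lemma ball_density_neq0 x : ball_density x != 0 -> enorm x < delta.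
Proof.
rewrite /ball_density mulf_eq0 negb_or => /andP[_].
by rewrite indicE pnatr_eq0 eqb0 negbK => /set_mem.
Qed.

Lemma ball_densityE x : enorm x < delta ->
  ball_density x = (fine (leb d (@eball R d delta)))^-1.
Proof. by move=> xd; rewrite /ball_density indicE mem_set// mulr1. Qed.

End ball_measure.

(** Coordinatewise (p + w)^2 <= 5 p^2 + 5/4 w^2 with p = x - a y and w = (a - b) y. The weights 5
    and 5/4 keep the first two jumps of the cube chain within length [delta]. *)
Lemma enorm_sqr_affine_le (R : realType) (d : nat) (x y : Rd R d) (a b r : R) :
  (forall i, `|x ord0 i - a * y ord0 i| <= r) ->
  enorm (x - b *: y) ^+ 2 <= 5 * (d%:R * r ^+ 2) + 5 / 4 * (b - a) ^+ 2 * enorm y ^+ 2.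
Proof.
move=> xr; rewrite !enorm_sqr mulr_sumr.
have -> : 5 * (d%:R * r ^+ 2) = \sum_(i < d) 5 * r ^+ 2.
  by rewrite sumr_const card_ord -mulr_natl; ring.
rewrite -big_split/=; apply: ler_sum => i _; rewrite !mxE.
have r2 : (x ord0 i - a * y ord0 i) ^+ 2 <= r ^+ 2.
  by rewrite -real_normK ?num_real// lerXn2r ?nnegrE// (le_trans _ (xr i)).
set p := x ord0 i - a * y ord0 i in r2.
have -> : x ord0 i - b * y ord0 i = p + (a - b) * y ord0 i by rewrite /p; ring.
set w := (a - b) * y ord0 i.
have -> : 5 / 4 * (b - a) ^+ 2 * y ord0 i ^+ 2 = 5 / 4 * w ^+ 2 by rewrite /w; ring.
have : 0 <= (4 * p - w) ^+ 2 by exact: sqr_ge0.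
move: (r ^+ 2) r2 => t; nra.
Qed.

(** * Uniform densities on shrinking cubes *)

Section shrinking_cubes.
Local Open Scope ereal_scope.
Context {R : realType} {d : nat} (eta : R -> R) (theta : R -> R -> R).
Local Notation RR := (Rd R d * Rd R d)%type.
Hypotheses (d_gt0 : (0 < d)%N) (keta : weight_kernel d eta) (itheta : interpolation theta).
Variables (s c delta lam : R).
Hypotheses (s0 : (0 < s)%R) (c0 : (0 < c)%R) (delta0 : (0 < delta)%R).
Hypotheses (lam0 : (0 < lam)%R) (lam1 : (lam < 1)%R) (lams : (lam `^ s = 16^-1)%R).
Hypothesis eta_ge : forall y : Rd R d, (0 < enorm y <= delta)%R ->
  (c * enorm y `^ (- d%:R - s) <= eta (enorm y))%R.

Let sd : R := Num.sqrt d%:R.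
Let sd0 : (0 < sd)%R. Proof. exact: sqrt_dim_gt0. Qed.
Let sd2 : (sd ^+ 2 = d%:R)%R. Proof. by rewrite /sd sqr_sqrtr. Qed.

(** The divisor [sd] is the square root of [d], so that the cube fits into the Euclidean ball of
    radius (delta / 5) lam^k. *)
Definition cube_radius k : R := (delta / (5 * sd) * lam ^+ k)%R.
Local Notation rad := cube_radius.
Definition cube_density k : R := (((2 * rad k) ^+ d)^-1)%R.
Local Notation dens := cube_density.
(** A jump from the edge of the ball straight into a cube around 0 could be longer than [delta],
    beyond which [eta] has no lower bound. The first jump therefore goes halfway; the later ones
    forget where they start. *)
Definition cube_ratio (k : nat) : R := if k is 0%N then (1 / 2)%R else 0%R.
Local Notation ratio := cube_ratio.

Definition cube_kernel k (z : RR) : R :=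
  (dens k * \1_(cube 0 (rad k)) (z.1 - ratio k *: z.2))%R.
Local Notation kap := cube_kernel.
Local Notation q := (@ball_density R d delta).
Local Notation beta := (@leb R d).
Local Notation g := (chain beta kap q).

Lemma cube_radius_gt0 k : (0 < rad k)%R.
Proof. by rewrite mulr_gt0 ?exprn_gt0// divr_gt0// mulr_gt0. Qed.

Lemma cube_density_gt0 k : (0 < dens k)%R.
Proof. by rewrite invr_gt0 exprn_gt0// mulr_gt0// cube_radius_gt0. Qed.

Lemma lam_le k : (0 <= lam ^+ k <= 1)%R.
Proof.
by apply/andP; split; [apply: exprn_ge0; exact: ltW|apply: exprn_ile1; exact: ltW].
Qed.

Lemma cube_radius_le k : (rad k.+1 <= rad k)%R.
Proof.
rewrite /rad exprS mulrCA ler_piMl ?(ltW lam1)//.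
exact: ltW (cube_radius_gt0 k).
Qed.

Lemma cube_density_le k : (dens k <= dens k.+1)%R.
Proof.
have r0 j : (0 < 2 * rad j)%R by rewrite mulr_gt0// cube_radius_gt0.
rewrite /dens lef_pV2 ?posrE ?exprn_gt0//.
by rewrite lerXn2r ?nnegrE ?(ltW (r0 _))// ler_wpM2l// cube_radius_le.
Qed.

Lemma sd_cube_radius k : (sd * rad k = delta / 5 * lam ^+ k)%R.
Proof. by rewrite /rad; field; rewrite gt_eqF. Qed.

Lemma dim_cube_radius_sqr k : (d%:R * rad k ^+ 2 <= delta ^+ 2 / 25)%R.
Proof.
rewrite -sd2 -exprMn sd_cube_radius exprMn expr_div_n.
have -> : (5 ^+ 2 = 25 :> R)%R by ring.
rewrite ler_piMr ?divr_ge0 ?sqr_ge0//.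
by have /andP[h1 h2] := lam_le k; rewrite exprn_ile1.
Qed.

Lemma measurable_cube_kernel k : measurable_fun setT (kap k).
Proof.
by apply: measurable_funM => //; apply: measurable_indic_sub; exact: measurable_cube.
Qed.

Lemma cube_kernel_ge0 k z : (0 <= kap k z)%R.
Proof. by rewrite mulr_ge0// ltW// cube_density_gt0. Qed.

Lemma cube_kernel_le k z : (kap k z <= (fun=> dens k) z.1)%R.
Proof. by rewrite /kap ler_piMr ?(ltW (cube_density_gt0 k))// indicE; case: (_ \in _). Qed.

Lemma integral_cube_kernel k y : \int[beta]_x (kap k (x, y))%:E = 1.
Proof.
have cE x : \1_(cube 0%R (rad k)) (x - ratio k *: y)%R = \1_(cube (ratio k *: y)%R (rad k)) x :> R.
  rewrite !indicE; congr (nat_of_bool _)%:R; apply/idP/idP => /set_mem xy; apply/mem_set => i.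
    by have := xy i; rewrite !mxE subr0.
  by have := xy i; rewrite !mxE subr0.
rewrite /kap /=; under eq_integral do rewrite cE EFinM.
have mc : measurable (cube (ratio k *: y)%R (rad k)) by exact: measurable_cube.
rewrite ge0_integralZl_EFin; [|by []| | |exact: ltW (cube_density_gt0 k)]; last 2 first.
- by move=> x _; rewrite lee_fin.
- by apply/measurable_EFinP; exact: measurable_indic.
rewrite integral_indic// setIT.
have lc := @leb_cube R d (ratio k *: y)%R (rad k) (ltW (cube_radius_gt0 k)).
by rewrite [X in _ * X]lc -EFinM mulVf// expf_neq0// mulf_neq0// gt_eqF// cube_radius_gt0.
Qed.

Let mq : measurable_fun setT q := measurable_ball_density delta.
Let q0 : forall x, (0 <= q x)%R := ball_density_ge0 d_gt0 delta0.
Let q1 : \int[beta]_x (q x)%:E = 1 := ball_density_mass d_gt0 delta0.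

Let gd : forall k, is_density1 beta (g k) :=
  chain_density (M := fun k _ => dens k) measurable_cube_kernel cube_kernel_ge0
    cube_kernel_le integral_cube_kernel mq q0 q1.

Lemma cube_kernel_neq0 k (z : RR) : kap k z != 0%R ->
  forall i, (`|z.1 ord0 i - ratio k * z.2 ord0 i| <= rad k)%R.
Proof.
rewrite /kap mulf_eq0 negb_or => /andP[_]; rewrite indicE pnatr_eq0 eqb0 negbK.
by move=> /set_mem zk i; have := zk i; rewrite !mxE subr0.
Qed.

Lemma cube_kernelS_neq0 k (z : RR) : kap k.+1 z != 0%R ->
  forall i, (`|z.1 ord0 i| <= rad k.+1)%R.
Proof. by move=> kz i; have := cube_kernel_neq0 kz i; rewrite mul0r subr0. Qed.

Lemma chain_support2 k y : g k.+2 y != 0%R -> forall i, (`|y ord0 i| <= rad k.+1)%R.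
Proof. by move=> /chain_neq0 [x [kx _]]; exact: (cube_kernelS_neq0 kx). Qed.

Lemma first_kernel_bound (z : RR) : kap 0 z != 0%R -> q z.2 != 0%R ->
  (enorm z.1 ^+ 2 <= 41 / 80 * delta ^+ 2 /\ enorm (z.1 - z.2) <= delta)%R.
Proof.
move=> kz /(ball_density_neq0) z2.
have zz := cube_kernel_neq0 kz; have dr := dim_cube_radius_sqr 0.
have z22 : (enorm z.2 ^+ 2 <= delta ^+ 2)%R.
  by rewrite lerXn2r ?nnegrE ?enorm_ge0 ?ltW.
split.
  have := @enorm_sqr_affine_le R d _ _ _ 0%R _ zz; rewrite scale0r subr0 /= => /le_trans; apply.
  move: (d%:R * _)%R (enorm z.2 ^+ 2)%R (delta ^+ 2)%R dr z22 => X Y Z; lra.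
rewrite -(@ler_pXn2r _ 2)// ?nnegrE ?enorm_ge0 ?(ltW delta0)//.
have := @enorm_sqr_affine_le R d _ _ _ 1%R _ zz; rewrite scale1r /= => /le_trans; apply.
have := sqr_ge0 (enorm z.2).
move: (d%:R * _)%R (enorm z.2 ^+ 2)%R (delta ^+ 2)%R dr z22 => X Y Z; lra.
Qed.

Lemma chain_support1 y : g 1 y != 0%R -> (enorm y ^+ 2 <= 41 / 80 * delta ^+ 2)%R.
Proof. by move=> /chain_neq0 [x [kx qx]]; have [] := first_kernel_bound kx qx. Qed.

(** From level 2 on, level k lives on the cube of index k - 1, hence the division by [lam], which
    also absorbs the two initial jumps. *)
Lemma cube_jump k (z : RR) : (kap k z * g k z.2 != 0)%R ->
  (enorm (z.1 - z.2) <= delta /\ enorm (z.1 - z.2) <= delta / lam * lam ^+ k)%R.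
Proof.
rewrite mulf_eq0 negb_or => /andP[kz gz].
have dl : (delta <= delta / lam)%R by rewrite ler_pdivlMr// ler_piMr// ltW.
case: k kz gz => [|[|k]] kz gz.
- have [_ zd] := first_kernel_bound kz gz; split => //.
  by rewrite expr0 mulr1; exact: le_trans dl.
- have zd : (enorm (z.1 - z.2) <= delta)%R.
    rewrite -(@ler_pXn2r _ 2)// ?nnegrE ?enorm_ge0 ?(ltW delta0)//.
    have := @enorm_sqr_affine_le R d _ _ _ 1%R _ (cube_kernel_neq0 kz).
    rewrite scale1r /= => /le_trans; apply.
    have := chain_support1 gz; have := dim_cube_radius_sqr 1; have := sqr_ge0 (enorm z.2).
    have := sqr_ge0 delta.
    move: (d%:R * _)%R (enorm z.2 ^+ 2)%R (delta ^+ 2)%R => X Y Z; lra.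
  by split => //; rewrite expr1 divfK// gt_eqF.
- have zd : (enorm (z.1 - z.2) <= delta * lam ^+ k.+1)%R.
    apply: (@le_trans _ _ (sd * (2 * rad k.+1))%R).
      apply: enorm_le_sup => [|i]; first by rewrite mulr_ge0// ltW// cube_radius_gt0.
      rewrite !mxE; apply: (le_trans (ler_normB _ _)); rewrite mulr_natl mulr2n; apply: lerD.
        by apply: (le_trans (cube_kernelS_neq0 kz i)); exact: cube_radius_le.
      exact: (chain_support2 gz).
    rewrite mulrCA sd_cube_radius mulrA; have /andP[l0 _] := lam_le k.+1.
    by apply: ler_wpM2r => //; have := delta0; lra.
  split; last by rewrite exprS mulrA divfK ?gt_eqF.
  apply: (le_trans zd); rewrite ler_piMr ?(ltW delta0)//.
  by have /andP[] := lam_le k.+1.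
Qed.

Lemma cube_chain_near (e : R) : (0 < e)%R -> exists N, forall k, (N <= k)%N ->
  (forall y, g k y != 0%R -> (enorm y < e)%R) /\
  (forall z, kap k z != 0%R -> (enorm z.1 < e)%R).
Proof.
move=> e0.
have lc : (lam ^+ n * delta)%R @[n --> \oo] --> (0 * delta)%R.
  by apply: cvgM; [apply: cvg_expr; rewrite gtr0_norm|exact: cvg_cst].
rewrite mul0r in lc; move/cvgrPdist_le : lc => /(_ _ e0) [n _ nP].
have H k : (n <= k)%N -> (sd * rad k < e)%R.
  move=> nk; rewrite sd_cube_radius; have := nP k nk; rewrite sub0r normrN.
  have lk : (0 < lam ^+ k * delta)%R by rewrite mulr_gt0 ?exprn_gt0.
  rewrite gtr0_norm// => h; apply: lt_le_trans h.
  by rewrite mulrC mulrA ltr_pdivrMr// ltr_pMr// ltr1n.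
have B k (y : Rd R d) : (n <= k)%N -> (forall i, `|y ord0 i| <= rad k)%R -> (enorm y < e)%R.
  move=> nk yk; apply: le_lt_trans (H k nk); apply: enorm_le_sup => //.
  exact: ltW (cube_radius_gt0 k).
exists n.+2 => -[//|[//|k]]; rewrite !ltnS => nk; split => [y gy|z kz].
  by apply: (B k.+1); [exact: leqW|exact: chain_support2].
by apply: (B k.+2); [exact: leqW (leqW nk)|exact: cube_kernelS_neq0].
Qed.

(** The bound theta >= min suffices once the density at the landing point is at least that of level
    k at the start. For k = 0 both points lie in the ball, where the density is constant; for k >= 1
    level k + 1 equals [dens k] on its cube, and level k is nowhere larger than [dens (k - 1)]. *)
Lemma cube_theta k (z : RR) : z.1 != z.2 -> (kap k z * g k z.2 != 0)%R ->
  (kap k z * g k z.2 <= dens k * theta ((g k z.1 + g k.+1 z.1) * (cst 1 z.2))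
    ((cst 1 z.1) * (g k z.2 + g k.+1 z.2)))%R.
Proof.
move=> _ kgz; rewrite !fctE mulr1 mul1r.
have g0 j x : (0 <= g j x)%R by have [] := gd j.
move: (kgz); rewrite mulf_eq0 negb_or => /andP[kz gz].
apply: ler_pM => //; [exact: cube_kernel_ge0|exact: (cube_kernel_le k z)|].
apply: le_trans (itp_ge_min itheta _ _); [|by rewrite addr_ge0..].
rewrite le_min lerDl g0 andbT.
case: k kz gz {kgz} => [|k] kz gz.
  have [z1 _] := first_kernel_bound kz gz.
  have z1d : (enorm z.1 < delta)%R.
    rewrite -(@ltr_pXn2r _ 2)// ?nnegrE ?enorm_ge0 ?(ltW delta0)//.
    apply: (le_lt_trans z1); have : (0 < delta ^+ 2)%R by exact: exprn_gt0.
    by move: (delta ^+ 2)%R => Z; lra.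
  by rewrite /= (ball_densityE z1d) -(ball_densityE (ball_density_neq0 gz)) lerDl; exact: (g0 1%N).
have -> : g k.+2 z.1 = dens k.+1.
  apply: EFin_inj; rewrite (chainSE (M := fun k _ => dens k) measurable_cube_kernel cube_kernel_ge0
    cube_kernel_le integral_cube_kernel mq q0 q1).
  have kE y : kap k.+1 (z.1, y) = dens k.+1.
    rewrite /kap indicE mem_set ?mulr1// => i; rewrite !mxE mul0r !subr0.
    exact: (cube_kernelS_neq0 kz).
  under eq_integral do rewrite kE EFinM.
  have [mg _ g1] := gd k.+1.
  rewrite ge0_integralZl_EFin; [by rewrite g1 mule1|by []| | |exact: ltW (cube_density_gt0 _)].
  - by move=> y _; rewrite lee_fin.
  - exact/measurable_EFinP.
apply: (@le_trans _ _ (dens k)); last first.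
  by apply: (le_trans (cube_density_le k)); rewrite lerDr.
have := kernel_step_fin (M := fun k _ => dens k) cube_kernel_ge0 cube_kernel_le k z.2 (gd k).
by rewrite -(chainSE (M := fun k _ => dens k) measurable_cube_kernel cube_kernel_ge0
    cube_kernel_le integral_cube_kernel mq q0 q1) lee_fin.
Qed.

Definition inverse_bound k : R := ((delta / lam * lam ^+ k) `^ (d%:R + s) / c)%R.

Lemma cube_profile k (z : RR) : z.1 != z.2 -> (kap k z * g k z.2 != 0)%R ->
  (1 <= inverse_bound k * pair_profile eta z)%R.
Proof.
move=> z12 kgz; have [zd zl] := cube_jump kgz.
have z0 : (0 < enorm (z.1 - z.2))%R by rewrite enorm_gt0 subr_eq0.
rewrite /pair_profile /profile z0.
have L0 : (0 < delta / lam * lam ^+ k)%R by rewrite mulr_gt0 ?exprn_gt0// divr_gt0.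
have := eta_ge (y := (z.1 - z.2)%R); rewrite z0 zd => /(_ isT).
rewrite /inverse_bound -opprD powRN.
set t := enorm _ in z0 zl *; set L := (delta / lam * _)%R in zl L0 *.
have p0 : (0 <= d%:R + s)%R by rewrite addr_ge0// ltW.
have tp : (0 < t `^ (d%:R + s))%R by exact: powR_gt0.
have tL : (t `^ (d%:R + s) <= L `^ (d%:R + s))%R.
  by apply: ge0_ler_powR => //; rewrite nnegrE ltW.
move: (t `^ _)%R (L `^ _)%R tp tL => T LL T0 TL ce.
apply: (@le_trans _ _ (LL / c * (c / T))%R); last first.
  by apply: ler_wpM2l => //; rewrite divr_ge0 ?(ltW c0)// (le_trans (ltW T0)).
rewrite mulrA divfK ?gt_eqF// ler_pdivlMr// mul1r //.
Qed.

Let A : R := (16 / c * (5 * sd / (2 * lam)) ^+ d)%R.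

(* lam^s = 1/16 beats the factor 8^k paid for the dyadic time scales. *)
Lemma cube_cost k : (8 ^+ k * (dens k * inverse_bound k) = A * delta `^ s * (1 / 2) ^+ k)%R.
Proof.
have lk0 : (0 < lam ^+ k)%R by rewrite exprn_gt0.
have dl0 : (0 < delta / lam)%R by rewrite divr_gt0.
have lks : ((lam ^+ k) `^ s = (16 ^+ k)^-1)%R.
  elim: k {lk0} => [|k ih]; first by rewrite !expr0 powR1 invr1.
  by rewrite !exprS powRM ?exprn_ge0 ?(ltW lam0)// ih lams invfM.
have dls : ((delta / lam) `^ s = 16 * delta `^ s)%R.
  have : (delta `^ s = (delta / lam) `^ s * lam `^ s)%R.
    by rewrite -powRM ?(ltW dl0) ?(ltW lam0)// divfK// gt_eqF.
  by rewrite lams => ->; rewrite mulrCA divff ?mulr1 ?pnatr_eq0.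
have pd (x : R) : (0 < x -> x `^ (d%:R + s) = x ^+ d * x `^ s)%R.
  by move=> x0; rewrite powRD ?(gt_eqF x0) ?implybT// powR_mulrn// ltW.
rewrite /inverse_bound powRM ?(ltW dl0) ?(ltW lk0)// !pd// lks dls.
rewrite /dens /rad /A !exprMn !exprVn !invfM.
have -> : (16 ^+ k = 8 ^+ k * 2 ^+ k :> R)%R by rewrite -exprMn -natrM.
rewrite expr1n !exprMn.
have n1 : ((lam ^+ k) ^+ d != 0)%R by rewrite expf_neq0// gt_eqF.
have n2 : (lam ^+ d != 0)%R by rewrite expf_neq0// gt_eqF.
have n3 : (delta ^+ d != 0)%R by rewrite expf_neq0// gt_eqF.
have n4 : (sd ^+ d != 0)%R by rewrite expf_neq0// gt_eqF.
have n5 : (5 ^+ d != 0 :> R)%R by rewrite expf_neq0// pnatr_eq0.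
have n6 : (2 ^+ d != 0 :> R)%R by rewrite expf_neq0// pnatr_eq0.
have n7 : (8 ^+ k != 0 :> R)%R by rewrite expf_neq0// pnatr_eq0.
have n8 : (2 ^+ k != 0 :> R)%R by rewrite expf_neq0// pnatr_eq0.
have n9 : (c != 0)%R by rewrite gt_eqF.
move: n1 n2 n3 n4 n5 n6 n7 n8 n9.
move: ((lam ^+ k) ^+ d)%R (lam ^+ d)%R (delta ^+ d)%R (sd ^+ d)%R (5 ^+ d : R)%R
  (2 ^+ d : R)%R (8 ^+ k : R)%R (2 ^+ k : R)%R (delta `^ s)%R c.
move=> x1 x2 x3 x4 x5 x6 x7 x8 x9 x10 n1 n2 n3 n4 n5 n6 n7 n8 n9.
by field; rewrite n1 n2 n3 n4 n5 n6 n7 n8 n9.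
Qed.

Lemma geometric_half_le n : (\sum_(k < n) (1 / 2) ^+ k <= 2 :> R)%R.
Proof.
have : (\sum_(k < n) (1 / 2) ^+ k = 2 - 2 * (1 / 2) ^+ n :> R)%R.
  elim: n => [|n ih]; first by rewrite big_ord0 expr0 mulr1 subrr.
  by rewrite big_ord_recr/= ih exprS; field.
by move=> ->; rewrite lerBlDr lerDl mulr_ge0// exprn_ge0// divr_ge0.
Qed.

Lemma W_unif_ball_le :
  W eta theta (\d_(0%R : Rd R d)) (unif_ball delta) <=
  (Num.sqrt (600 * (A * delta `^ s * 2)))%:E.
Proof.
have A0 : (0 <= A * delta `^ s)%R.
  rewrite mulr_ge0 ?powR_ge0// /A mulr_ge0 ?divr_ge0 ?(ltW c0)//.
  by rewrite exprn_ge0// divr_ge0// mulr_ge0// ltW.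
have bfin r : beta (cube 0%R r) < +oo.
  apply: (@le_lt_trans _ _ (leb d (cube (0%R : Rd R d) `|r|%R))).
    apply: le_measure; rewrite ?inE; [exact: measurable_cube|exact: measurable_cube|].
    by move=> x xr i; apply: (le_trans (xr i)); exact: ler_norm.
  by have lc := @leb_cube R d 0%R `|r|%R (normr_ge0 _); rewrite lc ltry.
have leb1 B : measurable B -> leb d B = \int[beta]_(x in B) (cst 1 x)%:E.
  move=> mB; apply: esym; apply: (@etrans _ _ (\int[beta]_(x in B) (cst 1 x))) => //.
  by rewrite integral_cst// mul1e.
apply: (@chain_W_le R d eta theta keta itheta beta bfin (cst 1%R) (measurable_cst _)
  (fun=> ler01) leb1 kap (fun k _ => dens k) q measurable_cube_kernel
  cube_kernel_ge0 cube_kernel_le integral_cube_kernel mq q0 q1 cube_chain_near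
  dens inverse_bound).
- by move=> k; exact: ltW (cube_density_gt0 k).
- by move=> k; rewrite divr_ge0 ?powR_ge0// ltW.
- exact: cube_profile.
- exact: cube_theta.
- move=> n; under eq_bigr do rewrite cube_cost.
  by rewrite -mulr_sumr ler_wpM2l// geometric_half_le.
- by move=> B mB; exact: unif_ballE.
Qed.

End shrinking_cubes.



(** * The bounds in terms of the distance *)

Section final_bounds.
Context {R : realType} {d : nat} (theta : R -> R -> R).
Hypotheses (d_gt0 : (0 < d)%N) (itheta : interpolation theta).

(** The set off which the Dirac mass vanishes contains 0 and is [nu]-null. *)
Lemma singular_dirac_point (nu : probability (Rd R d) R) :
  mutually_singular nu (\d_(0%R : Rd R d)) -> nu [set 0] = 0%E.
Proof.
move=> [A [mA nuA dA]].
have A0 : A 0.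
  apply: contrapT => nA; move: dA; rewrite diracE mem_set// => /eqP.
  by rewrite onee_eq0.
apply/eqP; rewrite -measure_le0 -nuA; apply: le_measure; rewrite ?inE//.
- exact: measurable_point_Rd.
- by move=> x ->.
Qed.

Lemma W_dirac_infinite (eta : R -> R) (nu : probability (Rd R d) R) : weight_kernel d eta ->
  nu [set 0] = 0%E -> (\int[leb d]_(y in eball 1) (eta (enorm y))%:E < +oo)%E ->
  theta 1 0 = 0 -> W eta theta (\d_(0%R : Rd R d)) nu = +oo%E.
Proof.
move=> keta nu0 Hoo th0.
have Hf := integral_profile_lty keta d_gt0 Hoo.
have HE : (\int[leb d]_y (profile eta (enorm y))%:E =
    (fine (\int[leb d]_y (profile eta (enorm y))%:E))%:E)%E.
  by rewrite fineK// ge0_fin_numE// ltW// integral_profile_gt0.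
rewrite /W (_ : ereal_inf _ = +oo%E)//.
apply/eqP; rewrite -leye_eq; apply: le_ereal_inf_tmp => a [mu [j [ce ->]]].
by rewrite (action_infinite d_gt0 keta itheta nu0 ce HE th0).
Qed.

Lemma W_dirac_lower_bound (eta : R -> R) (nu : probability (Rd R d) R) : weight_kernel d eta ->
  nu [set 0] = 0%E -> (\int[leb d]_(y in eball 1) (eta (enorm y))%:E < +oo)%E ->
  ((2 * (\int[leb d]_y eta (enorm y)) `^ (- 2^-1))%:E <= W eta theta (\d_(0%R : Rd R d)) nu)%E.
Proof.
move=> keta nu0 Hoo.
have Hf := integral_profile_lty keta d_gt0 Hoo.
have Hp := integral_profile_gt0 keta d_gt0.
have HE : (\int[leb d]_y (profile eta (enorm y))%:E =
    (fine (\int[leb d]_y (profile eta (enorm y))%:E))%:E)%E.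
  by rewrite fineK// ge0_fin_numE// ltW.
rewrite /Rintegral (integral_eta_profile keta d_gt0 measurableT).
move: HE; set H := fine _ => HE.
have H0 : 0 < H by rewrite -lte_fin -HE.
have -> : 2 * H `^ (- 2^-1) = Num.sqrt (4 / H).
  rewrite powRN powR12_sqrt ?(ltW H0)// sqrtrM// sqrtrV ?(ltW H0)//.
  by rewrite (_ : 4 = 2 ^+ 2 :> R) ?sqrtr_sqr ?ger0_norm//; ring.
have E4 : ((4 / H)%:E <= ereal_inf [set a | exists (mu : R -> probability (Rd R d) R)
    (j : R -> Mloc (Gset eta)), CE (\d_(0%R : Rd R d)) nu mu j /\
    a = \int[@lebesgue_measure R]_(t in `[0%R, 1%R]) action theta (mu t) (j t)])%E.
  apply: le_ereal_inf_tmp => a [mu [j [ce ->]]].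
  exact: (action_lower_bound d_gt0 keta itheta nu0 ce HE).
have h4 : (0 <= (4 / H)%:E)%E by rewrite lee_fin divr_ge0// ltW.
by rewrite /W -[X in (X <= _)%E]/(sqrte (4 / H)%:E) lee_sqrt// (le_trans h4).
Qed.

Lemma W_unif_ball_bound (s c : R) : 0 < s -> 0 < c ->
  exists C : R, forall (eta : R -> R) (delta : R), weight_kernel d eta -> 0 < delta ->
    (forall y : Rd R d, 0 < enorm y <= delta ->
      c * enorm y `^ (- d%:R - s) <= eta (enorm y)) ->
    (W eta theta (\d_(0%R : Rd R d)) (unif_ball delta) <= (C * delta `^ (s / 2))%:E)%E.
Proof.
move=> s0 c0; pose lam : R := 16 `^ (- s^-1).
have lam0 : 0 < lam by exact: powR_gt0.
have lams : lam `^ s = 16^-1.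
  by rewrite /lam -powRrM mulNr mulVf ?gt_eqF// powR_inv1.
have lam1 : lam < 1.
  rewrite ltNge; apply/negP => lam1.
  have : 1 `^ s <= lam `^ s by apply: ge0_ler_powR; rewrite ?nnegrE ?(ltW s0) ?(ltW lam0).
  by rewrite powR1 lams; apply/negP; rewrite -ltNge invf_lt1 ?ltr1n.
pose A : R := 16 / c * (5 * Num.sqrt d%:R / (2 * lam)) ^+ d.
have A0 : 0 <= A.
  rewrite mulr_ge0 ?divr_ge0 ?(ltW c0)// exprn_ge0// divr_ge0 ?mulr_ge0 ?sqrtr_ge0//.
  exact: ltW.
exists (Num.sqrt (600 * (A * 2))) => eta delta keta delta0 eta_ge.
have := W_unif_ball_le d_gt0 keta itheta s0 c0 delta0 lam0 lam1 lams eta_ge.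
rewrite -/A (_ : 600 * (A * delta `^ s * 2) = 600 * (A * 2) * delta `^ s); last by ring.
rewrite sqrtrM; last by apply: mulr_ge0; [exact: ler0n|rewrite mulr_ge0].
by rewrite -(powR12_sqrt (powR_ge0 delta s)) -powRrM.
Qed.

Lemma unif_ball_singular_dirac (delta : R) : 0 < delta ->
  mutually_singular (@unif_ball R d delta) (\d_(0%R : Rd R d)).
Proof.
move=> delta0; exists [set 0]; split.
- exact: measurable_point_Rd.
- apply/eqP; rewrite eq_le measure_ge0 andbT unif_ballE//; last exact: measurable_point_Rd.
  have V0 := ball_volume_gt0 d_gt0 delta0.
  apply: (@le_trans _ _ (\int[leb d]_(x in [set 0%R])
      (cst (fine (leb d (@eball R d delta)))^-1%:E x))%E).
    apply: ge0_le_integral_nonmeas => x _; rewrite lee_fin; first exact: ball_density_ge0.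
    by rewrite /ball_density ler_piMr ?invr_ge0 ?(ltW V0)// indicE; case: (_ \in _).
  have m0 : measurable ([set 0] : set (Rd R d)) by exact: measurable_point_Rd.
  have l0 : leb d [set (0 : Rd R d)] = 0%E by exact: leb_point.
  by rewrite integral_cst// [X in (_ * X)%E]l0 mule0.
- by rewrite diracE memNset// => /(_ erefl).
Qed.

(** The lower bound on [eta] persists for every radius below [delta] with the same constant, so the
    estimate for uniform measures can be used as the radius tends to 0. *)
Lemma inf_W_singular_eq0 (eta : R -> R) : weight_kernel d eta ->
  (exists s delta c : R, [/\ 0 < s, 0 < delta, 0 < c &
    forall y : Rd R d, 0 < enorm y <= delta ->
      c * enorm y `^ (- d%:R - s) <= eta (enorm y)]) ->
  ereal_inf [set W eta theta (\d_(0%R : Rd R d)) nu' | nu' in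
    [set nu' : probability (Rd R d) R | mutually_singular nu' (\d_(0%R : Rd R d))]] = 0%E.
Proof.
move=> keta [s [delta [c [s0 delta0 c0 eta_ge]]]].
have [C CP] := W_unif_ball_bound s0 c0.
apply/eqP; rewrite eq_le; apply/andP; split; last first.
  by apply: le_ereal_inf_tmp => _ [nu' _ <-]; exact: sqrte_ge0.
apply/lee_addgt0Pr => e e0; rewrite add0e.
have C1 : 0 < `|C| + 1 by rewrite ltr_wpDl.
(* The radius at which r^(s/2) = e / (|C| + 1); the summand 1 avoids a division by 0. *)
pose r : R := (e / (`|C| + 1)) `^ (2 / s).
have r0 : 0 < r by rewrite powR_gt0// divr_gt0.
pose a := Num.min delta r.
have a0 : 0 < a by rewrite lt_min delta0.
apply: (@le_trans _ _ (W eta theta (\d_(0%R : Rd R d)) (unif_ball a))).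
  apply: ereal_inf_lbound; exists (unif_ball a) => //.
  exact: unif_ball_singular_dirac.
apply: (le_trans (CP eta a keta a0 _)).
  move=> y /andP[y0 ya]; apply: eta_ge; rewrite y0 (le_trans ya)//.
  by rewrite ge_min lexx.
rewrite lee_fin; apply: (@le_trans _ _ (`|C| * r `^ (s / 2))).
  apply: (@le_trans _ _ (`|C| * a `^ (s / 2))).
    by apply: ler_wpM2r; [exact: powR_ge0|exact: ler_norm].
  apply: ler_wpM2l => //.
  apply: ge0_ler_powR; rewrite ?nnegrE ?divr_ge0 ?(ltW s0) ?(ltW a0) ?(ltW r0)//.
  by rewrite ge_min lexx orbT.
rewrite /r -powRrM (_ : 2 / s * (s / 2) = 1); last by field; rewrite gt_eqF.
rewrite powRr1; last by rewrite divr_ge0// ltW.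
by rewrite mulrA ler_pdivrMr// mulrC ler_wpM2l ?(ltW e0)// lerDl.
Qed.

End final_bounds.

Theorem proposition1p1 (R : realType) (d : nat) (d_gt0 : (0 < d)%N)
    (theta : R -> R -> R) (itheta : interpolation theta) :
  let delta0 : probability (Rd R d) R := \d_(0 : Rd R d) in
  (forall (eta : R -> R) (nu : probability (Rd R d) R),
     weight_kernel d eta ->
     compactly_supported nu -> mutually_singular nu delta0 ->
     (\int[leb d]_(y in eball 1) (eta (enorm y))%:E < +oo)%E ->
     (theta 1 0 = 0 -> W eta theta delta0 nu = +oo%E) /\
     (0 < theta 1 0 ->
        (W eta theta delta0 nu < +oo)%E /\
        ((2 * (\int[leb d]_y eta (enorm y)) `^ (- 2^-1))%:E
           <= W eta theta delta0 nu)%E)) /\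
  (forall s c : R, 0 < s -> 0 < c ->
     exists C : R, forall (eta : R -> R) (delta : R),
       weight_kernel d eta -> 0 < delta ->
       (forall y : Rd R d, 0 < enorm y <= delta ->
          c * enorm y `^ (- d%:R - s) <= eta (enorm y)) ->
       (W eta theta delta0 (unif_ball delta)
          <= (C * delta `^ (s / 2))%:E)%E) /\
  (forall eta : R -> R,
     weight_kernel d eta ->
     (exists s delta c : R, [/\ 0 < s, 0 < delta, 0 < c &
        forall y : Rd R d, 0 < enorm y <= delta ->
          c * enorm y `^ (- d%:R - s) <= eta (enorm y)]) ->
     ereal_inf [set W eta theta delta0 nu' | nu' in
        [set nu' : probability (Rd R d) R | mutually_singular nu' delta0]]
       = 0%E).

Proof.
move=> delta0; split; [|split].
- move=> eta nu keta nuc /singular_dirac_point nu0 Hoo; split => [th0|th0].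
    exact: W_dirac_infinite.
  by split; [exact: W_dirac_lty|exact: W_dirac_lower_bound].
- by move=> s c s0 c0; exact: W_unif_ball_bound.
- by move=> eta keta H; exact: inf_W_singular_eq0.
Qed.
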